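(* Let $G$ be a locally elliptic group, $(K_i)_{i\in\mathbb{N}}$ a standard decomposition of $G$, $(\Phi,\Psi)$ a complementary pair of Young functions and $\omega$ an $L^\Phi$-weight on $G$ with $1/\omega\in L^\Psi(G)$. Let $\mu$ be the Haar measure on $G$ normalised so that $\mu(K_1)=1$, put $a_i:=\sup\{\omega(x):x\in K_i\}$ for $i\in\mathbb{N}$, and define the weight $$\omega^\sharp_1:=(a_1+1)\chi_{K_1}+\sum_{i=2}^\infty (a_i+i^2)\,\mu(K_i\setminus K_{i-1})\,\chi_{K_i\setminus K_{i-1}}.$$ Then for all $f\in L^\Phi(G,\omega^\sharp_1)\subseteq L^\Phi(G,\omega)$, $$\nu_{L^\Phi(G,\omega)}(f)=\nu_{L^1(G)}(f).$$
   Context: Locally elliptic groups: a locally compact group $G$ is locally elliptic if every compact subset of $G$ generates a relatively compact subgroup. By the paper's standing convention, such a $G$ is non-compact and is a countable increasing union of compact open subgroups $K_1\le K_2\le\cdots$. Such groups are unimodular; integration is with respect to a fixed Haar measure. A standard decomposition of $G$ is a sequence $(K_i)_{i\in\mathbb{N}}$ of compact open subgroups with $K_i\le K_{i+1}$, $G=\bigcup_i K_i$, and $([K_{i+1}:K_i])_{i\ge1}$ non-decreasing. $\chi_U$ is the characteristic function of $U$. Young functions: a Young function is a convex even function $\Phi:\mathbb{R}\to[0,\infty]$ with $\Phi(0)=0$ and $\lim_{x\to\infty}\Phi(x)=+\infty$. Its complementary Young function is $\Psi(y)=\sup\{x|y|-\Phi(x):x\ge0\}$, and $(\Phi,\Psi)$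 is then called a complementary pair. Orlicz spaces: $L^\Phi(G)$ is the space of measurable $f:G\to\mathbb{C}$ (modulo a.e. equality) with $\int_G\Phi(\alpha|f|)\,dx<\infty$ for some $\alpha>0$, with norm $\|f\|_{L^\Phi(G)}=\sup\{\int_G|fg|\,dx:\int_G\Psi(|g|)\,dx\le1\}$. Weights: a weight on $G$ is a measurable function $\omega:G\to[1,\infty)$ that is bounded on compact sets, satisfies $\omega(xy)\le\omega(x)\omega(y)$ and $\omega(x)=\omega(x^{-1})$. $L^\Phi(G,\omega)=\{f\in L^\Phi(G):\|f\omega\|_{L^\Phi(G)}<\infty\}$ with norm $\|f\|_{L^\Phi(G,\omega)}=\|f\omega\|_{L^\Phi(G)}$. $\omega$ is an $L^\Phi$-weight if $L^\Phi(G,\omega)$ is a Banach $*$-algebra under convolution and the involution $f^*(x)=\overline{f(x^{-1})}$ (the norm being submultiplicative possibly only up to a constant, i.e. after passing to an equivalent norm). If $1/\omega\in L^\Psi(G)$ then $L^\Phi(G,\omega)\subseteq L^1(G)$. $\nu_{\mathcal{A}}(f)$ denotes the spectral radius of $f$ in the Banach algebra $\mathcal{A}$. *)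

(* Defs.v *)
From HB Require Import structures.
From mathcomp Require Import all_boot all_order all_algebra.
From mathcomp Require Import all_classical all_reals all_analysis.
From mathcomp Require Export complex.

Set Implicit Arguments.
Unset Strict Implicit.
Unset Printing Implicit Defensive.

Import Order.TTheory GRing.Theory Num.Theory.
Import numFieldNormedType.Exports.

Local Open Scope classical_set_scope.
Local Open Scope ring_scope.
Local Open Scope complex_scope.

(** * Topological groups *)

HB.mixin Record PointedTopologicalGroup_isTopologicalGroup G
    of Group G & PointedTopological G := {
  mulg_continuous : continuous (fun z : G * G => (z.1 * z.2)%g) ;
  invg_continuous : continuous (fun x : G => x^-1%g)
}.

(* The base point plays no role; it is there because the library equips
   generated sigma-algebras with a measurable structure on pointed types. *)
#[short(type="topologicalGroupType")]
HB.structure Definition TopologicalGroup :=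
  {G of PointedTopologicalGroup_isTopologicalGroup G
      & Group G & PointedTopological G}.

Definition is_subgroup (G : groupType) (H : set G) : Prop :=
  [/\ H 1%g, forall x y, H x -> H y -> H (x * y)%g
    & forall x, H x -> H x^-1%g].

Definition cosets (G : groupType) (H L : set G) : set (set G) :=
  [set (fun y => x * y)%g @` L | x in H].

Definition locally_elliptic (G : topologicalGroupType) : Prop :=
  [/\ hausdorff_space G, locally_compact [set: G]
    & forall C : set G, compact C -> precompact (smallest (@is_subgroup G) C)].

(* The sequence is indexed from 1: [K 0] is irrelevant. The indices of
   consecutive groups are compared as cardinals of coset spaces. *)
Definition standard_decomposition (G : topologicalGroupType)
    (K : nat -> set G) : Prop :=
  [/\ forall i, (1 <= i)%N -> [/\ is_subgroup (K i), compact (K i) & open (K i)],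
      forall i, (1 <= i)%N -> K i `<=` K i.+1,
      \bigcup_(i in [set i | (1 <= i)%N]) K i = [set: G]
    & forall i, (1 <= i)%N ->
        (cosets (K i.+1) (K i) #<= cosets (K i.+2) (K i.+1))%card].

(** * Haar measure *)

Notation borel G := (g_sigma_algebraType (@open G)).

Record haar_measure (R : realType) (G : topologicalGroupType)
    (mu : {measure set (borel G) -> \bar R}) : Prop := {
  haar_neq0 : mu setT != 0%E ;
  haar_translate : forall (x : G) (A : set (borel G)), measurable A ->
    mu ((fun y : G => x * y)%g @` A) = mu A ;
  haar_compact : forall C : set G, compact C -> (mu C < +oo)%E ;
  haar_outer_regular : forall A : set (borel G), measurable A ->
    mu A = ereal_inf [set mu U | U in [set U : set G | open U /\ A `<=` U]] ;
  haar_inner_regular : forall U : set G, open U ->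
    mu U = ereal_sup [set mu C | C in [set C : set G | compact C /\ C `<=` U]]
}.

(** * Young functions *)

Record young_function (R : realType) (Phi : R -> \bar R) : Prop := {
  young_ge0 : forall x : R, (0 <= Phi x)%E ;
  young_even : forall x : R, Phi (- x) = Phi x ;
  young_convex : forall t x y : R, 0 <= t <= 1 ->
    (Phi (t * x + (1 - t) * y)%R <= t%:E * Phi x + (1 - t)%R%:E * Phi y)%E ;
  young0 : Phi 0 = 0%E ;
  young_cvg : Phi x @[x --> +oo] --> +oo%E
}.

Definition complementary (R : realType) (Phi : R -> \bar R) (y : R) : \bar R :=
  ereal_sup [set ((x * `|y|)%R%:E - Phi x)%E | x in [set x : R | 0 <= x]].

Definition complementary_pair (R : realType) (Phi Psi : R -> \bar R) : Prop :=
  [/\ young_function Phi, young_function Psi & Psi = complementary Phi].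

(** * Function spaces *)

(* Elements of function spaces are represented by functions [G -> R[i]];
   equality in the spaces is equality almost everywhere. *)
Section function_spaces.
Variables (R : realType) (G : topologicalGroupType).
Variable mu : {measure set (borel G) -> \bar R}.
Implicit Types (f g h : G -> R[i]) (Phi : R -> \bar R) (omega : G -> R).

Definition modulus : R[i] -> R := @ComplexField.Normc.normc R.

Definition cmeasurable f : Prop :=
  measurable_fun [set: borel G] (fun x : borel G => complex.Re (f x)) /\
  measurable_fun [set: borel G] (fun x : borel G => complex.Im (f x)).

Definition cintegral f : R[i] :=
  (\int[mu]_x complex.Re (f x)) +i* (\int[mu]_x complex.Im (f x)).

Definition L1 : set (G -> R[i]) :=
  [set f | cmeasurable f /\ (\int[mu]_x (modulus (f x))%:E < +oo)%E].

Definition orlicz Phi : set (G -> R[i]) :=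
  [set f | cmeasurable f /\
    exists2 alpha : R, 0 < alpha
      & (\int[mu]_x Phi (alpha * modulus (f x))%R < +oo)%E].

Definition orlicz_norm Phi f : \bar R :=
  ereal_sup [set (\int[mu]_x (modulus (f x * g x))%:E)%E | g in
    [set g | cmeasurable g /\
      (\int[mu]_x complementary Phi (modulus (g x)) <= 1)%E]].

Definition weighted_orlicz_norm Phi omega f : \bar R :=
  orlicz_norm Phi (fun x => f x * (omega x)%:C).

Definition weighted_orlicz Phi omega : set (G -> R[i]) :=
  [set f | orlicz Phi f /\ (weighted_orlicz_norm Phi omega f < +oo)%E].

(* Where [y |-> f y * g (y^-1 x)] is not integrable the value is arbitrary. *)
Definition convolution f g : G -> R[i] :=
  fun x => cintegral (fun y : G => f y * g (y^-1 * x)%g).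

Definition star f : G -> R[i] := fun x => (f x^-1%g)^*.

Definition aeq f g : Prop := {ae mu, forall x : borel G, f x = g x}.

(* [A], normed by [N], is a Banach *-algebra for [convolution] and [star]; the norm is
   submultiplicative up to a constant. *)
Record banach_star_algebra (A : set (G -> R[i])) (N : (G -> R[i]) -> \bar R) :
    Prop := {
  bsa_zero : A (fun=> 0) ;
  bsa_add : forall f g, A f -> A g -> A (f \+ g) ;
  bsa_scale : forall (c : R[i]) f, A f -> A (fun x => c * f x) ;
  bsa_norm_fin : forall f, A f -> (0 <= N f < +oo)%E ;
  bsa_norm_eq0 : forall f, A f -> (N f = 0%E <-> aeq f (fun=> 0)) ;
  bsa_norm_add : forall f g, A f -> A g -> (N (f \+ g)%R <= N f + N g)%E ;
  bsa_norm_scale : forall (c : R[i]) f, A f ->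
    N (fun x => c * f x) = ((modulus c)%:E * N f)%E ;
  bsa_complete : forall u : nat -> G -> R[i], (forall n, A (u n)) ->
    (forall eps : R, 0 < eps -> exists n0, forall m n,
      (n0 <= m)%N -> (n0 <= n)%N -> (N (u m \- u n)%R < eps%:E)%E) ->
    exists2 l, A l & (fun n => N (u n \- l)) @ \oo --> 0%E ;
  bsa_conv : forall f g, A f -> A g -> A (convolution f g) ;
  bsa_convA : forall f g h, A f -> A g -> A h ->
    aeq (convolution f (convolution g h)) (convolution (convolution f g) h) ;
  bsa_convDl : forall f g h, A f -> A g -> A h ->
    aeq (convolution (f \+ g) h) (convolution f h \+ convolution g h) ;
  bsa_convDr : forall f g h, A f -> A g -> A h ->
    aeq (convolution f (g \+ h)) (convolution f g \+ convolution f h) ;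
  bsa_convZl : forall (c : R[i]) f g, A f -> A g ->
    aeq (convolution (fun x => c * f x) g) (fun x => c * convolution f g x) ;
  bsa_convZr : forall (c : R[i]) f g, A f -> A g ->
    aeq (convolution f (fun x => c * g x)) (fun x => c * convolution f g x) ;
  bsa_norm_conv : exists2 M : R, 0 < M & forall f g, A f -> A g ->
    (N (convolution f g) <= M%:E * N f * N g)%E ;
  bsa_star : forall f, A f -> A (star f) ;
  bsa_norm_star : forall f, A f -> N (star f) = N f ;
  bsa_star_conv : forall f g, A f -> A g ->
    aeq (star (convolution f g)) (convolution (star g) (star f))
}.

Definition weight omega : Prop :=
  [/\ measurable_fun [set: borel G] (omega : borel G -> R),
      forall x, 1 <= omega x,
      forall C : set G, compact C ->
        exists M, forall x, C x -> omega x <= M,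
      forall x y, omega (x * y)%g <= omega x * omega y
    & forall x, omega x^-1%g = omega x].

Definition orlicz_weight Phi omega : Prop :=
  weight omega /\
  banach_star_algebra (weighted_orlicz Phi omega)
    (weighted_orlicz_norm Phi omega).

(** ** Spectra in convolution algebras *)

Definition is_unit (A : set (G -> R[i])) (e : G -> R[i]) : Prop :=
  A e /\ forall f, A f -> aeq (convolution e f) f /\ aeq (convolution f e) f.

Definition invertible (A : set (G -> R[i])) (e f : G -> R[i]) : Prop :=
  exists2 g, A g & aeq (convolution f g) e /\ aeq (convolution g f) e.

(* The pair [(c, f)] stands for the element [c 1 + f] of the unitization. *)
Definition unitization_mul (u v : R[i] * (G -> R[i])) : R[i] * (G -> R[i]) :=
  (u.1 * v.1, fun x => u.1 * v.2 x + v.1 * u.2 x + convolution u.2 v.2 x).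

Definition unitization_eq1 (u : R[i] * (G -> R[i])) : Prop :=
  u.1 = 1 /\ aeq u.2 (fun=> 0).

Definition unitization_invertible (A : set (G -> R[i]))
    (u : R[i] * (G -> R[i])) : Prop :=
  exists2 v, A v.2 & unitization_eq1 (unitization_mul u v) /\
                     unitization_eq1 (unitization_mul v u).

(* The spectrum is taken in [A] itself when [A] has a unit, and in the
   unitization of [A] otherwise. *)
Definition spectrum (A : set (G -> R[i])) f : set R[i] :=
  [set lambda |
    (exists2 e, is_unit A e & ~ invertible A e (fun x => lambda * e x - f x)) \/
    (~ (exists e, is_unit A e) /\
     ~ unitization_invertible A (lambda, fun x => - f x))].

Definition spectral_radius (A : set (G -> R[i])) f : R :=
  sup [set modulus lambda | lambda in spectrum A f].

Definition omega_sharp (K : nat -> set G) omega : G -> R :=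
  let a i := sup [set omega x | x in K i] in
  fun x => (a 1%N + 1) * \1_(K 1%N) x +
    limn (fun n => \sum_(2 <= i < n)
      (a i + i%:R ^+ 2) * fine (mu (K i `\` K i.-1)) * \1_(K i `\` K i.-1) x).

End function_spaces.

(* Main.v *)
(* Let [u_k] be the [2^k]-fold convolution power of [f]. In a Banach algebra with
   [N (u * v) <= M * N u * N v], the spectrum of [f] lies in the open disc of
   radius [r] if and only if [M * N u_k <= r^(2^k) / 2] for some [k]; this form of
   Gelfand's formula is proved without complex analysis, by averaging the
   resolvent over the [2^k]-th roots of unity. It then suffices to compare the
   growth of [u_k] in the two norms. Hoelder's inequality and the integrability of
   [1 / omega] bound the [L1] norm by the weighted Orlicz norm. Conversely
   [omega_sharp] is a non-decreasing function of the least [i] with [x] in [K i],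
   hence [omega_sharp (x y) <= max (omega_sharp x) (omega_sharp y)], and the norm
   [S] weighted by [omega_sharp], which dominates the one weighted by [omega],
   satisfies [S (u * u) <= 4 * |u|_1 * S u]; so [S u_k] grows no faster than
   [|u_k|_1]. That [L1] is a Banach algebra rests on Tonelli's theorem for a Haar
   measure on the Borel sets of a group that need not be second countable. *)

Require Import Defs.
From HB Require Import structures.
From mathcomp Require Import all_boot all_order all_algebra.
From mathcomp Require Import all_classical all_reals all_analysis.
From mathcomp Require Import finmap measurable_realfun lra ring.

Set Implicit Arguments.
Unset Strict Implicit.
Unset Printing Implicit Defensive.

Import Order.TTheory GRing.Theory Num.Theory.
Import HBNNSimple numFieldNormedType.Exports.

Local Open Scope classical_set_scope.
Local Open Scope ring_scope.

(** * Tonelli's theorem for Radon measures *)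

(** The two algebras have different norms, different constants and possibly units, and their
    elements are functions known only almost everywhere. Both are treated as instances of one
    abstract [convolution_algebra], whose unitization is a genuine ring, and the spectral theory is
    proved there once.

    Strict bounds [r < r'] replace limits of roots: the ratio [(r / r')^(2^k)] absorbs the
    multiplicative constants that arise when norms are compared.

    The constant 4 in the estimate of [S (u * u)] leaves no trace. The algebra constant of [L1] is
    2, so the criterion reads [2 * |u_j|_1 <= r^(2^j) / 2], and the factor [4 * |u_j|_1] gained from
    [u_j] to [u_(j+1)] is at most [r^(2^j)]. The product of these bounds for [k <= j < l] is
    [r^(2^l - 2^k)]. This uses the criterion at every index from [k] on, which is available because
    it passes from [u] to [u * u]. *)

Lemma ge0_emeasurable_ind d (T : measurableType d) (R : realType)
    (P : (T -> \bar R) -> Prop) :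
  (forall A : set T, measurable A -> P (fun x => (\1_A x)%:E)) ->
  (forall (r : R) (f : T -> \bar R), 0 <= r -> measurable_fun setT f ->
     (forall x, 0 <= f x)%E -> P f -> P (fun x => r%:E * f x)%E) ->
  (forall f g : T -> \bar R, measurable_fun setT f -> measurable_fun setT g ->
     (forall x, 0 <= f x)%E -> (forall x, 0 <= g x)%E ->
     P f -> P g -> P (fun x => f x + g x)%E) ->
  (forall F : nat -> T -> \bar R, (forall n, measurable_fun setT (F n)) ->
     (forall n x, 0 <= F n x)%E ->
     (forall x, {homo F ^~ x : m n / (m <= n)%N >-> (m <= n)%E}) ->
     (forall n, P (F n)) -> P (fun x => limn (F ^~ x))) ->
  forall f, measurable_fun setT f -> (forall x, 0 <= f x)%E -> P f.
Proof.
move=> P1 PZ PD Pl f mf f0.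
pose g := nnsfun_approx measurableT mf.
have -> : f = fun x => limn (fun n => (g n x)%:E).
  apply/funext => x; apply/esym/cvg_lim => //.
  exact: (@cvg_nnsfun_approx _ _ _ _ measurableT _ mf).
apply: (Pl (fun n x => (g n x)%:E)) => //.
- by move=> n; exact/measurable_EFinP.
- by move=> n x; rewrite lee_fin.
- by move=> x m n mn; rewrite lee_fin; exact/lefP/nd_nnsfun_approx.
move=> n.
have -> : (fun x => (g n x)%:E) = fun x =>
    (\sum_(r <- fset_set (range (g n))) r%:E * (\1_(g n @^-1` [set r]) x)%:E)%E.
  apply/funext => x; rewrite [in LHS](fimfunE (g n)) fsbig_finite//=.
  by rewrite sumEFin.
have : all (fun r => 0 <= r) (fset_set (range (g n))).
  apply/allP => r; rewrite in_fset_set; last exact: fimfunP.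
  by move=> /set_mem[x _ <-].
have mI r : measurable_fun setT (fun x : T => (\1_(g n @^-1` [set r]) x)%:E : \bar R).
  by apply/measurable_EFinP; exact: measurable_indic.
elim: (fset_set _ : seq R) => [_|r s ih /= /andP[r0 s0]].
  under eq_fun do rewrite big_nil.
  have := P1 set0 measurable0; congr P.
  by apply/funext => x; rewrite indic0.
under eq_fun do rewrite big_cons.
apply: PD.
- by apply: measurable_funeM; exact: mI.
- by apply: emeasurable_sum => r'; apply: measurable_funeM; exact: mI.
- by move=> x; rewrite mule_ge0// lee_fin.
- move=> x; rewrite big_seq; apply: sume_ge0 => r' r's.
  by rewrite mule_ge0// lee_fin//; exact: (allP s0).
- by apply: PZ => //; exact: P1.
- exact: ih.
Qed.

(** Joins the pointed and the topological structure of a product, so that [borel (S * T)] is a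
    measurable type. *)
HB.instance Definition _ (S T : ptopologicalType) :=
  Topological.on (S * T)%type.

Lemma open_borel (T : ptopologicalType) (U : set T) : open U -> measurable (U : set (borel T)).
Proof. by move=> oU; exact: sub_sigma_algebra. Qed.

Lemma compact_borel (T : ptopologicalType) (C : set T) : hausdorff_space T -> compact C ->
  measurable (C : set (borel T)).
Proof.
move=> hT /(compact_closed hT) cC; rewrite -(setCK C).
apply: (@measurableC _ (borel T)).
by apply: open_borel; rewrite openC.
Qed.

Lemma continuous_borel (S T : ptopologicalType) (phi : S -> T) : continuous phi ->
  measurable_fun setT (phi : borel S -> borel T).
Proof.
move=> cphi; apply: (@measurability _ _ (borel S) (borel T) setT phi (@open T)) => //.
move=> _ [U oU <-].
by rewrite setTI; apply: (@open_borel S); move/continuousP: cphi; exact.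
Qed.

Section borel_sections.
Context (S T : ptopologicalType).

Lemma pair_continuous (x : S) : continuous (fun y : T => (x, y)).
Proof. by move=> y; apply: cvg_pair => //=; exact: cvg_cst. Qed.

Lemma pair_continuous_l (y : T) : continuous (fun x : S => (x, y)).
Proof. by move=> x; apply: cvg_pair => //=; exact: cvg_cst. Qed.

Lemma open_xsection (W : set (S * T)) x : open W -> open (xsection W x).
Proof.
by move=> oW; rewrite xsectionE; have /continuousP := @pair_continuous x; exact.
Qed.

Lemma open_ysection (W : set (S * T)) y : open W -> open (ysection W y).
Proof.
by move=> oW; rewrite ysectionE; have /continuousP := @pair_continuous_l y; exact.
Qed.

Lemma borel_xsection (W : set (borel (S * T)%type)) x :
  measurable W -> measurable (xsection W x : set (borel T)).
Proof.
move=> mW; rewrite xsectionE -[X in measurable X]setTI.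
exact: (@continuous_borel T (S * T)%type _ (@pair_continuous x)).
Qed.

Lemma borel_ysection (W : set (borel (S * T)%type)) y :
  measurable W -> measurable (ysection W y : set (borel S)).
Proof.
move=> mW; rewrite ysectionE -[X in measurable X]setTI.
exact: (@continuous_borel S (S * T)%type _ (@pair_continuous_l y)).
Qed.

End borel_sections.

Lemma nbhs_open (T : topologicalType) (U : set T) :
  (forall x, U x -> nbhs x U) -> open U.
Proof. by rewrite openE. Qed.

Lemma measureS d (T : measurableType d) (R : realType)
    (mu : {measure set T -> \bar R}) (A B : set T) :
  measurable A -> measurable B -> A `<=` B -> (mu A <= mu B)%E.
Proof. by move=> mA mB; apply: le_measure; exact: mem_set. Qed.

Section inner_regular_measures.
Context (R : realType) (T : ptopologicalType).
Variable mu : {measure set (borel T) -> \bar R}.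

Record radon_exhaustion (D : nat -> set T) : Prop := {
  radon_hausdorff : hausdorff_space T ;
  radon_inner : forall U : set T, open U ->
    mu U = ereal_sup [set mu C | C in [set C : set T | compact C /\ C `<=` U]] ;
  radon_open : forall n, open (D n) ;
  radon_finite : forall n, (mu (D n) < +oo)%E ;
  radon_nondecreasing : nondecreasing_seq D ;
  radon_cover : \bigcup_n D n = setT
}.

Variable D : nat -> set T.
Hypothesis rD : radon_exhaustion D.

Lemma radon_sigma_finite : sigma_finite setT mu.
Proof.
exists D; first by rewrite (radon_cover rD).
by move=> n; split; [apply: open_borel; exact: (radon_open rD)|exact: (radon_finite rD)].
Qed.

(** Inner regularity puts a compact set of measure greater than [t] inside the section at [x]; by
    the tube lemma it stays inside the sections at nearby points. *)
Lemma open_xsection_lsc (W : set (T * T)) (t : \bar R) : open W ->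
  open [set x | t < mu (xsection W x)]%E.
Proof.
move=> oW; apply: nbhs_open => x /=.
rewrite (radon_inner rD); last exact: open_xsection.
move=> /ereal_sup_gt[_ [C [cC CW] <-] tC].
have : \forall x' \near x, C `<=` (fun y => W (x', y)).
  apply: ((compact_near_coveringP C).1 cC T (nbhs x) (fun x' y => W (x', y))).
  move=> y /CW /xsectionP Wxy.
  have [[P Q] [/= Px Qy] PQW] : nbhs (x, y) W by exact: open_nbhs_nbhs.
  by exists (Q, P) => // -[y' x'] [/= ? ?]; exact: PQW.
apply: filterS => x' CWx'.
apply: (lt_le_trans tC); apply: measureS.
- by exact: (compact_borel (radon_hausdorff rD)).
- by apply: open_borel; exact: open_xsection.
- by move=> y Cy; apply/xsectionP; exact: CWx'.
Qed.

Lemma measurable_mu_xsection_open (W : set (T * T)) : open W ->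
  measurable_fun setT (fun x : borel T => mu (xsection W x)).
Proof.
move=> oW; apply: (measurability _ (ErealGenOInfty.measurableE R)).
move=> /= _ [_ [a ->]] <-; apply: measurableI => //; apply: open_borel.
rewrite [X in open X](_ : _ = [set x | a%:E < mu (xsection W x)]%E).
  exact: open_xsection_lsc.
by apply/seteqP; split => x /=; rewrite in_itv/= andbT.
Qed.

(* Inner regularity reduces an open set, up to a null set, to a countable union
   of compact sets, which are finitely covered. *)
Lemma open_cover_negligible (U : set T) (V : T -> set T) : open U ->
  (mu U < +oo)%E -> (forall x, U x -> open (V x) /\ V x x) ->
  exists2 F : nat -> {fset T}, (forall n x, x \in F n -> U x) &
    mu (U `\` \bigcup_n \bigcup_(x in [set` F n]) V x) = 0.
Proof.
move=> oU Uoo UV.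
have Ufin : mu U \is a fin_num by rewrite ge0_fin_numE.
have H n : exists F : {fset T}, (forall x, x \in F -> U x) /\
    (mu (U `\` \bigcup_(x in [set` F]) V x) <= (n.+1%:R^-1)%:E)%E.
  have [||_ [C [cC CU] <-]] := @ub_ereal_sup_adherent R
     [set mu C | C in [set C : set T | compact C /\ C `<=` U]] (n.+1%:R^-1).
  - by rewrite invr_gt0.
  - by rewrite -(radon_inner rD).
  rewrite -(radon_inner rD)// => UC.
  move: (cC); rewrite compact_cover => /(_ T U V).
  case; first by move=> x /UV[].
    by move=> x Cx; exists x; [exact: CU|apply: (UV _ _).2; exact: CU].
  move=> F FU CF; exists F; split; first by move=> x /FU/set_mem.
  have mC := compact_borel (radon_hausdorff rD) cC.
  have mU := open_borel oU.
  have mV : measurable (\bigcup_(x in [set` F]) V x : set (borel T)).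
    apply: open_borel; apply: bigcup_open => x /= xF.
    by apply: (UV _ _).1; move/FU/set_mem : xF.
  apply: (@le_trans _ _ (mu (U `\` C))).
    apply: measureS; [exact: measurableD|exact: measurableD|].
    by apply: setDS => x /CF.
  rewrite measureD//= setIidr// leeBlDr; last first.
    by rewrite ge0_fin_numE// (le_lt_trans _ Uoo)// measureS.
  by rewrite addeC -leeBlDr// ltW.
have [F HF] := choice H; exists F; first by move=> n; have [] := HF n.
apply/eqP; rewrite eq_le measure_ge0 andbT; apply/lee_addgt0Pr => e e0.
rewrite add0e; have [n ne] := ltr_add_invr e0.
have [FU le] := HF n; rewrite add0r in ne.
apply: (@le_trans _ _ (n.+1%:R^-1)%:E); last by rewrite lee_fin ltW.
apply: le_trans le; apply: measureS.
- apply: measurableD; first exact: open_borel.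
  apply: open_borel; apply: bigcup_open => i _; apply: bigcup_open => x /= xF.
  by apply: (UV _ _).1; exact: (HF i).1.
- apply: measurableD; first exact: open_borel.
  apply: open_borel; apply: bigcup_open => x /= xF.
  by apply: (UV _ _).1; exact: FU.
- by apply: setDS => x [y Fy Vy]; exists n => //; exists y.
Qed.

End inner_regular_measures.

Section sigma_finite_tonelli.
Context d (T : measurableType d) (R : realType).
Variables (mu : {measure set T -> \bar R}) (smu : sigma_finite setT mu).

(** A copy of [mu] on which sigma-finiteness can be registered as a structure, which gives access to
    product measures. *)
Let m : set T -> \bar R := mu.
HB.instance Definition _ := Measure.on m.
HB.instance Definition _ := Measure_isSigmaFinite.Build d T R m smu.

Lemma sigma_finite_tonelli_sections (E : set (T * T)) : measurable E ->
  [/\ measurable_fun setT (fun x => mu (xsection E x)),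
      measurable_fun setT (fun y => mu (ysection E y)) &
      (\int[mu]_x mu (xsection E x) = \int[mu]_y mu (ysection E y))%E].
Proof.
move=> mE; split.
- exact: (measurable_fun_xsection m mE).
- exact: (measurable_fun_ysection m mE).
- have := @product_measure_unique _ _ _ _ _ m m (product_measure2 m m) _ E mE.
  apply => A B mA mB; exact: product_measure2E.
Qed.

End sigma_finite_tonelli.

(* [T] need not be second countable, so [borel (T * T)] may be larger than the
   product sigma-algebra. Open sets are exhausted from inside, up to null
   sections, by countable unions of measurable rectangles; the rest is a
   monotone class argument. *)
Section radon_tonelli.
Context (R : realType) (T : ptopologicalType).
Variable mu : {measure set (borel T) -> \bar R}.
Variable D : nat -> set T.
Hypothesis rD : radon_exhaustion mu D.

Lemma open_swap (W : set (T * T)) : open W -> open (swap_pair @^-1` W).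
Proof. by move=> oW; have /continuousP := @swap_continuous T T; exact. Qed.

Lemma measurable_mu_ysection_open (W : set (T * T)) : open W ->
  measurable_fun setT (fun y : borel T => mu (ysection W y)).
Proof.
by move=> /open_swap /(measurable_mu_xsection_open rD).
Qed.

(** Each [x] whose section has measure greater than [q] lies in an open [V] with [V * C] inside [W]
    for some compact [C] of measure greater than [q]. Countably many such [V] cover the set of these
    [x] up to a null set, and [E] is the union of the corresponding rectangles. The box [A * A]
    makes that set of finite measure. *)
Lemma open_inner_rectangles (W : set (T * T)) (A : set T) (q : R) :
  open W -> open A -> (mu A < +oo)%E -> W `<=` A `*` A -> 0 <= q ->
  exists E : set (borel T * borel T), [/\ measurable E, E `<=` W &
    {ae mu, forall x : borel T, (q%:E < mu (xsection W x) -> q%:E < mu (xsection E x))%E}].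
Proof.
move=> oW oA Aoo WA q0.
pose U := [set x | q%:E < mu (xsection W x)]%E.
have oU : open U by exact: (open_xsection_lsc rD).
have UA : U `<=` A.
  move=> x Ux; apply: contrapT => Ax; move: Ux; rewrite /U/=.
  rewrite (_ : xsection W x = set0) ?measure0 ?ltNge ?lee_fin ?q0//.
  by apply/seteqP; split=> // y /xsectionP /WA[].
have Uoo : (mu U < +oo)%E.
  by apply: le_lt_trans Aoo; apply: measureS => //; exact: open_borel.
have H x : exists VC : set T * set T, U x ->
    [/\ open VC.1, VC.1 x, compact VC.2, VC.1 `*` VC.2 `<=` W &
        (q%:E < mu VC.2)%E].
  have [Ux|nUx] := pselect (U x); last by exists (set0, set0).
  have := Ux; rewrite /U/= (radon_inner rD); last exact: open_xsection.
  move=> /ereal_sup_gt[_ [C [cC CW] <-] qC].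
  have : nbhs x [set x' | C `<=` (fun y => W (x', y))].
    apply: ((compact_near_coveringP C).1 cC T (nbhs x) (fun x' y => W (x', y))).
    move=> y /CW /xsectionP Wxy.
    have [[P Q] [/= Px Qy] PQW] : nbhs (x, y) W by exact: open_nbhs_nbhs.
    by exists (Q, P) => // -[y' x'] [/= ? ?]; exact: PQW.
  rewrite nbhsE => -[V [oV Vx] VW]; exists (V, C) => _; split => //=.
  by move=> [x' y] [/= /VW + Cy]; exact.
have [VC HVC] := choice H.
have [x Ux|F FU UF] := @open_cover_negligible _ _ _ _ rD U (fun x => (VC x).1) oU Uoo.
  by have [] := HVC _ Ux.
exists (\bigcup_n \bigcup_(y in [set` F n]) ((VC y).1 `*` (VC y).2)); split.
- apply: bigcup_measurable => n _; apply: fin_bigcup_measurable => //= y Fy.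
  have [oV _ cC _ _] := HVC _ (FU _ _ Fy).
  apply: measurableX; first exact: open_borel.
  exact: (compact_borel (radon_hausdorff rD)).
- move=> z [n _ [y Fy Vz]].
  by have [_ _ _ + _] := HVC _ (FU _ _ Fy); exact.
- exists (U `\` \bigcup_n \bigcup_(x in [set` F n]) (VC x).1); split => //.
    apply: measurableD; first exact: open_borel.
    apply: open_borel; apply: bigcup_open => i _; apply: bigcup_open => x /= xF.
    by have [] := HVC _ (FU _ _ xF).
  move=> x /= /not_implyP[Ux qE]; split => // -[n _ [y Fy Vx]]; apply: qE.
  have [_ _ cC _ qC] := HVC _ (FU _ _ Fy).
  apply: (lt_le_trans qC); apply: measureS.
  + exact: (compact_borel (radon_hausdorff rD)).
  + apply: measurable_xsection; apply: bigcup_measurable => m _.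
    apply: fin_bigcup_measurable => //= z Fz.
    have [oV _ cC' _ _] := HVC _ (FU _ _ Fz).
    apply: measurableX; first exact: open_borel.
    exact: (compact_borel (radon_hausdorff rD)).
  + by move=> z Cz; apply/xsectionP; exists n => //; exists y.
Qed.

(** The union [E] of the rectangles obtained for all rational levels lies in the product
    sigma-algebra, and almost all of its sections are at least as large as those of [W]: otherwise a
    rational would separate the two measures. Tonelli for [E] and the inclusion of [E] in [W]
    conclude. *)
Lemma open_tonelli_le (W : set (T * T)) (A : set T) :
  open W -> open A -> (mu A < +oo)%E -> W `<=` A `*` A ->
  (\int[mu]_x mu (xsection W x) <= \int[mu]_y mu (ysection W y))%E.
Proof.
move=> oW oA Aoo WA.
(* [t] enumerates the rationals; an index that codes none gives 0. *)
pose t n : R := oapp ratr 0 (@choice.unpickle rat n).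
have H n : exists E : set (borel T * borel T), [/\ measurable E, E `<=` W &
    {ae mu, forall x : borel T, (0 <= t n)%R ->
      ((t n)%:E < mu (xsection W x) -> (t n)%:E < mu (xsection E x))%E}].
  have [t0|t0] := leP 0 (t n); last first.
    by exists set0; split => //; apply: aeW.
  have [E [? ? aeE]] := open_inner_rectangles oW oA Aoo WA t0.
  by exists E; split => //; move: aeE; apply: filterS => x + _.
have [E_ HE] := choice H; pose E := \bigcup_n E_ n.
have mE : measurable E by apply: bigcup_measurable => n _; have [] := HE n.
have EW : E `<=` W by move=> z [n _]; have [_ + _] := HE n; exact.
have [mxE myE E12] := sigma_finite_tonelli_sections (radon_sigma_finite rD) mE.
apply: (@le_trans _ _ (\int[mu]_x mu (xsection E x))%E).
  apply: ae_ge0_le_integral => //.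
    exact: (measurable_mu_xsection_open rD).
  have : {ae mu, forall x : borel T, forall n, (0 <= t n)%R ->
      ((t n)%:E < mu (xsection W x) -> (t n)%:E < mu (xsection (E_ n) x))%E}.
    by apply/ae_foralln => n; have [] := HE n.
  apply: filterS => x tW _; rewrite leNgt; apply/negP => EWx.
  have fE : mu (xsection E x) \is a fin_num.
    by rewrite ge0_fin_numE// (lt_le_trans EWx) ?leey.
  have [q qE qW] : exists2 q : rat, (mu (xsection E x) <= (ratr q)%:E)%E &
      ((ratr q)%:E < mu (xsection W x))%E.
    have fW : mu (xsection W x) \is a fin_num.
      rewrite ge0_fin_numE//; apply: le_lt_trans Aoo; apply: measureS.
      - by apply: open_borel; exact: open_xsection.
      - exact: open_borel.
      - by move=> y /xsectionP /WA[].
    move: EWx; rewrite -(fineK fE) -(fineK fW) lte_fin => /rat_in_itvoo[q].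
    by rewrite in_itv/= => /andP[Eq qW]; exists q; rewrite ?lee_fin ?lte_fin// ltW.
  have q0 : 0 <= ratr q :> R by rewrite -lee_fin (le_trans _ qE).
  have := tW (choice.pickle q); rewrite /t choice.pickleK/= => /(_ q0 qW) qE'.
  move: qE; rewrite leNgt => /negP; apply.
  apply: (lt_le_trans qE'); apply: measureS.
  - by apply: measurable_xsection; have [] := HE (choice.pickle q).
  - exact: measurable_xsection.
  - by move=> y /xsectionP Ey; apply/xsectionP; exists (choice.pickle q).
rewrite E12; apply: ge0_le_integral => //.
- exact: measurable_mu_ysection_open.
- move=> y _; apply: measureS.
  + exact: measurable_ysection.
  + by apply: open_borel; exact: open_ysection.
  + by move=> x /ysectionP /EW Wxy; apply/ysectionP.
Qed.

Lemma open_tonelli (W : set (T * T)) (A : set T) :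
  open W -> open A -> (mu A < +oo)%E -> W `<=` A `*` A ->
  (\int[mu]_x mu (xsection W x) = \int[mu]_y mu (ysection W y))%E.
Proof.
move=> oW oA Aoo WA; apply/eqP; rewrite eq_le (open_tonelli_le oW oA)//=.
by apply: (open_tonelli_le (open_swap oW) oA Aoo) => -[x y] /= /WA[].
Qed.

Let tonelli_set (W : set (T * T)) :=
  [/\ measurable_fun setT (fun x : borel T => mu (xsection W x)),
      measurable_fun setT (fun y : borel T => mu (ysection W y)) &
      (\int[mu]_x mu (xsection W x) = \int[mu]_y mu (ysection W y))%E].

Lemma tonelli_set_bigcup (F : nat -> set (borel (T * T)%type)) :
  nondecreasing_seq F -> (forall n, measurable (F n)) ->
  (forall n, tonelli_set (F n)) -> tonelli_set (\bigcup_n F n).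
Proof.
move=> ndF mF tF.
have mU : measurable (\bigcup_n F n) by exact: bigcupT_measurable.
have xF (x : T) : mu (xsection (F n) x) @[n --> \oo] --> mu (xsection (\bigcup_n F n) x).
  rewrite xsection_bigcup; apply: nondecreasing_cvg_mu.
  - by move=> n; exact: borel_xsection.
  - by apply: bigcupT_measurable => n; exact: borel_xsection.
  - by move=> m n mn; exact/subsetPset/le_xsection/subsetPset/ndF.
have yF (y : T) : mu (ysection (F n) y) @[n --> \oo] --> mu (ysection (\bigcup_n F n) y).
  rewrite ysection_bigcup; apply: nondecreasing_cvg_mu.
  - by move=> n; exact: borel_ysection.
  - by apply: bigcupT_measurable => n; exact: borel_ysection.
  - by move=> m n mn; exact/subsetPset/le_ysection/subsetPset/ndF.
split.
- apply: (emeasurable_fun_cvg (fun n (x : borel T) => mu (xsection (F n) x))) => //.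
  by move=> n; have [] := tF n.
- apply: (emeasurable_fun_cvg (fun n (y : borel T) => mu (ysection (F n) y))) => //.
  by move=> n; have [] := tF n.
- under eq_integral do rewrite -(cvg_lim _ (xF _))//.
  under [RHS]eq_integral do rewrite -(cvg_lim _ (yF _))//.
  rewrite !monotone_convergence//.
  + by congr (limn _); apply/funext => n; have [] := tF n.
  + by move=> n; have [] := tF n.
  + move=> y _ m n mn; apply: measureS; [exact: borel_ysection..|].
    exact/le_ysection/subsetPset/ndF.
  + by move=> n; have [] := tF n.
  + move=> y _ m n mn; apply: measureS; [exact: borel_xsection..|].
    exact/le_xsection/subsetPset/ndF.
Qed.

(** Measures of sections and their integrals are subtracted here, which requires finiteness: hence
    the restriction to the box [D n * D n]. *)
Lemma tonelli_set_setD n (A B : set (borel (T * T)%type)) : measurable A ->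
  measurable B -> B `<=` A -> A `<=` D n `*` D n ->
  tonelli_set A -> tonelli_set B -> tonelli_set (A `\` B).
Proof.
move=> mA mB BA AD [mxA myA eA] [mxB myB eB].
have mD : measurable (D n : set (borel T)).
  by apply: open_borel; exact: (radon_open rD).
have Doo := radon_finite rD n.
have xBA x : xsection B x `<=` xsection A x by exact: le_xsection.
have yBA y : ysection B y `<=` ysection A y by exact: le_ysection.
have xoo (x : T) : (mu (xsection B x) < +oo)%E.
  apply: le_lt_trans Doo; apply: measureS => //; first exact: borel_xsection.
  by move=> y /xBA/xsectionP /AD[].
have yoo (y : T) : (mu (ysection B y) < +oo)%E.
  apply: le_lt_trans Doo; apply: measureS => //; first exact: borel_ysection.
  by move=> x /yBA/ysectionP /AD[].
have xE (x : T) : mu (xsection (A `\` B) x) =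
    (mu (xsection A x) - mu (xsection B x))%E.
  rewrite xsectionD measureD ?(setIidr (xBA x))//; try exact: borel_xsection.
  apply: le_lt_trans Doo; apply: measureS => //; first exact: borel_xsection.
  by move=> y /xsectionP /AD[].
have yE (y : T) : mu (ysection (A `\` B) y) =
    (mu (ysection A y) - mu (ysection B y))%E.
  rewrite ysectionD measureD ?(setIidr (yBA y))//; try exact: borel_ysection.
  apply: le_lt_trans Doo; apply: measureS => //; first exact: borel_ysection.
  by move=> x /ysectionP /AD[].
have mx : measurable_fun setT (fun x : borel T => mu (xsection (A `\` B) x)).
  by under eq_fun do rewrite xE; exact: emeasurable_funB.
have my : measurable_fun setT (fun y : borel T => mu (ysection (A `\` B) y)).
  by under eq_fun do rewrite yE; exact: emeasurable_funB.
split=> //.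
have fB : (\int[mu]_x mu (xsection B x))%E \is a fin_num.
  rewrite ge0_fin_numE; last by apply: integral_ge0 => x _; exact: measure_ge0.
  apply: (@le_lt_trans _ _ (\int[mu]_x (mu (D n) * (\1_(D n) x)%:E))%E).
    apply: ge0_le_integral => //.
    + by apply: measurable_funeM; apply/measurable_EFinP; exact: measurable_indic.
    + move=> x _; have [xD|xD] := pselect (D n x).
        rewrite indicE mem_set// mule1; apply: measureS => //; first exact: borel_xsection.
        by move=> y /xBA/xsectionP /AD[].
      rewrite (_ : xsection B x = set0) ?measure0 ?mule0//.
      by apply/seteqP; split=> // y /xBA/xsectionP /AD[].
  rewrite ge0_integralZl ?integral_indic ?setIT//.
  - by rewrite lte_mul_pinfty// ge0_fin_numE.
  - by apply/measurable_EFinP; exact: measurable_indic.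
have xD : (\int[mu]_x mu (xsection A x) =
    \int[mu]_x mu (xsection (A `\` B) x) + \int[mu]_x mu (xsection B x))%E.
  rewrite -ge0_integralD//; apply: eq_integral => x _.
  by rewrite xE subeK// ge0_fin_numE.
have yD : (\int[mu]_y mu (ysection A y) =
    \int[mu]_y mu (ysection (A `\` B) y) + \int[mu]_y mu (ysection B y))%E.
  rewrite -ge0_integralD//; apply: eq_integral => y _.
  by rewrite yE subeK// ge0_fin_numE.
have E : (\int[mu]_x mu (xsection (A `\` B) x) + \int[mu]_x mu (xsection B x) =
    \int[mu]_y mu (ysection (A `\` B) y) + \int[mu]_x mu (xsection B x))%E.
  by rewrite -xD eA yD eB.
by rewrite -[LHS](addeK _ fB) E addeK.
Qed.

(** Inside a box of finite measure the sets satisfying Tonelli form a lambda-system, and the open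
    sets, which satisfy it, are stable under intersection. *)
Lemma borel_tonelli_restr n (W : set (borel (T * T)%type)) : measurable W ->
  tonelli_set (W `&` (D n `*` D n)).
Proof.
pose Q : set (T * T) := D n `*` D n.
have oQ : open Q.
  rewrite (_ : Q = (fst @^-1` D n) `&` (snd @^-1` D n)); last by [].
  apply: openI.
    by apply: open_comp (radon_open rD n) => z _; exact: cvg_fst.
  by apply: open_comp (radon_open rD n) => z _; exact: cvg_snd.
have mD : measurable (D n : set (borel T)).
  by apply: open_borel; exact: (radon_open rD).
pose H : set (set (T * T)) := [set W |
  measurable (W : set (borel (T * T)%type)) /\ tonelli_set (W `&` Q)].
suff : <<s @open (T * T)%type >> `<=` H by move=> sH /sH[].
have Hopen : @open (T * T)%type `<=` H.
  move=> U oU; split; first exact: open_borel.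
  have oUQ : open (U `&` Q) by exact: openI.
  split; [exact: (measurable_mu_xsection_open rD)|
          exact: measurable_mu_ysection_open|].
  apply: (open_tonelli oUQ (@radon_open _ _ _ _ rD n) (@radon_finite _ _ _ _ rD n)).
  by move=> z [].
have mQ : measurable (Q : set (borel (T * T)%type)) by exact: open_borel.
apply: lambda_system_subset => //.
  by move=> U V oU oV; exact: openI.
split => //.
- by apply: Hopen; exact: openT.
- move=> A B BA [mA [mxA myA eA]] [mB [mxB myB eB]].
  split; first exact: (@measurableD _ (borel (T * T)%type)).
  rewrite (_ : (A `\` B) `&` Q = (A `&` Q) `\` (B `&` Q)); last first.
    apply/seteqP; split=> [z [[Az Bz] Qz]|z [[Az Qz] BQ]].
      by split => // -[].
    by split => //; split => // Bz; exact: BQ.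
  have mI (V : set (borel (T * T)%type)) : measurable V -> measurable (V `&` Q).
    by move=> mV; exact: measurableI.
  apply: (@tonelli_set_setD n (A `&` Q) (B `&` Q)) => //.
  + exact: mI.
  + exact: mI.
  + by move=> z [Bz Qz]; split => //; exact: BA.
- move=> F ndF HF; split; first by apply: bigcupT_measurable => i; have [] := HF i.
  rewrite setI_bigcupl; apply: tonelli_set_bigcup.
  + by move=> i j ij; apply/subsetPset; apply: setSI; exact/subsetPset/ndF.
  + by move=> i; apply: measurableI => //; have [] := HF i.
  + by move=> i; have [] := HF i.
Qed.

Lemma borel_tonelli (W : set (borel (T * T)%type)) : measurable W ->
  tonelli_set W.
Proof.
move=> mW.
have oQ n : open (D n `*` D n).
  rewrite (_ : D n `*` D n = (fst @^-1` D n) `&` (snd @^-1` D n))//.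
  apply: openI.
    by apply: open_comp (radon_open rD n) => z _; exact: cvg_fst.
  by apply: open_comp (radon_open rD n) => z _; exact: cvg_snd.
have -> : W = \bigcup_n (W `&` (D n `*` D n)).
  rewrite -setI_bigcupr (_ : \bigcup_n (D n `*` D n) = setT) ?setIT//.
  apply/seteqP; split=> // -[x y] _.
  have [m _ Dx] : (\bigcup_n D n) x by rewrite (radon_cover rD).
  have [n _ Dy] : (\bigcup_n D n) y by rewrite (radon_cover rD).
  exists (maxn m n) => //; split => /=.
    by move: x Dx; apply/subsetPset/(radon_nondecreasing rD)/leq_maxl.
  by move: y Dy; apply/subsetPset/(radon_nondecreasing rD)/leq_maxr.
apply: tonelli_set_bigcup => [m n mn|n|n].
- apply/subsetPset; apply: setIS; apply: setSX;
    exact/subsetPset/(radon_nondecreasing rD).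
- by apply: measurableI => //; apply: open_borel; exact: oQ.
- exact: borel_tonelli_restr.
Qed.

Theorem radon_tonelli (f : T * T -> \bar R) :
  measurable_fun setT (f : borel (T * T)%type -> \bar R) ->
  (forall z, 0 <= f z)%E ->
  [/\ measurable_fun setT (fun x : borel T => \int[mu]_y f (x, y)),
      measurable_fun setT (fun y : borel T => \int[mu]_x f (x, y)) &
      \int[mu]_x \int[mu]_y f (x, y) = \int[mu]_y \int[mu]_x f (x, y)]%E.
Proof.
have msec1 (g : borel (T * T)%type -> \bar R) x : measurable_fun setT g ->
    measurable_fun setT (fun y : borel T => g (x, y)).
  by move=> mg; apply: measurableT_comp mg _; exact: (continuous_borel (@pair_continuous T T x)).
have msec2 (g : borel (T * T)%type -> \bar R) y : measurable_fun setT g ->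
    measurable_fun setT (fun x : borel T => g (x, y)).
  by move=> mg; apply: measurableT_comp mg _; exact: (continuous_borel (@pair_continuous_l T T y)).
have addE (p q : borel T -> \bar R) : measurable_fun setT p ->
    measurable_fun setT q -> (forall x, 0 <= p x)%E -> (forall x, 0 <= q x)%E ->
    (\int[mu]_x (p x + q x) = \int[mu]_x p x + \int[mu]_x q x)%E.
  by move=> mp mq p0 q0; exact: ge0_integralD.
have scaleE (r : R) (p : borel T -> \bar R) : 0 <= r -> measurable_fun setT p ->
    (forall x, 0 <= p x)%E ->
    (\int[mu]_x (r%:E * p x) = r%:E * \int[mu]_x p x)%E.
  by move=> r0 mp p0; rewrite ge0_integralZl.
have limE (F : nat -> borel T -> \bar R) : (forall n, measurable_fun setT (F n)) ->
    (forall n x, 0 <= F n x)%E ->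
    (forall x, {homo F ^~ x : m n / (m <= n)%N >-> (m <= n)%E}) ->
    (\int[mu]_x limn (F ^~ x) = limn (fun n => \int[mu]_x F n x))%E.
  by move=> mF F0 ndF; rewrite monotone_convergence.
have int0 (p : borel T -> \bar R) : (forall x, 0 <= p x)%E -> (0 <= \int[mu]_x p x)%E.
  by move=> p0; exact: integral_ge0.
move: f; apply: (@ge0_emeasurable_ind _ (borel (T * T)%type) R).
- move=> A mA.
  have xE (x : T) : (\int[mu]_y (\1_A (x, y))%:E = mu (xsection A x))%E.
    transitivity (\int[mu]_y (\1_(xsection A x) y)%:E)%E.
      by apply: eq_integral => y _; rewrite !indicE mem_xsection.
    by rewrite integral_indic ?setIT//; exact: borel_xsection.
  have yE (y : T) : (\int[mu]_x (\1_A (x, y))%:E = mu (ysection A y))%E.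
    transitivity (\int[mu]_x (\1_(ysection A y) x)%:E)%E.
      by apply: eq_integral => x _; rewrite !indicE mem_ysection.
    by rewrite integral_indic ?setIT//; exact: borel_ysection.
  have [mx my xy] := borel_tonelli mA.
  split.
  + by under eq_fun do rewrite xE.
  + by under eq_fun do rewrite yE.
  + by under eq_integral do rewrite xE; under [RHS]eq_integral do rewrite yE.
- move=> r f r0 mf f0 [mx my xy].
  have xE (x : T) : (\int[mu]_y (r%:E * f (x, y)) = r%:E * \int[mu]_y f (x, y))%E.
    exact: (scaleE _ _ r0 (msec1 _ x mf) (fun y => f0 (x, y))).
  have yE (y : T) : (\int[mu]_x (r%:E * f (x, y)) = r%:E * \int[mu]_x f (x, y))%E.
    exact: (scaleE _ _ r0 (msec2 _ y mf) (fun x => f0 (x, y))).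
  split.
  + by under eq_fun do rewrite xE; exact: measurable_funeM.
  + by under eq_fun do rewrite yE; exact: measurable_funeM.
  + under eq_integral do rewrite xE; under [RHS]eq_integral do rewrite yE.
    rewrite (scaleE _ _ r0 mx (fun x => int0 _ (fun y => f0 (x, y)))).
    by rewrite xy (scaleE _ _ r0 my (fun y => int0 _ (fun x => f0 (x, y)))).
- move=> f g mf mg f0 g0 [mx my xy] [mx' my' xy'].
  have xE (x : T) : (\int[mu]_y (f (x, y) + g (x, y)) =
      \int[mu]_y f (x, y) + \int[mu]_y g (x, y))%E.
    exact: (addE _ _ (msec1 _ x mf) (msec1 _ x mg) (fun y => f0 (x, y)) (fun y => g0 (x, y))).
  have yE (y : T) : (\int[mu]_x (f (x, y) + g (x, y)) =
      \int[mu]_x f (x, y) + \int[mu]_x g (x, y))%E.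
    exact: (addE _ _ (msec2 _ y mf) (msec2 _ y mg) (fun x => f0 (x, y)) (fun x => g0 (x, y))).
  split.
  + by under eq_fun do rewrite xE; exact: emeasurable_funD.
  + by under eq_fun do rewrite yE; exact: emeasurable_funD.
  + under eq_integral do rewrite xE; under [RHS]eq_integral do rewrite yE.
    rewrite (addE _ _ mx mx' (fun x => int0 _ (fun y => f0 (x, y)))
      (fun x => int0 _ (fun y => g0 (x, y)))).
    by rewrite xy xy' (addE _ _ my my' (fun y => int0 _ (fun x => f0 (x, y)))
      (fun y => int0 _ (fun x => g0 (x, y)))).
- move=> F mF F0 ndF HF.
  have xE (x : T) : (\int[mu]_y limn (F ^~ (x, y)) =
      limn (fun n => \int[mu]_y F n (x, y)))%E.
    apply: (limE (fun n y => F n (x, y))) => [n|n y|y]; [exact: msec1|exact: F0|exact: ndF].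
  have yE (y : T) : (\int[mu]_x limn (F ^~ (x, y)) =
      limn (fun n => \int[mu]_x F n (x, y)))%E.
    apply: (limE (fun n x => F n (x, y))) => [n|n x|x]; [exact: msec2|exact: F0|exact: ndF].
  have ndx (x : T) : {homo (fun n => \int[mu]_y F n (x, y))%E : m n / (m <= n)%N >-> (m <= n)%E}.
    move=> m n mn; apply: ge0_le_integral => //; try exact: msec1.
    by move=> y _; exact: ndF.
  have ndy (y : T) : {homo (fun n => \int[mu]_x F n (x, y))%E : m n / (m <= n)%N >-> (m <= n)%E}.
    move=> m n mn; apply: ge0_le_integral => //; try exact: msec2.
    by move=> x _; exact: ndF.
  split.
  + apply: (emeasurable_fun_cvg (fun n (x : borel T) => \int[mu]_y F n (x, y))%E).
      by move=> n; have [] := HF n.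
    by move=> x _; rewrite xE; exact: ereal_nondecreasing_is_cvgn.
  + apply: (emeasurable_fun_cvg (fun n (y : borel T) => \int[mu]_x F n (x, y))%E).
      by move=> n; have [] := HF n.
    by move=> y _; rewrite yE; exact: ereal_nondecreasing_is_cvgn.
  + under eq_integral do rewrite xE; under [RHS]eq_integral do rewrite yE.
    rewrite (limE (fun n x => \int[mu]_y F n (x, y))%E); first last.
    * exact: ndx.
    * by move=> n x; apply: int0 => y; exact: F0.
    * by move=> n; have [] := HF n.
    rewrite (limE (fun n y => \int[mu]_x F n (x, y))%E); first last.
    * exact: ndy.
    * by move=> n y; apply: int0 => x; exact: F0.
    * by move=> n; have [] := HF n.
    by congr (limn _); apply/funext => n; have [] := HF n.
Qed.

End radon_tonelli.

(** * Haar measure under inversion and right translation *)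

Lemma ge0_integral_invariant d (T : measurableType d) (R : realType)
    (mu : {measure set T -> \bar R}) (phi : T -> T) (f : T -> \bar R) :
  measurable_fun setT phi ->
  (forall A, measurable A -> mu (phi @^-1` A) = mu A) ->
  measurable_fun setT f -> (forall x, 0 <= f x)%E ->
  (\int[mu]_x f (phi x) = \int[mu]_x f x)%E.
Proof.
move=> mphi muphi mf f0.
have := @ge0_integral_pushforward _ _ _ _ _ phi mphi mu setT f measurableT mf.
rewrite preimage_setT => <-; last by move=> x _; exact: f0.
by apply: eq_measure_integral => A mA _; rewrite -muphi.
Qed.

Section topological_group.
Variable G : topologicalGroupType.

Lemma mull_continuous (a : G) : continuous (fun x : G => a * x)%g.
Proof.
move=> x; apply: (@cvg_comp _ _ _ (fun x => (a, x)) (fun z : G * G => z.1 * z.2)%g).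
  exact: pair_continuous.
exact: (@mulg_continuous G (a, x)).
Qed.

Lemma mulr_continuous (a : G) : continuous (fun x : G => x * a)%g.
Proof.
move=> x; apply: (@cvg_comp _ _ _ (fun x => (x, a)) (fun z : G * G => z.1 * z.2)%g).
  exact: pair_continuous_l.
exact: (@mulg_continuous G (x, a)).
Qed.

Lemma ldiv_continuous : continuous (fun z : G * G => z.1^-1 * z.2)%g.
Proof.
move=> z; apply: (@cvg_comp _ _ _ (fun z : G * G => (z.1^-1, z.2)%g)
  (fun z : G * G => z.1 * z.2)%g); last exact: (@mulg_continuous G (z.1^-1, z.2)%g).
apply: cvg_pair => /=; last exact: cvg_snd.
apply: (@cvg_comp _ _ _ fst (fun x : G => x^-1)%g); first exact: cvg_fst.
exact: (@invg_continuous G z.1).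
Qed.

End topological_group.

Section haar.
Context (R : realType) (G : topologicalGroupType).
Variable mu : {measure set (borel G) -> \bar R}.

(** The exhaustion is by subgroups of finite positive measure: on such a subgroup invariance under
    inversion follows from Tonelli, with no modular function. *)
Record haar_exhaustion (D : nat -> set G) : Prop := {
  haar_radon : radon_exhaustion mu D ;
  haar_subgroup : forall n, is_subgroup (D n) ;
  haar_pos : forall n, (0 < mu (D n))%E ;
  haar_left : forall (x : G) (A : set (borel G)), measurable A ->
    mu ((fun y : G => x * y)%g @` A) = mu A
}.

Variable D : nat -> set G.
Hypothesis hD : haar_exhaustion D.

Let mull_borel (a : G) : measurable_fun setT ((fun x => a * x)%g : borel G -> borel G).
Proof. exact: continuous_borel (@mull_continuous G a). Qed.

Let mulr_borel (a : G) : measurable_fun setT ((fun x => x * a)%g : borel G -> borel G).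
Proof. exact: continuous_borel (@mulr_continuous G a). Qed.

Let inv_borel : measurable_fun setT ((fun x => x^-1)%g : borel G -> borel G).
Proof. exact: continuous_borel (@invg_continuous G). Qed.

Lemma mu_mull (a : G) (A : set (borel G)) : measurable A ->
  mu ((fun x : G => a * x)%g @^-1` A) = mu A.
Proof.
move=> mA; rewrite -(haar_left hD a^-1%g mA); congr (mu _).
apply/seteqP; split=> [x Ax|_ [x Ax <-]] /=; last by rewrite mulVKg.
by exists (a * x)%g; rewrite ?mulKg.
Qed.

(* Tonelli for the set of [(x, y)] with [D n x] and [B (x^-1 * y)]: one order of
   integration gives [mu (D n) * mu B], the other [mu (D n) * mu B^-1]. *)
Lemma mu_inv (A : set (borel G)) : measurable A ->
  mu ((fun x : G => x^-1)%g @^-1` A) = mu A.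
Proof.
have mpre (B : set (borel G)) : measurable B ->
    measurable ((fun x : G => x^-1)%g @^-1` B : set (borel G)).
  by move=> mB; rewrite -[X in measurable X]setTI; exact: inv_borel.
have mD n : measurable (D n : set (borel G)).
  by apply: open_borel; exact: (radon_open (haar_radon hD)).
have HD n (B : set (borel G)) : measurable B -> B `<=` D n ->
    mu ((fun x : G => x^-1)%g @^-1` B) = mu B.
  move=> mB BD.
  have [D1 DM DV] := haar_subgroup hD n.
  pose W : set (borel (G * G)%type) :=
    (fst @^-1` D n) `&` ((fun z => z.1^-1 * z.2)%g @^-1` B).
  have mW : measurable W.
    apply: measurableI.
      rewrite -[X in measurable X]setTI.
      have cf : continuous (fst : G * G -> G) by move=> z; exact: cvg_fst.
      exact: (continuous_borel cf).
    rewrite -[X in measurable X]setTI.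
    exact: (continuous_borel (@ldiv_continuous G)).
  have [_ _] := borel_tonelli (haar_radon hD) mW.
  have xE (x : G) : mu (xsection W x) = (mu B * (\1_(D n) x)%:E)%E.
    have [Dx|nDx] := pselect (D n x).
      rewrite indicE mem_set// mule1 -(mu_mull x^-1%g mB); congr (mu _).
      by apply/seteqP; split=> y; [move/xsectionP => []|move=> By; apply/xsectionP].
    rewrite indicE memNset// mule0 (_ : xsection W x = set0) ?measure0//.
    by apply/seteqP; split=> // y /xsectionP[].
  have yE (y : G) : mu (ysection W y) =
      (mu ((fun x : G => x^-1)%g @^-1` B) * (\1_(D n) y)%:E)%E.
    have [Dy|nDy] := pselect (D n y).
      rewrite indicE mem_set// mule1 -(mu_mull y^-1%g (mpre _ mB)); congr (mu _).
      apply/seteqP; split=> x /=; rewrite invgM invgK => /=.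
        by move/ysectionP => [].
      move=> Bx; apply/ysectionP; split => //=.
      rewrite -(mulVKg y x); apply: DM => //.
      by rewrite -(invgK (y^-1 * x)%g) invgM invgK; apply: DV; exact: BD.
    rewrite indicE memNset// mule0 (_ : ysection W y = set0) ?measure0//.
    apply/seteqP; split=> // x /ysectionP[/= Dx /BD Dxy]; apply: nDy.
    by rewrite -(mulVKg x y); exact: DM.
  have mI : measurable_fun setT (fun x : borel G => (\1_(D n) x)%:E : \bar R).
    by apply/measurable_EFinP; exact: measurable_indic.
  have I0 (x : borel G) : (0 <= (\1_(D n) x)%:E :> \bar R)%E by rewrite lee_fin.
  have IE (c : \bar R) : (0 <= c)%E ->
      (\int[mu]_x (c * (\1_(D n) x)%:E) = c * mu (D n))%E.
    by move=> c0; rewrite ge0_integralZl// integral_indic// setIT.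
  under eq_integral do rewrite xE.
  under [X in _ = X -> _]eq_integral do rewrite yE.
  rewrite !IE// => /esym E.
  have fD : mu (D n) \is a fin_num.
    by rewrite ge0_fin_numE//; exact: (radon_finite (haar_radon hD)).
  have D0 := haar_pos hD n.
  by apply/eqP; rewrite eq_le -(lee_pmul2r fD D0) -[X in _ && X](lee_pmul2r fD D0) E lexx.
move=> mA.
have cA : A = \bigcup_n (A `&` D n).
  by rewrite -setI_bigcupr (radon_cover (haar_radon hD)) setIT.
have ndA : nondecreasing_seq (fun n => A `&` D n).
  move=> m n mn; apply/subsetPset; apply: setIS.
  exact/subsetPset/(radon_nondecreasing (haar_radon hD)).
have mAD n : measurable (A `&` D n) by exact: measurableI.
have c1 : mu (A `&` D n) @[n --> \oo] --> mu A.
  rewrite [in X in _ --> X]cA; apply: nondecreasing_cvg_mu => //.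
  exact: bigcupT_measurable.
have c2 : mu ((fun x : G => x^-1)%g @^-1` (A `&` D n)) @[n --> \oo] -->
    mu ((fun x : G => x^-1)%g @^-1` A).
  rewrite [in X in _ --> X]cA preimage_bigcup; apply: nondecreasing_cvg_mu.
  - by move=> n; exact: mpre.
  - by apply: bigcupT_measurable => n; exact: mpre.
  - move=> m n mn; apply/subsetPset => x /=.
    by move/ndA : mn => /subsetPset; exact.
have e : (fun n => mu ((fun x : G => x^-1)%g @^-1` (A `&` D n))) =
    (fun n => mu (A `&` D n)).
  by apply/funext => n; apply: HD => //; exact: subIsetr.
by rewrite e in c2; exact: (cvg_unique _ c2 c1).
Qed.

(** A right translation is a left translation conjugated by inversion. *)
Lemma mu_mulr (a : G) (A : set (borel G)) : measurable A ->
  mu ((fun x : G => x * a)%g @^-1` A) = mu A.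
Proof.
move=> mA.
have mpre (B : set (borel G)) : measurable B ->
    measurable ((fun x : G => x^-1)%g @^-1` B : set (borel G)).
  by move=> mB; rewrite -[X in measurable X]setTI; exact: inv_borel.
rewrite -(mu_inv mA) -(mu_mull a^-1%g (mpre _ mA)) -mu_inv; last first.
  by have := mulr_borel a measurableT mA; rewrite setTI.
congr (mu _); apply/seteqP; split=> x /=; by rewrite invgM invgK.
Qed.

Lemma ge0_integral_mull (a : G) (f : G -> \bar R) :
  measurable_fun setT (f : borel G -> \bar R) -> (forall x, 0 <= f x)%E ->
  (\int[mu]_x f (a * x)%g = \int[mu]_x f x)%E.
Proof. exact: (ge0_integral_invariant (mull_borel a) (@mu_mull a)). Qed.

Lemma ge0_integral_mulr (a : G) (f : G -> \bar R) :
  measurable_fun setT (f : borel G -> \bar R) -> (forall x, 0 <= f x)%E ->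
  (\int[mu]_x f (x * a)%g = \int[mu]_x f x)%E.
Proof. exact: (ge0_integral_invariant (mulr_borel a) (@mu_mulr a)). Qed.

Lemma ge0_integral_inv (f : G -> \bar R) :
  measurable_fun setT (f : borel G -> \bar R) -> (forall x, 0 <= f x)%E ->
  (\int[mu]_x f x^-1%g = \int[mu]_x f x)%E.
Proof. exact: (ge0_integral_invariant inv_borel mu_inv). Qed.

End haar.

Local Open Scope complex_scope.

(** * Complex-valued functions and convolution *)

Section modulus.
Variable R : realType.
Implicit Types z w : R[i].

Lemma modulus_ge0 z : 0 <= modulus z.
Proof. by case: z => a b; exact: sqrtr_ge0. Qed.

Lemma modulus0 : modulus (0 : R[i]) = 0.
Proof. exact: ComplexField.Normc.normc0. Qed.

Lemma modulus1 : modulus (1 : R[i]) = 1.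
Proof. exact: ComplexField.Normc.normc1. Qed.

Lemma modulusM z w : modulus (z * w) = modulus z * modulus w.
Proof. exact: ComplexField.Normc.normcM. Qed.

Lemma modulusV z : modulus z^-1 = (modulus z)^-1.
Proof. exact: ComplexField.Normc.normcV. Qed.

Lemma modulusD z w : modulus (z + w) <= modulus z + modulus w.
Proof. exact: le_normcD. Qed.

Lemma modulusN z : modulus (- z) = modulus z.
Proof. exact: normcN. Qed.

Lemma modulus_eq0 z : (modulus z == 0) = (z == 0).
Proof.
apply/eqP/eqP => [|->]; last exact: modulus0.
exact: ComplexField.Normc.eq0_normc.
Qed.

Lemma modulus_real (r : R) : modulus r%:C = `|r|.
Proof. by rewrite /modulus/= expr0n/= addr0 sqrtr_sqr. Qed.

Lemma modulusX z n : modulus (z ^+ n) = modulus z ^+ n.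
Proof.
elim: n => [|n ih]; first by rewrite !expr0 modulus1.
by rewrite !exprS modulusM ih.
Qed.

Lemma modulus_Re z : `|complex.Re z| <= modulus z.
Proof.
case: z => a b /=; rewrite -sqrtr_sqr /modulus/= ler_wsqrtr//.
by rewrite lerDl sqr_ge0.
Qed.

Lemma modulus_Im z : `|complex.Im z| <= modulus z.
Proof.
case: z => a b /=; rewrite -sqrtr_sqr /modulus/= ler_wsqrtr//.
by rewrite lerDr sqr_ge0.
Qed.

Lemma modulus_le z : modulus z <= `|complex.Re z| + `|complex.Im z|.
Proof.
case: z => a b /=; rewrite -[leRHS]ger0_norm ?addr_ge0// -[leRHS]sqrtr_sqr.
rewrite /modulus/= ler_wsqrtr// sqrrD !real_normK ?num_real//.
by rewrite addrAC lerDl mulrn_wge0// mulr_ge0.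
Qed.

Lemma cReD z w : complex.Re (z + w) = complex.Re z + complex.Re w.
Proof. by case: z w => [a b] [c d]. Qed.

Lemma cImD z w : complex.Im (z + w) = complex.Im z + complex.Im w.
Proof. by case: z w => [a b] [c d]. Qed.

Lemma cReN z : complex.Re (- z) = - complex.Re z.
Proof. by case: z. Qed.

Lemma cImN z : complex.Im (- z) = - complex.Im z.
Proof. by case: z. Qed.

Lemma cReM z w : complex.Re (z * w) =
  complex.Re z * complex.Re w - complex.Im z * complex.Im w.
Proof. by case: z w => [a b] [c d]. Qed.

Lemma cImM z w : complex.Im (z * w) =
  complex.Re z * complex.Im w + complex.Im z * complex.Re w.
Proof. by case: z w => [a b] [c d]. Qed.

End modulus.

Section complex_measurable.
Context d (T : measurableType d) (R : realType).
Implicit Types f g : T -> R[i].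

Definition cmeas f := measurable_fun setT (fun x => complex.Re (f x)) /\
  measurable_fun setT (fun x => complex.Im (f x)).

Lemma cmeas_cst (c : R[i]) : cmeas (fun=> c).
Proof. by split; exact: measurable_cst. Qed.

Lemma cmeasD f g : cmeas f -> cmeas g -> cmeas (fun x => f x + g x).
Proof.
move=> [mf mf'] [mg mg']; split.
  by under eq_fun do rewrite cReD; exact: measurable_funD.
by under eq_fun do rewrite cImD; exact: measurable_funD.
Qed.

Lemma cmeasN f : cmeas f -> cmeas (fun x => - f x).
Proof.
move=> [mf mf']; split.
  by under eq_fun do rewrite cReN; exact: measurableT_comp.
by under eq_fun do rewrite cImN; exact: measurableT_comp.
Qed.

Lemma cmeasM f g : cmeas f -> cmeas g -> cmeas (fun x => f x * g x).
Proof.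
move=> [mf mf'] [mg mg']; split.
  by under eq_fun do rewrite cReM; apply: measurable_funB; exact: measurable_funM.
by under eq_fun do rewrite cImM; apply: measurable_funD; exact: measurable_funM.
Qed.

Lemma cmeas_modulus f : cmeas f -> measurable_fun setT (fun x => modulus (f x)).
Proof.
move=> [mf mf'].
have -> : (fun x => modulus (f x)) =
    (fun x => Num.sqrt (complex.Re (f x) ^+ 2 + complex.Im (f x) ^+ 2)).
  by apply/funext => x; case: (f x).
apply: measurableT_comp; first by apply: continuous_measurable_fun; exact: sqrt_continuous.
by apply: measurable_funD; exact: measurable_funX.
Qed.

Lemma cmeas_emodulus f : cmeas f ->
  measurable_fun setT (fun x => (modulus (f x))%:E).
Proof. by move=> /cmeas_modulus mf; exact/measurable_EFinP. Qed.

Lemma cmeas_real (f : T -> R) : measurable_fun setT f ->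
  cmeas (fun x => (f x)%:C).
Proof. by move=> mf; split => //=; exact: measurable_cst. Qed.

End complex_measurable.

Lemma cmeas_comp d (S : measurableType d) d' (T : measurableType d')
    (R : realType) (phi : S -> T) (f : T -> R[i]) :
  measurable_fun setT phi -> cmeas f -> cmeas (fun x => f (phi x)).
Proof.
move=> mphi [mf mf']; split.
  exact: (measurableT_comp mf mphi).
exact: (measurableT_comp mf' mphi).
Qed.

Lemma rdiv_continuous (G : topologicalGroupType) :
  continuous (fun z : G * G => z.2 * z.1^-1)%g.
Proof.
move=> z; apply: (@cvg_comp _ _ _ (fun z : G * G => (z.2, z.1^-1)%g)
  (fun z : G * G => z.1 * z.2)%g); last exact: (@mulg_continuous G (z.2, z.1^-1)%g).
apply: cvg_pair => /=; first exact: cvg_snd.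
apply: (@cvg_comp _ _ _ fst (fun x : G => x^-1)%g); first exact: cvg_fst.
exact: (@invg_continuous G z.1).
Qed.

(** * Convolution of nonnegative extended-real functions *)

Section convolution_ge0.
Context (R : realType) (G : topologicalGroupType).
Variable mu : {measure set (borel G) -> \bar R}.
Variable D : nat -> set G.
Hypothesis hD : haar_exhaustion mu D.
Implicit Types f g h : G -> \bar R.

Definition emeas f := measurable_fun setT (f : borel G -> \bar R).

Lemma emeas_comp f (phi : G -> G) : continuous phi -> emeas f -> emeas (f \o phi).
Proof. by move=> cphi mf; apply: measurableT_comp mf _; exact: continuous_borel. Qed.

Lemma invmul_continuous (x : G) : continuous (fun y : G => y^-1 * x)%g.
Proof.
move=> y; apply: (@cvg_comp _ _ _ (fun y : G => y^-1)%g (fun z => z * x)%g).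
  exact: invg_continuous.
exact: mulr_continuous.
Qed.

Lemma mulinv_continuous (x : G) : continuous (fun y : G => x * y^-1)%g.
Proof.
move=> y; apply: (@cvg_comp _ _ _ (fun y : G => y^-1)%g (fun z => x * z)%g).
  exact: invg_continuous.
exact: mull_continuous.
Qed.

Lemma measurable_fst f : emeas f ->
  measurable_fun setT ((fun z => f z.1) : borel (G * G)%type -> \bar R).
Proof.
move=> mf.
have cf : continuous (fst : G * G -> G) by move=> z; exact: cvg_fst.
exact: (measurableT_comp mf (continuous_borel cf)).
Qed.

Lemma measurable_snd f : emeas f ->
  measurable_fun setT ((fun z => f z.2) : borel (G * G)%type -> \bar R).
Proof.
move=> mf.
have cf : continuous (snd : G * G -> G) by move=> z; exact: cvg_snd.
exact: (measurableT_comp mf (continuous_borel cf)).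
Qed.

Lemma measurable_ldiv f : emeas f ->
  measurable_fun setT ((fun z => f (z.1^-1 * z.2)%g) : borel (G * G)%type -> \bar R).
Proof.
by move=> mf; exact: (measurableT_comp mf (continuous_borel (@ldiv_continuous G))).
Qed.

Lemma haar_tonelli (F : G * G -> \bar R) :
  measurable_fun setT (F : borel (G * G)%type -> \bar R) ->
  (forall z, 0 <= F z)%E ->
  [/\ emeas (fun x : G => \int[mu]_y F (x, y))%E,
      emeas (fun y : G => \int[mu]_x F (x, y))%E &
      \int[mu]_x \int[mu]_y F (x, y) = \int[mu]_y \int[mu]_x F (x, y)]%E.
Proof. exact: (radon_tonelli (haar_radon hD)). Qed.

(** Meaningful at every point, with [+oo] allowed. Estimates and identities for complex
    convolutions, whose integrals may diverge at some points, are reduced to it. *)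
Definition ge0_convolution f g : G -> \bar R :=
  fun x => (\int[mu]_y (f y * g (y^-1 * x)%g))%E.

Lemma ge0_convolution_ge0 f g : (forall x, 0 <= f x)%E ->
  (forall x, 0 <= g x)%E -> forall x, (0 <= ge0_convolution f g x)%E.
Proof. by move=> f0 g0 x; apply: integral_ge0 => y _; exact: mule_ge0. Qed.

Let integralZl_emeas (r : \bar R) f : (0 <= r)%E -> emeas f -> (forall x, 0 <= f x)%E ->
  (\int[mu]_x (r * f x) = r * \int[mu]_x f x)%E.
Proof. by move=> r0 mf f0; exact: (@ge0_integralZl _ _ _ mu setT measurableT). Qed.

Let integralZr_emeas (r : \bar R) f : (0 <= r)%E -> emeas f -> (forall x, 0 <= f x)%E ->
  (\int[mu]_x (f x * r) = \int[mu]_x f x * r)%E.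
Proof. by move=> r0 mf f0; exact: (@ge0_integralZr _ _ _ mu setT measurableT). Qed.

Lemma measurable_conv_kernel f g : emeas f -> emeas g ->
  measurable_fun setT ((fun z => f z.1 * g (z.1^-1 * z.2)%g)%E : borel (G * G)%type -> \bar R).
Proof.
move=> mf mg; apply: emeasurable_funM; first exact: measurable_fst.
exact: measurable_ldiv.
Qed.

Lemma emeas_ge0_convolution f g : emeas f -> emeas g -> (forall x, 0 <= f x)%E ->
  (forall x, 0 <= g x)%E -> emeas (ge0_convolution f g).
Proof.
move=> mf mg f0 g0.
have [|_ + _] := haar_tonelli (measurable_conv_kernel mf mg); last exact.
by move=> z; exact: mule_ge0.
Qed.

(* [ge0_convolution_pairl] and [ge0_convolution_pairr] are Tonelli's theorem for
   [h x * f y * g (y^-1 x)]; the second one uses unimodularity. *)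
Lemma ge0_convolution_pairl f g h : emeas f -> emeas g -> emeas h ->
  (forall x, 0 <= f x)%E -> (forall x, 0 <= g x)%E -> (forall x, 0 <= h x)%E ->
  (\int[mu]_x (h x * ge0_convolution f g x) =
   \int[mu]_y (f y * \int[mu]_x (h x * g (y^-1 * x)%g)))%E.
Proof.
move=> mf mg mh f0 g0 h0.
pose F (z : G * G) := (h z.2 * (f z.1 * g (z.1^-1 * z.2)%g))%E.
have mF : measurable_fun setT (F : borel (G * G)%type -> \bar R).
  apply: emeasurable_funM; first exact: measurable_snd.
  exact: measurable_conv_kernel.
have F0 z : (0 <= F z)%E by rewrite /F mule_ge0// mule_ge0.
have [_ _ E] := haar_tonelli mF F0.
transitivity (\int[mu]_x \int[mu]_y F (y, x))%E.
  apply: eq_integral => x _; apply/esym.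
  apply: (integralZl_emeas (h0 x) (f := fun y => f y * g (y^-1 * x)%g)%E).
    exact: (emeasurable_funM mf (emeas_comp (@invmul_continuous x) mg)).
  by move=> y; exact: mule_ge0.
rewrite -E; apply: eq_integral => y _.
rewrite -(integralZl_emeas (f0 y) (f := fun x => h x * g (y^-1 * x)%g)%E).
- by apply: eq_integral => x _; rewrite /F/= muleCA.
- exact: (emeasurable_funM mh (emeas_comp (@mull_continuous _ y^-1%g) mg)).
- by move=> x; exact: mule_ge0.
Qed.

(** The substitution [y = x * z^-1], by left invariance and invariance under inversion. *)
Lemma ge0_convolutionE f g : emeas f -> emeas g -> (forall x, 0 <= f x)%E ->
  (forall x, 0 <= g x)%E ->
  forall x, (ge0_convolution f g x = \int[mu]_z (f (x * z^-1)%g * g z))%E.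
Proof.
move=> mf mg f0 g0 x; rewrite /ge0_convolution.
have mF : emeas (fun y => f y * g (y^-1 * x)%g)%E.
  exact: (emeasurable_funM mf (emeas_comp (@invmul_continuous x) mg)).
have F0 y : (0 <= f y * g (y^-1 * x)%g)%E by exact: mule_ge0.
rewrite -(ge0_integral_mull hD x mF)// -(ge0_integral_inv hD)//; last first.
  exact: (emeas_comp (@mull_continuous _ x) mF).
by apply: eq_integral => y _; rewrite invgM invgK mulgVK.
Qed.

Lemma ge0_convolution_pairr f g h : emeas f -> emeas g -> emeas h ->
  (forall x, 0 <= f x)%E -> (forall x, 0 <= g x)%E -> (forall x, 0 <= h x)%E ->
  (\int[mu]_x (h x * ge0_convolution f g x) =
   \int[mu]_z (g z * \int[mu]_x (h (x * z)%g * f x)))%E.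
Proof.
move=> mf mg mh f0 g0 h0.
pose F (z : G * G) := (h z.2 * (f (z.2 * z.1^-1)%g * g z.1))%E.
have mF : measurable_fun setT (F : borel (G * G)%type -> \bar R).
  apply: emeasurable_funM; first exact: measurable_snd.
  apply: emeasurable_funM; last exact: measurable_fst.
  exact: (measurableT_comp mf (continuous_borel (@rdiv_continuous G))).
have F0 z : (0 <= F z)%E by rewrite /F mule_ge0// mule_ge0.
have [_ _ E] := haar_tonelli mF F0.
transitivity (\int[mu]_x \int[mu]_y F (y, x))%E.
  apply: eq_integral => x _; rewrite (ge0_convolutionE mf mg f0 g0 x); apply/esym.
  apply: (integralZl_emeas (h0 x) (f := fun z => f (x * z^-1)%g * g z)%E).
    exact: (emeasurable_funM (emeas_comp (@mulinv_continuous x) mf) mg).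
  by move=> y; exact: mule_ge0.
rewrite -E; apply: eq_integral => z _.
have mK : emeas (fun x => h x * f (x * z^-1)%g)%E.
  exact: (emeasurable_funM mh (emeas_comp (@mulr_continuous _ z^-1%g) mf)).
have K0 x : (0 <= h x * f (x * z^-1)%g)%E by exact: mule_ge0.
transitivity (g z * \int[mu]_x (h x * f (x * z^-1)%g))%E.
  rewrite -(integralZl_emeas (g0 z) mK K0); apply: eq_integral => x _.
  by rewrite /F/= muleA muleC.
rewrite -(ge0_integral_mulr hD z mK K0); congr (_ * _)%E.
by apply: eq_integral => x _; rewrite mulgK.
Qed.

Lemma integral_ge0_convolution f g : emeas f -> emeas g ->
  (forall x, 0 <= f x)%E -> (forall x, 0 <= g x)%E ->
  (\int[mu]_x ge0_convolution f g x = \int[mu]_x f x * \int[mu]_x g x)%E.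
Proof.
move=> mf mg f0 g0.
have m1 : emeas (fun=> 1%E) by exact: measurable_cst.
have := ge0_convolution_pairl mf mg m1 f0 g0 (fun=> lee01).
under eq_integral do rewrite mul1e.
move=> ->; transitivity (\int[mu]_y (f y * \int[mu]_x g x))%E.
  apply: eq_integral => y _; congr (_ * _)%E.
  under eq_integral do rewrite mul1e.
  exact: (ge0_integral_mull hD).
by apply: integralZr_emeas => //; exact: integral_ge0.
Qed.

(** This is [ge0_convolution_pairl] with the test function [w |-> h (w^-1 * x)], followed by a left
    translation of the inner integral. *)
Lemma ge0_convolutionA f g h : emeas f -> emeas g -> emeas h ->
  (forall x, 0 <= f x)%E -> (forall x, 0 <= g x)%E -> (forall x, 0 <= h x)%E ->
  ge0_convolution f (ge0_convolution g h) = ge0_convolution (ge0_convolution f g) h.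
Proof.
move=> mf mg mh f0 g0 h0; apply/funext => x; rewrite /ge0_convolution.
have mH : emeas (fun w => h (w^-1 * x)%g).
  exact: (emeas_comp (@invmul_continuous x) mh).
transitivity (\int[mu]_w (h (w^-1 * x)%g * ge0_convolution f g w))%E; last first.
  by apply: eq_integral => w _; rewrite muleC.
rewrite (ge0_convolution_pairl mf mg mH f0 g0 (fun w => h0 _)).
apply: eq_integral => y _; congr (_ * _)%E.
rewrite -[RHS](ge0_integral_mull hD y).
- by apply: eq_integral => z _; rewrite mulKg invgM mulgA muleC.
- exact: (emeasurable_funM mH (emeas_comp (@mull_continuous _ y^-1%g) mg)).
- by move=> z; exact: mule_ge0.
Qed.

Lemma ge0_convolution_ael f f' g : emeas f -> emeas f' -> emeas g ->
  (forall x, 0 <= f x)%E -> (forall x, 0 <= f' x)%E -> (forall x, 0 <= g x)%E ->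
  {ae mu, forall x : borel G, f x = f' x} ->
  ge0_convolution f g = ge0_convolution f' g.
Proof.
move=> mf mf' mg f0 f'0 g0 ff'; apply/funext => x.
have mK := emeas_comp (@invmul_continuous x) mg.
apply: ge0_ae_eq_integral.
- exact: measurableT.
- exact: (emeasurable_funM mf mK).
- exact: (emeasurable_funM mf' mK).
- by move=> y _; exact: mule_ge0.
- by move=> y _; exact: mule_ge0.
- by apply: filterS ff' => y -> _.
Qed.

(** In the form of [ge0_convolutionE] the right factor is evaluated at the integration variable
    itself, so the exceptional null set is not moved. *)
Lemma ge0_convolution_aer f g g' : emeas f -> emeas g -> emeas g' ->
  (forall x, 0 <= f x)%E -> (forall x, 0 <= g x)%E -> (forall x, 0 <= g' x)%E ->
  {ae mu, forall x : borel G, g x = g' x} ->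
  ge0_convolution f g = ge0_convolution f g'.
Proof.
move=> mf mg mg' f0 g0 g'0 gg'; apply/funext => x.
rewrite !ge0_convolutionE//.
have mK := emeas_comp (@mulinv_continuous x) mf.
apply: ge0_ae_eq_integral.
- exact: measurableT.
- exact: (emeasurable_funM mK mg).
- exact: (emeasurable_funM mK mg').
- by move=> y _; exact: mule_ge0.
- by move=> y _; exact: mule_ge0.
- by apply: filterS gg' => y -> _.
Qed.

End convolution_ge0.

(** * The complex integral and the L1 norm *)

Section complex_integral.
Context (R : realType) (G : topologicalGroupType).
Variable mu : {measure set (borel G) -> \bar R}.
Implicit Types f g : G -> R[i].

Definition L1_norm f : \bar R := (\int[mu]_x (modulus (f x))%:E)%E.

Lemma L1_norm_ge0 f : (0 <= L1_norm f)%E.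
Proof. by apply: integral_ge0 => x _; rewrite lee_fin modulus_ge0. Qed.

Lemma L1_integrable_Re f : L1 mu f ->
  mu.-integrable setT (fun x : borel G => (complex.Re (f x))%:E).
Proof.
move=> [[mf mf'] foo]; apply/integrableP; split; first exact/measurable_EFinP.
apply: le_lt_trans foo; apply: ge0_le_integral => //.
- by apply/measurable_EFinP; exact: measurableT_comp.
- exact: cmeas_emodulus.
- by move=> x _; rewrite lee_fin modulus_Re.
Qed.

Lemma L1_integrable_Im f : L1 mu f ->
  mu.-integrable setT (fun x : borel G => (complex.Im (f x))%:E).
Proof.
move=> [[mf mf'] foo]; apply/integrableP; split; first exact/measurable_EFinP.
apply: le_lt_trans foo; apply: ge0_le_integral => //.
- by apply/measurable_EFinP; exact: measurableT_comp.
- exact: cmeas_emodulus.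
- by move=> x _; rewrite lee_fin modulus_Im.
Qed.

Lemma L1_normD f g : cmeasurable f -> cmeasurable g ->
  (L1_norm (f \+ g)%R <= L1_norm f + L1_norm g)%E.
Proof.
have H0 (h : G -> R[i]) (x : borel G) : [set: borel G] x -> (0 <= (modulus (h x))%:E)%E.
  by rewrite lee_fin modulus_ge0.
move=> mf mg; rewrite /L1_norm -(ge0_integralD mu measurableT (H0 f) (cmeas_emodulus mf)
  (H0 g) (cmeas_emodulus mg)).
apply: ge0_le_integral => //.
- exact: H0.
- by apply: cmeas_emodulus; exact: cmeasD.
- exact: (emeasurable_funD (cmeas_emodulus mf) (cmeas_emodulus mg)).
- by move=> x _; rewrite -EFinD lee_fin modulusD.
Qed.

Lemma L1_normZ (c : R[i]) f : cmeasurable f ->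
  L1_norm (fun x => c * f x) = ((modulus c)%:E * L1_norm f)%E.
Proof.
move=> mf; rewrite /L1_norm -(@ge0_integralZl _ _ _ mu setT measurableT).
- by apply: eq_integral => x _; rewrite modulusM EFinM.
- exact: cmeas_emodulus.
- by move=> x _; rewrite lee_fin modulus_ge0.
- by rewrite lee_fin modulus_ge0.
Qed.

Lemma L1_add f g : L1 mu f -> L1 mu g -> L1 mu (f \+ g).
Proof.
move=> [mf foo] [mg goo]; split; first exact: cmeasD.
by apply: le_lt_trans (L1_normD mf mg) _; exact: lte_add_pinfty.
Qed.

Lemma L1_scale c f : L1 mu f -> L1 mu (fun x => c * f x).
Proof.
move=> [mf foo]; split; first by apply: cmeasM => //; exact: cmeas_cst.
have := L1_normZ c mf; rewrite /L1_norm => ->.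
by apply: lte_mul_pinfty => //; rewrite lee_fin modulus_ge0.
Qed.

Lemma cintegralD f g : L1 mu f -> L1 mu g ->
  cintegral mu (f \+ g) = cintegral mu f + cintegral mu g.
Proof.
move=> Lf Lg; rewrite /cintegral.
under eq_Rintegral do rewrite cReD.
under [X in _ +i* X]eq_Rintegral do rewrite cImD.
rewrite RintegralD//; [|exact: L1_integrable_Re|exact: L1_integrable_Re].
by rewrite RintegralD//; [exact: L1_integrable_Im|exact: L1_integrable_Im].
Qed.

Lemma cintegralZ c f : L1 mu f ->
  cintegral mu (fun x => c * f x) = c * cintegral mu f.
Proof.
move=> Lf; have iR := L1_integrable_Re Lf; have iI := L1_integrable_Im Lf.
have iZ (r : R) (h : borel G -> R) : mu.-integrable setT (EFin \o h) ->
    mu.-integrable setT (EFin \o (fun x => r * h x)).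
  by move=> ih; exact: (integrableZl measurableT r ih).
rewrite /cintegral; under eq_Rintegral do rewrite cReM.
under [X in _ +i* X]eq_Rintegral do rewrite cImM.
rewrite RintegralB//; [|exact: iZ|exact: iZ].
rewrite RintegralD//; [|exact: iZ|exact: iZ].
rewrite !RintegralZl//.
by case: c.
Qed.

(** Real and imaginary parts are bounded separately, whence the factor 2. It only enlarges algebra
    constants, to which spectral radii are insensitive. *)
Lemma modulus_cintegral f : cmeasurable f ->
  ((modulus (cintegral mu f))%:E <= 2%:E * L1_norm f)%E.
Proof.
move=> mf; have [foo|] := ltP (L1_norm f) +oo%E; last first.
  by rewrite leye_eq => /eqP ->; rewrite gt0_muley ?leey// lte_fin.
have Lf : L1 mu f by [].
have bnd (h : borel G -> R) : mu.-integrable setT (EFin \o h) ->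
    (forall x, `|h x| <= modulus (f x)) ->
    ((`|\int[mu]_x h x|)%R%:E <= L1_norm f)%E.
  move=> ih hf; rewrite EFin_normr_Rintegral//.
  have mh : measurable_fun setT (EFin \o h) by case/integrableP: ih.
  apply: le_trans (le_abse_integral mu measurableT mh) _.
  apply: ge0_le_integral => //.
  - exact: measurableT_comp.
  - exact: cmeas_emodulus.
  - by move=> x _; rewrite lee_fin.
apply: le_trans (_ : (_ + _)%:E <= _)%E; first by rewrite lee_fin; exact: modulus_le.
rewrite mule_natl mule2n EFinD; apply: leeD.
  by apply: bnd; [exact: L1_integrable_Re|move=> x; exact: modulus_Re].
by apply: bnd; [exact: L1_integrable_Im|move=> x; exact: modulus_Im].
Qed.

End complex_integral.

(** * Convolution of complex functions *)

Section complex_convolution.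
Context (R : realType) (G : topologicalGroupType).
Variable mu : {measure set (borel G) -> \bar R}.
Variable D : nat -> set G.
Hypothesis hD : haar_exhaustion mu D.
Implicit Types f g h : G -> R[i].

Definition emod f : G -> \bar R := fun x => (modulus (f x))%:E.

Lemma emod_ge0 f x : (0 <= emod f x)%E.
Proof. by rewrite lee_fin modulus_ge0. Qed.

Lemma emeas_emod f : cmeasurable f -> emeas (emod f).
Proof. exact: cmeas_emodulus. Qed.

Lemma cmeas_conv_kernel f g x : cmeasurable f -> cmeasurable g ->
  cmeasurable (fun y => f y * g (y^-1 * x)%g).
Proof.
move=> mf mg; apply: (@cmeasM _ (borel G)) => //.
exact: (cmeas_comp (continuous_borel (@invmul_continuous G x)) mg).
Qed.

Lemma L1_norm_conv_kernel f g x :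
  L1_norm mu (fun y => f y * g (y^-1 * x)%g) = ge0_convolution mu (emod f) (emod g) x.
Proof. by apply: eq_integral => y _; rewrite modulusM EFinM. Qed.

Lemma modulus_convolution f g x : cmeasurable f -> cmeasurable g ->
  ((modulus (convolution mu f g x))%:E <=
   2%:E * ge0_convolution mu (emod f) (emod g) x)%E.
Proof.
move=> mf mg; rewrite -L1_norm_conv_kernel; apply: modulus_cintegral.
exact: cmeas_conv_kernel.
Qed.

(** [Rintegral] is [fine] of the difference of the integrals of the positive and negative parts,
    each measurable by Tonelli, so it is measurable also where the integral diverges. *)
Lemma measurable_Rintegral_section (F : G * G -> R) :
  measurable_fun setT (F : borel (G * G)%type -> R) ->
  measurable_fun setT ((fun x => \int[mu]_y F (y, x)) : borel G -> R).
Proof.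
move=> mF; have mE : measurable_fun setT ((fun z => (F z)%:E) : borel (G * G)%type -> \bar R).
  exact/measurable_EFinP.
have [_ mp _] := haar_tonelli hD (measurable_funepos mE) (funepos_ge0 _).
have [_ mn _] := haar_tonelli hD (measurable_funeneg mE) (funeneg_ge0 _).
have E : (fun x => \int[mu]_y F (y, x)) = (fun x => fine
    (\int[mu]_y ((fun z => (F z)%:E)^\+ (y, x)) -
     \int[mu]_y ((fun z => (F z)%:E)^\- (y, x)))%E).
  apply/funext => x; rewrite /Rintegral integralE; congr (fine (_ - _)).
    by apply: eq_integral => y _; rewrite !funeposE.
  by apply: eq_integral => y _; rewrite !funenegE.
rewrite E; apply: measurableT_comp; first exact: fine_measurable.
exact: (emeasurable_funB mp mn).
Qed.

Lemma cmeasurable_convolution f g : cmeasurable f -> cmeasurable g ->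
  cmeasurable (convolution mu f g).
Proof.
move=> mf mg.
have cf : continuous (fst : G * G -> G) by move=> z; exact: cvg_fst.
have m1 := cmeas_comp (continuous_borel cf) mf.
have m2 := cmeas_comp (continuous_borel (@ldiv_continuous G)) mg.
have [mR mI] := cmeasM m1 m2.
by split; [exact: (measurable_Rintegral_section mR)|
           exact: (measurable_Rintegral_section mI)].
Qed.

Lemma L1_convolution_norm f g : cmeasurable f -> cmeasurable g ->
  (L1_norm mu (convolution mu f g) <= 2%:E * L1_norm mu f * L1_norm mu g)%E.
Proof.
move=> mf mg; have mc := cmeasurable_convolution mf mg.
have mk : emeas (ge0_convolution mu (emod f) (emod g)).
  exact: (emeas_ge0_convolution hD (emeas_emod mf) (emeas_emod mg) (emod_ge0 f) (emod_ge0 g)).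
have k0 := ge0_convolution_ge0 mu (emod_ge0 f) (emod_ge0 g).
apply: (@le_trans _ _ (\int[mu]_x (2%:E * ge0_convolution mu (emod f) (emod g) x))%E).
  apply: ge0_le_integral => //.
  - by move=> x _; exact: emod_ge0.
  - exact: emeas_emod.
  - exact: measurable_funeM.
  - by move=> x _; exact: modulus_convolution.
rewrite (@ge0_integralZl _ _ _ mu setT measurableT)//.
by rewrite (integral_ge0_convolution hD (emeas_emod mf) (emeas_emod mg)
  (emod_ge0 f) (emod_ge0 g)) muleA.
Qed.

Lemma L1_convolution f g : L1 mu f -> L1 mu g -> L1 mu (convolution mu f g).
Proof.
move=> [mf foo] [mg goo]; split; first exact: cmeasurable_convolution.
apply: le_lt_trans (L1_convolution_norm mf mg) _.
rewrite -muleA; apply: lte_mul_pinfty => //.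
by apply: lte_mul_pinfty => //; [exact: L1_norm_ge0|rewrite ge0_fin_numE ?L1_norm_ge0].
Qed.

(** The integral over [x] is the product of the two norms. Outside the exceptional null set the
    convolution integral converges absolutely, which gives bilinearity almost everywhere. *)
Lemma ae_ge0_convolution_fin f g : L1 mu f -> L1 mu g ->
  {ae mu, forall x : borel G, (ge0_convolution mu (emod f) (emod g) x < +oo)%E}.
Proof.
move=> [mf foo] [mg goo].
have mk : emeas (ge0_convolution mu (emod f) (emod g)).
  exact: (emeas_ge0_convolution hD (emeas_emod mf) (emeas_emod mg) (emod_ge0 f) (emod_ge0 g)).
have k0 := ge0_convolution_ge0 mu (emod_ge0 f) (emod_ge0 g).
have ik : mu.-integrable setT (ge0_convolution mu (emod f) (emod g)).
  apply/integrableP; split => //.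
  under eq_integral do rewrite gee0_abs//.
  rewrite (integral_ge0_convolution hD (emeas_emod mf) (emeas_emod mg)
    (emod_ge0 f) (emod_ge0 g)).
  by apply: lte_mul_pinfty => //; [exact: L1_norm_ge0|rewrite ge0_fin_numE ?L1_norm_ge0].
have := integrable_ae measurableT ik; apply: filterS => x /(_ I).
by rewrite ge0_fin_numE.
Qed.

Lemma ae_L1_conv_kernel f g : L1 mu f -> L1 mu g ->
  {ae mu, forall x : borel G, L1 mu (fun y => f y * g (y^-1 * x)%g)}.
Proof.
move=> Lf Lg; have := ae_ge0_convolution_fin Lf Lg; apply: filterS => x.
rewrite -L1_norm_conv_kernel => xoo; split => //.
by apply: cmeas_conv_kernel; [exact: Lf.1|exact: Lg.1].
Qed.

Lemma convolutionDl f g h : L1 mu f -> L1 mu g -> L1 mu h ->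
  aeq mu (convolution mu (f \+ g) h) (convolution mu f h \+ convolution mu g h).
Proof.
move=> Lf Lg Lh; apply: filterS2 (ae_L1_conv_kernel Lf Lh) (ae_L1_conv_kernel Lg Lh).
move=> x Lfx Lgx; rewrite /convolution/= -cintegralD//.
by congr cintegral; apply/funext => y; rewrite /= mulrDl.
Qed.

Lemma convolutionDr f g h : L1 mu f -> L1 mu g -> L1 mu h ->
  aeq mu (convolution mu f (g \+ h)) (convolution mu f g \+ convolution mu f h).
Proof.
move=> Lf Lg Lh; apply: filterS2 (ae_L1_conv_kernel Lf Lg) (ae_L1_conv_kernel Lf Lh).
move=> x Lfx Lgx; rewrite /convolution/= -cintegralD//.
by congr cintegral; apply/funext => y; rewrite /= mulrDr.
Qed.

Lemma convolutionZl c f g : L1 mu f -> L1 mu g ->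
  aeq mu (convolution mu (fun x => c * f x) g) (fun x => c * convolution mu f g x).
Proof.
move=> Lf Lg; apply: filterS (ae_L1_conv_kernel Lf Lg) => x Lx.
rewrite /convolution -cintegralZ//.
by congr cintegral; apply/funext => y; rewrite mulrA.
Qed.

Lemma convolutionZr c f g : L1 mu f -> L1 mu g ->
  aeq mu (convolution mu f (fun x => c * g x)) (fun x => c * convolution mu f g x).
Proof.
move=> Lf Lg; apply: filterS (ae_L1_conv_kernel Lf Lg) => x Lx.
rewrite /convolution -cintegralZ//.
by congr cintegral; apply/funext => y; rewrite mulrCA.
Qed.

Lemma L1_norm_eq0 f : L1 mu f -> (L1_norm mu f = 0%E <-> aeq mu f (fun=> 0)).
Proof.
move=> [mf foo].
have m := emeas_emod mf.
have := ae_eq_integral_abs mu measurableT m.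
have -> : (\int[mu]_x `|emod f x|)%E = L1_norm mu f.
  by apply: eq_integral => x _; rewrite gee0_abs// emod_ge0.
move=> ->; split; apply: filterS => x.
  by move=> /(_ I) [] /eqP; rewrite modulus_eq0 => /eqP.
by move=> fx0 _; rewrite /emod fx0 modulus0.
Qed.

End complex_convolution.

Section L1_ind.
Context (R : realType) (G : topologicalGroupType).
Variable mu : {measure set (borel G) -> \bar R}.

Lemma L1_le (f g : G -> R[i]) : cmeasurable f -> L1 mu g ->
  (forall x, modulus (f x) <= modulus (g x)) -> L1 mu f.
Proof.
move=> mf [mg goo] fg; split => //; apply: le_lt_trans goo.
apply: ge0_le_integral => //.
- by move=> x _; rewrite lee_fin modulus_ge0.
- exact: cmeas_emodulus.
- exact: cmeas_emodulus.
- by move=> x _; rewrite lee_fin.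
Qed.

(** Reduces a property stable under linear combinations to nonnegative functions, through real and
    imaginary parts and then positive and negative parts. Associativity applies it to each of its
    three arguments. *)
Lemma L1_ge0_ind (P : (G -> R[i]) -> Prop) :
  (forall p : G -> R, measurable_fun setT (p : borel G -> R) ->
     (forall x, 0 <= p x) -> L1 mu (fun x => (p x)%:C) -> P (fun x => (p x)%:C)) ->
  (forall f g, L1 mu f -> L1 mu g -> P f -> P g -> P (f \+ g)) ->
  (forall c f, L1 mu f -> P f -> P (fun x => c * f x)) ->
  forall f, L1 mu f -> P f.
Proof.
move=> Pp PD PZ.
have Pr (p : G -> R) : measurable_fun setT (p : borel G -> R) ->
    L1 mu (fun x => (p x)%:C) -> P (fun x => (p x)%:C).
  move=> mp Lp.
  pose p1 x := Num.max (p x) 0; pose p2 x := Num.max (- p x) 0.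
  have m1 : measurable_fun setT (p1 : borel G -> R).
    by apply: measurable_maxr => //; exact: measurable_cst.
  have m2 : measurable_fun setT (p2 : borel G -> R).
    apply: measurable_maxr; last exact: measurable_cst.
    exact: measurableT_comp.
  have L_1 : L1 mu (fun x => (p1 x)%:C).
    apply: (L1_le _ Lp); first exact: cmeas_real.
    move=> x; rewrite !modulus_real /p1; case: (leP (p x) 0) => // _.
    by rewrite normr0.
  have L_2 : L1 mu (fun x => (p2 x)%:C).
    apply: (L1_le _ Lp); first exact: cmeas_real.
    move=> x; rewrite !modulus_real /p2; case: (leP (- p x) 0) => // _.
      by rewrite normr0.
    by rewrite normrN.
  have -> : (fun x => (p x)%:C) =
      (fun x => (p1 x)%:C) \+ (fun x => -1 * (p2 x)%:C).
    apply/funext => x /=; rewrite mulN1r -rmorphB /p1 /p2/=; congr (_%:C).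
    by case: (leP (p x) 0); case: (leP (- p x) 0); lra.
  apply: PD => //; first exact: L1_scale.
  - by apply: Pp => // x; rewrite /p1 le_max lexx orbT.
  - by apply: PZ => //; apply: Pp => // x; rewrite /p2 le_max lexx orbT.
move=> f Lf.
have LRe : L1 mu (fun x => (complex.Re (f x))%:C).
  apply: (L1_le _ Lf); first by apply: cmeas_real; exact: Lf.1.1.
  by move=> x; rewrite modulus_real modulus_Re.
have LIm : L1 mu (fun x => (complex.Im (f x))%:C).
  apply: (L1_le _ Lf); first by apply: cmeas_real; exact: Lf.1.2.
  by move=> x; rewrite modulus_real modulus_Im.
have -> : f = (fun x => (complex.Re (f x))%:C) \+
    (fun x => 'i * (complex.Im (f x))%:C).
  by apply/funext => x; exact: complexE.
apply: PD => //; first exact: L1_scale.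
- by apply: Pr => //; exact: Lf.1.1.
- by apply: PZ => //; apply: Pr => //; exact: Lf.1.2.
Qed.

Lemma cintegral_ae (f g : G -> R[i]) : cmeasurable f -> cmeasurable g ->
  aeq mu f g -> cintegral mu f = cintegral mu g.
Proof.
move=> [mf mf'] [mg mg'] fg; congr (_ +i* _); congr fine; apply: ae_eq_integral => //.
- exact/measurable_EFinP.
- exact/measurable_EFinP.
- by apply: filterS fg => x -> _.
- exact/measurable_EFinP.
- exact/measurable_EFinP.
- by apply: filterS fg => x -> _.
Qed.

End L1_ind.

(** * Associativity of convolution *)

Section convolution_assoc.
Context (R : realType) (G : topologicalGroupType).
Variable mu : {measure set (borel G) -> \bar R}.
Variable D : nat -> set G.
Hypothesis hD : haar_exhaustion mu D.
Implicit Types f g h : G -> R[i].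

Lemma convolution_ael f f' g : cmeasurable f -> cmeasurable f' -> cmeasurable g ->
  aeq mu f f' -> convolution mu f g = convolution mu f' g.
Proof.
move=> mf mf' mg ff'; apply/funext => x; apply: cintegral_ae.
- exact: cmeas_conv_kernel.
- exact: cmeas_conv_kernel.
- by apply: filterS ff' => y ->.
Qed.

(** The map [y |-> y^-1 * x] is an inversion followed by a right translation, and both preserve null
    sets. *)
Lemma ae_invmul (P : G -> Prop) (x : G) : {ae mu, forall y : borel G, P y} ->
  {ae mu, forall y : borel G, P (y^-1 * x)%g}.
Proof.
move=> [N [mN N0 PN]].
have mNx : measurable ((fun z => z * x)%g @^-1` N : set (borel G)).
  have := continuous_borel (@mulr_continuous G x) measurableT mN.
  by rewrite setTI.
exists ((fun y => y^-1)%g @^-1` ((fun z => z * x)%g @^-1` N)); split.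
- have := continuous_borel (@invg_continuous G) measurableT mNx.
  by rewrite setTI.
- by rewrite (mu_inv hD mNx) (mu_mulr hD).
- by move=> y /= nP; exact: PN.
Qed.

Lemma convolution_aer f g g' : cmeasurable f -> cmeasurable g -> cmeasurable g' ->
  aeq mu g g' -> convolution mu f g = convolution mu f g'.
Proof.
move=> mf mg mg' gg'; apply/funext => x; apply: cintegral_ae.
- exact: cmeas_conv_kernel.
- exact: cmeas_conv_kernel.
- by apply: filterS (ae_invmul x gg') => y ->.
Qed.

Lemma convolution_real (p q : G -> R) :
  convolution mu (fun x => (p x)%:C) (fun x => (q x)%:C) =
  fun x => (fine (ge0_convolution mu (EFin \o p) (EFin \o q) x))%:C.
Proof.
apply/funext => x; rewrite /convolution /cintegral /ge0_convolution.
congr (_ +i* _).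
  by apply: eq_Rintegral => y _; rewrite cReM/= mulr0 subr0.
rewrite /Rintegral (eq_integral (fun=> 0%E)) ?integral0//.
by move=> y _; rewrite cImM/= mulr0 mul0r addr0.
Qed.

Lemma emod_real (p : G -> R) : (forall x, 0 <= p x) ->
  emod (fun x => (p x)%:C) = EFin \o p.
Proof. by move=> p0; apply/funext => x; rewrite /emod modulus_real ger0_norm. Qed.

Let assoc f g h := aeq mu (convolution mu f (convolution mu g h))
  (convolution mu (convolution mu f g) h).

(** For nonnegative functions the complex convolution is [fine] of [ge0_convolution]. Applying
    [fine] to the inner convolution changes it on a null set only, which the outer one does not see,
    so [ge0_convolutionA] applies. *)
Lemma convolutionA_ge0 (p q r : G -> R) :
  measurable_fun setT (p : borel G -> R) -> measurable_fun setT (q : borel G -> R) ->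
  measurable_fun setT (r : borel G -> R) ->
  (forall x, 0 <= p x) -> (forall x, 0 <= q x) -> (forall x, 0 <= r x) ->
  L1 mu (fun x => (p x)%:C) -> L1 mu (fun x => (q x)%:C) -> L1 mu (fun x => (r x)%:C) ->
  assoc (fun x => (p x)%:C) (fun x => (q x)%:C) (fun x => (r x)%:C).
Proof.
move=> mp mq mr p0 q0 r0 Lp Lq Lr.
have ep x : (0 <= (EFin \o p) x)%E by rewrite lee_fin.
have eq x : (0 <= (EFin \o q) x)%E by rewrite lee_fin.
have er x : (0 <= (EFin \o r) x)%E by rewrite lee_fin.
have Mp : emeas (EFin \o p) by exact/measurable_EFinP.
have Mq : emeas (EFin \o q) by exact/measurable_EFinP.
have Mr : emeas (EFin \o r) by exact/measurable_EFinP.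
have := ae_ge0_convolution_fin hD Lp Lq; have := ae_ge0_convolution_fin hD Lq Lr.
rewrite !emod_real// => fqr fpq.
set u := ge0_convolution mu (EFin \o q) (EFin \o r) in fqr.
set v := ge0_convolution mu (EFin \o p) (EFin \o q) in fpq.
have u0 := ge0_convolution_ge0 mu eq er : forall x, (0 <= u x)%E.
have v0 := ge0_convolution_ge0 mu ep eq : forall x, (0 <= v x)%E.
have mu' : emeas u := emeas_ge0_convolution hD Mq Mr eq er.
have mv : emeas v := emeas_ge0_convolution hD Mp Mq ep eq.
have fineM (w : G -> \bar R) : emeas w -> emeas (EFin \o (fine \o w)).
  move=> mw; apply/measurable_EFinP; apply: measurableT_comp; [exact: fine_measurable|exact: mw].
have fine0 (w : G -> \bar R) : (forall x, 0 <= w x)%E -> forall x, (0 <= (EFin \o (fine \o w)) x)%E.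
  by move=> w0 x; rewrite lee_fin; exact: fine_ge0.
apply: aeW => x; rewrite !convolution_real -/u -/v.
congr (fine _)%:C.
rewrite (@ge0_convolution_aer _ _ mu _ hD (EFin \o p) (EFin \o (fine \o u)) u)//; last 3 first.
- exact: fineM.
- exact: fine0.
- by apply: filterS fqr => y uy; rewrite /= fineK// ge0_fin_numE.
rewrite (@ge0_convolution_ael _ _ mu (EFin \o (fine \o v)) v (EFin \o r))//; last 3 first.
- exact: fineM.
- exact: fine0.
- by apply: filterS fpq => y vy; rewrite /= fineK// ge0_fin_numE.
by rewrite /u /v (ge0_convolutionA hD Mp Mq Mr ep eq er).
Qed.

Lemma convolutionA f g h : L1 mu f -> L1 mu g -> L1 mu h ->
  aeq mu (convolution mu f (convolution mu g h))
    (convolution mu (convolution mu f g) h).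
Proof.
have L1c := @L1_convolution _ _ mu _ hD.
have m1 k : L1 mu k -> cmeasurable k by case.
have mc k l : L1 mu k -> L1 mu l -> cmeasurable (convolution mu k l).
  by move=> Lk Ll; exact: (L1c _ _ Lk Ll).1.
move=> Lf Lg Lh; rewrite -/(assoc f g h).
move: f Lf; apply: L1_ge0_ind => [p mp p0 Lp|f f' Lf Lf' af af'|c f Lf af]; first last.
- rewrite /assoc (@convolution_ael (convolution mu (fun x => c * f x) g)
    (fun x => c * convolution mu f g x) h); last first.
  + exact: (convolutionZl hD).
  + exact: m1.
  + by apply: m1; apply: L1_scale; exact: L1c.
  + by apply: mc => //; exact: L1_scale.
  apply: filterS3 (convolutionZl hD c Lf (L1c _ _ Lg Lh))
    (convolutionZl hD c (L1c _ _ Lf Lg) Lh) af => x -> -> ->//.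
- rewrite /assoc (@convolution_ael (convolution mu (f \+ f') g)
    (convolution mu f g \+ convolution mu f' g) h); last first.
  + exact: (convolutionDl hD).
  + exact: m1.
  + by apply: m1; apply: L1_add; exact: L1c.
  + by apply: mc => //; exact: L1_add.
  apply: filterS2 (filterI af af') (filterI
    (convolutionDl hD Lf Lf' (L1c _ _ Lg Lh))
    (convolutionDl hD (L1c _ _ Lf Lg) (L1c _ _ Lf' Lg) Lh)).
  by move=> x [e1 e2] [-> ->] /=; rewrite e1 e2.
move: g Lg; apply: L1_ge0_ind => [q mq q0 Lq|g g' Lg Lg' ag ag'|c g Lg ag]; first last.
- rewrite /assoc (@convolution_ael (convolution mu _ (fun x => c * g x))
    (fun x => c * convolution mu (fun x => (p x)%:C) g x) h); last first.
  + exact: (convolutionZr hD).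
  + exact: m1.
  + by apply: m1; apply: L1_scale; exact: L1c.
  + by apply: mc => //; exact: L1_scale.
  rewrite (@convolution_aer _ (convolution mu (fun x => c * g x) h)
    (fun x => c * convolution mu g h x)); last first.
  + exact: (convolutionZl hD).
  + by apply: m1; apply: L1_scale; exact: L1c.
  + by apply: mc => //; exact: L1_scale.
  + exact: m1.
  apply: filterS3 (convolutionZr hD c Lp (L1c _ _ Lg Lh))
    (convolutionZl hD c (L1c _ _ Lp Lg) Lh) ag => x -> -> ->//.
- rewrite /assoc (@convolution_ael (convolution mu _ (g \+ g'))
    (convolution mu (fun x => (p x)%:C) g \+ convolution mu (fun x => (p x)%:C) g') h); last first.
  + exact: (convolutionDr hD).
  + exact: m1.
  + by apply: m1; apply: L1_add; exact: L1c.
  + by apply: mc => //; exact: L1_add.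
  rewrite (@convolution_aer _ (convolution mu (g \+ g') h)
    (convolution mu g h \+ convolution mu g' h)); last first.
  + exact: (convolutionDl hD).
  + by apply: m1; apply: L1_add; exact: L1c.
  + by apply: mc => //; exact: L1_add.
  + exact: m1.
  apply: filterS2 (filterI ag ag') (filterI
    (convolutionDr hD Lp (L1c _ _ Lg Lh) (L1c _ _ Lg' Lh))
    (convolutionDl hD (L1c _ _ Lp Lg) (L1c _ _ Lp Lg') Lh)).
  by move=> x [e1 e2] [-> ->] /=; rewrite e1 e2.
move: h Lh; apply: L1_ge0_ind => [r mr r0 Lr|h h' Lh Lh' ah ah'|c h Lh ah]; first last.
- rewrite /assoc (@convolution_aer _ (convolution mu _ (fun x => c * h x))
    (fun x => c * convolution mu (fun x => (q x)%:C) h x)); last first.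
  + exact: (convolutionZr hD).
  + by apply: m1; apply: L1_scale; exact: L1c.
  + by apply: mc => //; exact: L1_scale.
  + exact: m1.
  apply: filterS3 (convolutionZr hD c Lp (L1c _ _ Lq Lh))
    (convolutionZr hD c (L1c _ _ Lp Lq) Lh) ah => x -> -> ->//.
- rewrite /assoc (@convolution_aer _ (convolution mu _ (h \+ h'))
    (convolution mu (fun x => (q x)%:C) h \+ convolution mu (fun x => (q x)%:C) h')); last first.
  + exact: (convolutionDr hD).
  + by apply: m1; apply: L1_add; exact: L1c.
  + by apply: mc => //; exact: L1_add.
  + exact: m1.
  apply: filterS2 (filterI ah ah') (filterI
    (convolutionDr hD Lp (L1c _ _ Lq Lh) (L1c _ _ Lq Lh'))
    (convolutionDr hD (L1c _ _ Lp Lq) Lh Lh')).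
  by move=> x [e1 e2] [-> ->] /=; rewrite e1 e2.
exact: convolutionA_ge0.
Qed.

End convolution_assoc.

(** * Convolution algebras *)

Section real_L1_complete.
Context d (T : measurableType d) (R : realType).
Variable mu : {measure set T -> \bar R}.
Variable u : nat -> T -> R.
Hypothesis mu_ : forall n, measurable_fun setT (u n).
Hypothesis u_cauchy : forall eps : R, 0 < eps -> exists n0, forall m n,
  (n0 <= m)%N -> (n0 <= n)%N -> (\int[mu]_x (`|u m x - u n x|)%:E < eps%:E)%E.

(** The Riesz-Fischer argument: a subsequence with summable increments converges almost everywhere,
    and Fatou's lemma bounds the distance to its limit. *)
Lemma real_L1_complete : exists2 l : T -> R, measurable_fun setT l &
  forall eps : R, 0 < eps -> exists n0, forall n, (n0 <= n)%N ->
    (\int[mu]_x (`|u n x - l x|)%:E <= eps%:E)%E.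
Proof.
(* These tolerances have sum 1. *)
pose e_ k : R := 1 / (2 ^ k.+1)%:R.
have e0 k : 0 < e_ k by rewrite /e_ divr_gt0// ltr0n expn_gt0.
have [N HN] := choice (fun k => u_cauchy (e0 k)).
(* A running maximum, so that [phi k] is past all the thresholds [N j] with [j <= k]. *)
pose phi k := \max_(j < k.+1) N j.
have phiN j k : (j <= k)%N -> (N j <= phi k)%N.
  by move=> jk; rewrite -ltnS in jk; exact: (leq_bigmax (Ordinal jk)).
pose w k := u (phi k).
pose a k x := w k.+1 x - w k x.
have mw k : measurable_fun setT (w k) by exact: mu_.
have ma k : measurable_fun setT (fun x => (`|a k x|)%:E : \bar R).
  apply/measurable_EFinP; apply: measurableT_comp => //.
  exact: measurable_funB.
have a0 k x : (0 <= (`|a k x|)%:E :> \bar R)%E by rewrite lee_fin.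
pose S x := (\sum_(k <oo) (`|a k x|)%:E)%E.
have mS : measurable_fun setT S.
  by apply: ge0_emeasurable_sum => // k x _.
have S0 x : (0 <= S x)%E by apply: nneseries_ge0 => k _ _.
have iS : mu.-integrable setT S.
  apply/integrableP; split => //.
  under eq_integral do rewrite gee0_abs//.
  rewrite integral_nneseries//.
  apply: le_lt_trans (_ : (1%:E < +oo)%E); last exact: ltry.
  apply: le_trans (epsilon_trick0 xpredT ler01).
  apply: lee_nneseries => [k _ _|k _]; first exact: integral_ge0.
  by apply/ltW/HN; apply: phiN.
have Sfin := integrable_ae measurableT iS.
(* The upper limit is measurable and defined everywhere; it is the limit wherever [S] is finite. *)
pose l x := fine (limn_esup (fun k => (w k x)%:E)).
have ml : measurable_fun setT l.
  apply: measurableT_comp; first exact: fine_measurable.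
  by apply: measurable_fun_limn_esup => n; exact/measurable_EFinP.
have wl x : S x \is a fin_num -> w ^~ x @ \oo --> l x.
  move=> Sx.
  have csa : cvgn (series (fun k => a k x)).
    apply: normed_cvg; apply: nondecreasing_is_cvgn.
      by apply: nondecreasing_series => k _ _; rewrite /= normr_ge0.
    exists (fine (S x)) => _ [n _ <-]; rewrite -lee_fin fineK//.
    rewrite /series/= -sumEFin; exact: nneseries_lim_ge.
  have cw : cvgn (w ^~ x).
    rewrite (_ : w ^~ x = (fun n => w 0 x + series (fun k => a k x) n)).
      by apply: is_cvgD csa; exact: is_cvg_cst.
    apply/funext => n; rewrite /series/= /a telescope_sumr//.
    by rewrite addrCA subrr addr0.
  have /cvg_ex[L wL] := cw.
  suff -> : l x = L by [].
  rewrite /l; have -> : limn_esup (fun k => (w k x)%:E) = L%:E; last by [].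
  apply: (cvg_limn_einf_sup _).2; by apply/fine_cvgP; split; [exact: nearW|].
exists l => // eps eps0.
have [j je] : exists j, e_ j <= eps.
  have [j] := ltr_add_invr eps0; rewrite add0r => /ltW je; exists j.
  apply: le_trans je; rewrite /e_ div1r lef_pV2 ?posrE ?ltr0n ?expn_gt0//.
  by rewrite ler_nat ltnW// ltn_expl.
exists (N j) => n Nn; apply: (@le_trans _ _ (e_ j)%:E); last by rewrite lee_fin.
have mnw k : measurable_fun setT (fun x => (`|u n x - w k x|)%:E : \bar R).
  apply/measurable_EFinP; apply: measurableT_comp => //.
  exact: measurable_funB.
have mlim : measurable_fun setT (fun x => limn_einf (fun k => (`|u n x - w k x|)%:E : \bar R)).
  rewrite /limn_einf; apply: measurableT_comp => //.
  by apply: measurable_fun_limn_esup => k; exact: measurableT_comp.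
apply: (@le_trans _ _ (\int[mu]_x limn_einf (fun k => (`|u n x - w k x|)%:E))%E).
  apply: ae_ge0_le_integral => //.
  - apply/measurable_EFinP; apply: measurableT_comp => //.
    exact: measurable_funB.
  - move=> x _; rewrite limn_einf_lim; apply: lime_ge; first exact: is_cvg_einfs.
    by apply: nearW => k; apply: le_ereal_inf_tmp => _ [m _ <-]; rewrite lee_fin.
  - apply: filterS Sfin => x /(_ I) /wl wlx _.
    rewrite (_ : limn_einf _ = (`|u n x - l x|)%:E)//.
    apply: (cvg_limn_einf_sup _).1; apply/fine_cvgP; split; first exact: nearW.
    by apply: cvg_norm; apply: cvgB => //; exact: cvg_cst.
apply: le_trans (fatou mu measurableT mnw _) _ => //.
rewrite limn_einf_lim; apply: lime_le; first exact: is_cvg_einfs.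
near=> k.
apply: (@le_trans _ _ (\int[mu]_x (`|u n x - w k x|)%:E)%E).
  by apply: ereal_inf_lbound; exists k => //=.
apply/ltW/HN => //; apply: phiN; near: k; exact: nbhs_infty_ge.
Unshelve. all: by end_near.
Qed.

End real_L1_complete.

Section convolution_algebra.
Context (R : realType) (G : topologicalGroupType).
Variable mu : {measure set (borel G) -> \bar R}.

(** The laws of [banach_star_algebra] without the involution; the weighted Orlicz space and [L1] are
    the two instances. *)
Record convolution_algebra (A : set (G -> R[i])) (N : (G -> R[i]) -> \bar R) :
    Prop := {
  ca_zero : A (fun=> 0) ;
  ca_add : forall f g, A f -> A g -> A (f \+ g) ;
  ca_scale : forall (c : R[i]) f, A f -> A (fun x => c * f x) ;
  ca_norm_fin : forall f, A f -> (0 <= N f < +oo)%E ;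
  ca_norm_eq0 : forall f, A f -> (N f = 0%E <-> aeq mu f (fun=> 0)) ;
  ca_norm_add : forall f g, A f -> A g -> (N (f \+ g)%R <= N f + N g)%E ;
  ca_norm_scale : forall (c : R[i]) f, A f ->
    N (fun x => c * f x) = ((modulus c)%:E * N f)%E ;
  ca_complete : forall u : nat -> G -> R[i], (forall n, A (u n)) ->
    (forall eps : R, 0 < eps -> exists n0, forall m n,
      (n0 <= m)%N -> (n0 <= n)%N -> (N (u m \- u n)%R < eps%:E)%E) ->
    exists2 l, A l & (fun n => N (u n \- l)) @ \oo --> 0%E ;
  ca_conv : forall f g, A f -> A g -> A (convolution mu f g) ;
  ca_convA : forall f g h, A f -> A g -> A h ->
    aeq mu (convolution mu f (convolution mu g h))
      (convolution mu (convolution mu f g) h) ;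
  ca_convDl : forall f g h, A f -> A g -> A h ->
    aeq mu (convolution mu (f \+ g) h) (convolution mu f h \+ convolution mu g h) ;
  ca_convDr : forall f g h, A f -> A g -> A h ->
    aeq mu (convolution mu f (g \+ h)) (convolution mu f g \+ convolution mu f h) ;
  ca_convZl : forall (c : R[i]) f g, A f -> A g ->
    aeq mu (convolution mu (fun x => c * f x) g) (fun x => c * convolution mu f g x) ;
  ca_convZr : forall (c : R[i]) f g, A f -> A g ->
    aeq mu (convolution mu f (fun x => c * g x)) (fun x => c * convolution mu f g x) ;
  ca_norm_conv : exists2 M : R, 0 < M & forall f g, A f -> A g ->
    (N (convolution mu f g) <= M%:E * N f * N g)%E
}.

Lemma banach_star_algebra_convolution A N :
  banach_star_algebra mu A N -> convolution_algebra A N.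
Proof. by case=> *; split. Qed.

Lemma L1_complete (u : nat -> G -> R[i]) : (forall n, L1 mu (u n)) ->
  (forall eps : R, 0 < eps -> exists n0, forall m n,
    (n0 <= m)%N -> (n0 <= n)%N -> (L1_norm mu (u m \- u n)%R < eps%:E)%E) ->
  exists2 l, L1 mu l & (fun n => L1_norm mu (u n \- l)) @ \oo --> 0%E.
Proof.
move=> Lu Cu.
have mB (f g : G -> R[i]) : cmeasurable f -> cmeasurable g -> cmeasurable (f \- g).
  move=> mf mg; have := @cmeasD _ (borel G) R _ _ mf (@cmeasN _ (borel G) R _ mg).
  exact.
have part (p : R[i] -> R) :
    (forall z w, p (z - w) = p z - p w) -> (forall z, `|p z| <= modulus z) ->
    (forall f : G -> R[i], cmeasurable f -> measurable_fun setT (p \o f : borel G -> R)) ->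
    exists2 l : G -> R, measurable_fun setT (l : borel G -> R) &
    forall eps : R, 0 < eps -> exists n0, forall n, (n0 <= n)%N ->
      (\int[mu]_x (`|p (u n x) - l x|)%:E <= eps%:E)%E.
  move=> pB pm mp.
  apply: (@real_L1_complete _ (borel G) R mu (fun n => p \o u n)).
    by move=> n; apply: mp; exact: (Lu n).1.
  move=> eps /Cu[n0 Hn0]; exists n0 => m n mn nn.
  apply: le_lt_trans (Hn0 m n mn nn); apply: ge0_le_integral => //.
  - apply/measurable_EFinP; apply: measurableT_comp => //; apply: measurable_funB.
      by apply: mp; exact: (Lu m).1.
    by apply: mp; exact: (Lu n).1.
  - by apply: cmeas_emodulus; apply: mB; [exact: (Lu m).1|exact: (Lu n).1].
  - by move=> x _; rewrite lee_fin -pB pm.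
have [||f mf|lr mlr Hr] := part (@complex.Re R).
- by move=> z w; rewrite cReD cReN.
- exact: modulus_Re.
- exact: mf.1.
have [||f mf|li mli Hi] := part (@complex.Im R).
- by move=> z w; rewrite cImD cImN.
- exact: modulus_Im.
- exact: mf.2.
pose l x := lr x +i* li x.
have ml : cmeasurable l by split.
have mul n : cmeasurable (u n \- l) by apply: mB => //; exact: (Lu n).1.
have bound (eps : R) : 0 < eps -> exists n0, forall n, (n0 <= n)%N ->
    (L1_norm mu (u n \- l)%R <= eps%:E)%E.
  move=> eps0; have e20 : 0 < eps / 2 by rewrite divr_gt0.
  have [n1 H1] := Hr _ e20; have [n2 H2] := Hi _ e20.
  exists (maxn n1 n2) => n; rewrite geq_max => /andP[nn1 nn2].
  have mre : measurable_fun setT (fun x : borel G => (`|complex.Re (u n x) - lr x|)%:E : \bar R).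
    apply/measurable_EFinP; apply: measurableT_comp => //; apply: measurable_funB => //.
    exact: (Lu n).1.1.
  have mim : measurable_fun setT (fun x : borel G => (`|complex.Im (u n x) - li x|)%:E : \bar R).
    apply/measurable_EFinP; apply: measurableT_comp => //; apply: measurable_funB => //.
    exact: (Lu n).1.2.
  rewrite (splitr eps) EFinD; apply: le_trans (leeD (H1 n nn1) (H2 n nn2)).
  rewrite -ge0_integralD//; apply: ge0_le_integral => //.
  - by move=> x _; rewrite lee_fin modulus_ge0.
  - exact: (cmeas_emodulus (mul n)).
  - exact: emeasurable_funD.
  - move=> x _; rewrite -EFinD lee_fin.
    by apply: le_trans (modulus_le _) _; rewrite /= cReD cImD cReN cImN.
exists l.
  have [n /(_ n (leqnn _)) ln] := bound 1 ltr01.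
  have -> : l = u n \+ (fun x => -1 * (u n \- l) x).
    by apply/funext => x /=; rewrite mulN1r opprB addrC subrK.
  apply: L1_add => //; apply: L1_scale; split => //.
  by apply: le_lt_trans ln _; exact: ltry.
apply/fine_cvgP; split.
  have [n0 H0] := bound 1 ltr01; near=> n.
  rewrite ge0_fin_numE ?L1_norm_ge0//; apply: le_lt_trans (H0 n _) _; last exact: ltry.
  by near: n; exact: nbhs_infty_ge.
apply/cvgrPdist_le => eps eps0; have [n0 H0] := bound eps eps0; near=> n.
have Hn : (L1_norm mu (u n \- l)%R <= eps%:E)%E.
  by apply: H0; near: n; exact: nbhs_infty_ge.
rewrite sub0r normrN ger0_norm ?fine_ge0 ?L1_norm_ge0//= -lee_fin fineK//.
by rewrite ge0_fin_numE ?L1_norm_ge0//; exact: le_lt_trans Hn (ltry _).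
Unshelve. all: by end_near. Qed.

Variable D : nat -> set G.
Hypothesis hD : haar_exhaustion mu D.

Lemma L1_convolution_algebra : convolution_algebra (L1 mu) (L1_norm mu).
Proof.
split.
- split; first exact: (@cmeas_cst _ (borel G)).
  by under eq_integral do rewrite modulus0; rewrite integral0.
- exact: L1_add.
- by move=> c f; exact: L1_scale.
- by move=> f [_ ?]; rewrite L1_norm_ge0.
- exact: L1_norm_eq0.
- by move=> f g [? _] [? _]; exact: L1_normD.
- by move=> c f [? _]; exact: L1_normZ.
- exact: L1_complete.
- exact: (L1_convolution hD).
- exact: (convolutionA hD).
- exact: (convolutionDl hD).
- exact: (convolutionDr hD).
- exact: (convolutionZl hD).
- exact: (convolutionZr hD).
- exists 2 => // f g [? _] [? _]; exact: (L1_convolution_norm hD).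
Qed.

End convolution_algebra.

(** * A quantitative Gelfand formula *)

Section two_sided_inverse.
Variable B : pzRingType.
Implicit Types x y v : B.

Definition inverses x v := x * v = 1 /\ v * x = 1.

(** Since [1 - y^2 = (1 - y) (1 + y)], the element [(1 + y) * v] is a right inverse and
    [v * (1 + y)] a left inverse, and the two coincide. *)
Lemma inverses_sqr y v : inverses (1 - y ^+ 2) v ->
  inverses (1 - y) ((1 + y) * v).
Proof.
move=> [yv vy].
have yl : (1 - y) * (1 + y) = 1 - y ^+ 2.
  by rewrite mulrDr mulr1 mulrBl mul1r addrA subrK expr2.
have yr : (1 + y) * (1 - y) = 1 - y ^+ 2.
  by rewrite mulrBr mulr1 mulrDl mul1r opprD addrA addrK expr2.
have ri : (1 - y) * ((1 + y) * v) = 1 by rewrite mulrA yl.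
have li : (v * (1 + y)) * (1 - y) = 1 by rewrite -mulrA yr.
split => //; suff -> : (1 + y) * v = v * (1 + y) by [].
transitivity (v * (1 + y) * (1 - y) * ((1 + y) * v)); first by rewrite li mul1r.
by rewrite -(mulrA (v * (1 + y))) ri mulr1.
Qed.

Lemma inverses_expn2 k x v : inverses (1 - x ^+ (2 ^ k)) v ->
  exists w, inverses (1 - x) w.
Proof.
elim: k v => [v|k ih v]; first by rewrite expn0 expr1; exists v.
by rewrite expnSr exprM => /inverses_sqr /ih.
Qed.

End two_sided_inverse.

Section unit_square_bound.
Variable R : realType.

(** Compactness is applied to the square [[-1, 1]^2], a product of segments. Around a point of the
    square outside the disc there is a neighbourhood that misses the disc, where nothing is to be
    shown. *)
Lemma bounded_on_disc (F : R[i] -> R) :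
  (forall z, modulus z <= 1 -> exists2 d : R, 0 < d &
     exists C, forall w, modulus w <= 1 -> modulus (w - z) <= d -> F w <= C) ->
  exists C, forall z, modulus z <= 1 -> F z <= C.
Proof.
move=> locF.
pose Q : set (R * R) := `[-1, 1] `*` `[-1, 1].
have cQ : compact Q by apply: compact_setX; exact: segment_compact.
pose c (p : R * R) : R[i] := p.1 +i* p.2.
have H (p : R * R) : Q p -> \forall p' \near p & M \near +oo,
    modulus (c p') <= 1 -> F (c p') <= M.
  move=> _.
  have [d d0 [C HC]] : exists2 d : R, 0 < d &
      exists C, forall w, modulus w <= 1 -> modulus (w - c p) <= d -> F w <= C.
    have [/locF//|p1] := leP (modulus (c p)) 1.
    exists ((modulus (c p) - 1) / 2); first by rewrite divr_gt0 ?subr_gt0.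
    exists 0 => w w1 wp; exfalso; move: wp; apply/negP; rewrite -ltNge.
    have : modulus (c p) <= modulus (w - c p) + modulus w.
      rewrite -(modulusN (w - _)) opprB; apply: le_trans (modulusD _ _).
      by rewrite subrK.
    lra.
  (* The radius is halved because the modulus is bounded by the sum of the two coordinates. *)
  exists ([set p' | ball p (d / 2) p'], [set M | C <= M]).
    split; first by apply: nbhsx_ballx; rewrite divr_gt0.
    by apply: nbhs_pinfty_ge; exact: num_real.
  move=> [p' M] /= [[b1 b2] CM] p'1; apply: le_trans CM; apply: HC => //.
  apply: le_trans (modulus_le _) _; rewrite cReD cImD cReN cImN/=.
  move: b1 b2; rewrite /ball/= !(distrC p.1) !(distrC p.2) => b1 b2.
  by rewrite (splitr d) lerD// ltW.
have := (compact_near_coveringP Q).1 cQ R (+oo : set_system R)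
  (fun M p => modulus (c p) <= 1 -> F (c p) <= M) _ H.
move=> /(_ _) [M [_ HM]].
exists (M + 1) => z z1.
have zQ : Q (complex.Re z, complex.Im z).
  split; rewrite /= in_itv/= -ler_norml.
    exact: le_trans (modulus_Re z) z1.
  exact: le_trans (modulus_Im z) z1.
have MM : M < M + 1 by rewrite ltrDl.
have cE : c (complex.Re z, complex.Im z) = z by case: (z).
by have := HM _ MM _ zQ; rewrite cE; exact.
Qed.

End unit_square_bound.

Section gelfand.
(** [B] stands for a complex algebra, presented as a ring with a central copy [iota] of the scalars,
    and [nrm] for a submultiplicative seminorm that restricts to the modulus on scalars. *)
Variables (R : realType) (B : pzRingType) (iota : R[i] -> B) (nrm : B -> R).
Hypothesis iota1 : iota 1 = 1.
Hypothesis iotaD : forall a b, iota (a + b) = iota a + iota b.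
Hypothesis iotaM : forall a b, iota (a * b) = iota a * iota b.
Hypothesis iotaC : forall a x, iota a * x = x * iota a.
Hypothesis nrm_ge0 : forall x, 0 <= nrm x.
Hypothesis nrmD : forall x y, nrm (x + y) <= nrm x + nrm y.
Hypothesis nrmM : forall x y, nrm (x * y) <= nrm x * nrm y.
Hypothesis nrm_iota : forall a, nrm (iota a) = modulus a.

Let iotaN a : iota (- a) = - iota a.
Proof.
apply/eqP; rewrite -addr_eq0 -iotaD addNr; apply/eqP.
by apply: (addrI (iota 0)); rewrite -iotaD !addr0.
Qed.

Let iotaX a n : iota (a ^+ n) = iota a ^+ n.
Proof. by elim: n => [|n ih]; rewrite ?expr0// !exprS iotaM ih. Qed.

Let nrmN x : nrm (- x) = nrm x.
Proof.
have le y : nrm (- y) <= nrm y.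
  rewrite -mulN1r -iota1 -iotaN; apply: le_trans (nrmM _ _) _.
  by rewrite nrm_iota modulusN modulus1 mul1r.
by apply/eqP; rewrite eq_le le/= -{1}(opprK x).
Qed.

Let nrm1 : nrm 1 = 1.
Proof. by rewrite -iota1 nrm_iota modulus1. Qed.

Lemma nrmX x n : nrm (x ^+ n) <= nrm x ^+ n.
Proof.
elim: n => [|n ih]; first by rewrite !expr0 nrm1.
by rewrite !exprS; apply: le_trans (nrmM _ _) _; rewrite ler_wpM2l.
Qed.

Let iotaMX a x n : (iota a * x) ^+ n = iota (a ^+ n) * x ^+ n.
Proof. by rewrite exprMn_comm ?iotaX//; exact: iotaC. Qed.

Variable x : B.
Hypothesis resolvent_ex : forall z, modulus z <= 1 ->
  exists v, inverses (1 - iota z * x) v.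

(** The resolvent identity [S z - S w = S z * (z - w) x * S w] gives local boundedness of [S],
    compactness of the disc a global bound [C], and the identity again the Lipschitz constant
    [C * nrm x * C]. *)
Lemma resolvent_lipschitz : exists S : R[i] -> B, exists L : R,
  [/\ 0 <= L, forall z, modulus z <= 1 -> inverses (1 - iota z * x) (S z) &
    forall z w, modulus z <= 1 -> modulus w <= 1 ->
      nrm (S z - S w) <= L * modulus (z - w)].
Proof.
have H z : exists v, modulus z <= 1 -> inverses (1 - iota z * x) v.
  have [/resolvent_ex[v zv]|z1] := boolP (modulus z <= 1); first by exists v.
  by exists 0.
have [S HS] := choice H.
have SB z w : modulus z <= 1 -> modulus w <= 1 ->
    S z - S w = S z * (iota (z - w) * x) * S w.
  move=> /HS[_ Sz] /HS[wS _].
  have -> : iota (z - w) * x = (1 - iota w * x) - (1 - iota z * x).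
    by rewrite iotaD iotaN mulrDl mulNr opprB [RHS]addrC subrKA.
  rewrite mulrBr mulrBl Sz mul1r; congr (_ - _).
  by rewrite -mulrA wS mulr1.
have SBn z w : modulus z <= 1 -> modulus w <= 1 ->
    nrm (S z - S w) <= nrm (S z) * (modulus (z - w) * nrm x) * nrm (S w).
  move=> z1 w1; rewrite SB//; apply: le_trans (nrmM _ _) _.
  rewrite ler_wpM2r//; apply: le_trans (nrmM _ _) _; rewrite ler_wpM2l//.
  by apply: le_trans (nrmM _ _) _; rewrite nrm_iota.
have [|C HC] := @bounded_on_disc R (fun z => nrm (S z)).
  (* With this [d] the product [modulus (w - z) * nrm x * nrm (S z)] is at most 1/2, and the
     resolvent identity yields [nrm (S w) <= 2 * nrm (S z)]. The summand 1 keeps the denominator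
     positive. *)
  move=> z z1; pose d := (2 * (nrm x * nrm (S z) + 1))^-1.
  have p0 : 0 < nrm x * nrm (S z) + 1 by rewrite ltr_wpDl// mulr_ge0.
  exists d; first by rewrite invr_gt0 mulr_gt0.
  exists (2 * nrm (S z)) => w w1 wz.
  have h : nrm (S w) <= nrm (S z) + nrm (S w) * (modulus (w - z) * nrm x) * nrm (S z).
    have := SBn _ _ w1 z1.
    have := nrmD (S w - S z) (S z); rewrite subrK; lra.
  have h2 : modulus (w - z) * (nrm x * nrm (S z)) <= 1 / 2.
    apply: le_trans (_ : d * (nrm x * nrm (S z) + 1) <= _).
      apply: ler_pM => //; rewrite ?modulus_ge0 ?mulr_ge0//.
      by rewrite lerDl.
    by rewrite /d invfM -mulrA mulVf ?gt_eqF// mulr1 div1r.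
  have h3 : nrm (S w) * (modulus (w - z) * nrm x) * nrm (S z) <= nrm (S w) * (1 / 2).
    by rewrite -!mulrA ler_wpM2l.
  lra.
have C0 : 0 <= C.
  by apply: le_trans (nrm_ge0 _) (HC 0 _); rewrite modulus0.
exists S, (C * nrm x * C); split => //.
  by rewrite !mulr_ge0.
move=> z w z1 w1; apply: le_trans (SBn _ _ z1 w1) _.
rewrite [leRHS](_ : _ = C * (modulus (z - w) * nrm x) * C); last by lra.
apply: ler_pM; rewrite ?mulr_ge0 ?modulus_ge0 ?HC//.
by rewrite ler_wpM2r ?mulr_ge0 ?modulus_ge0 ?HC.
Qed.

(** Replacing [z] by [e * z] turns [(z x)^(2^k)] into its opposite, as the doubling step of
    [averaged_resolvent] requires. Such an [e] is an iterated square root of [-1]. *)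
Lemma unit_root_opp1 (k : nat) :
  exists e : R[i], modulus e = 1 /\ e ^+ (2 ^ k) = -1.
Proof.
elim: k => [|k [e [e1 ek]]].
  by exists (-1); rewrite modulusN modulus1 expn0 expr1.
exists (sqrtc e); split; last by rewrite expnS exprM sqr_sqrtc.
have : modulus (sqrtc e) ^+ 2 = 1 by rewrite -modulusX sqr_sqrtc.
move/eqP; rewrite sqrf_eq1 => /orP[/eqP//|/eqP s].
by have := modulus_ge0 (sqrtc e); rewrite s ler0N1.
Qed.

(* [T z] is the average of the resolvent over the [2 ^ k]-th roots of unity
   times [z]; averaging does not increase the Lipschitz constant. *)
Lemma averaged_resolvent (S : R[i] -> B) (L : R) (k : nat) : 0 <= L ->
  (forall z, modulus z <= 1 -> inverses (1 - iota z * x) (S z)) ->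
  (forall z w, modulus z <= 1 -> modulus w <= 1 ->
      nrm (S z - S w) <= L * modulus (z - w)) ->
  exists T : R[i] -> B,
    (forall z, modulus z <= 1 ->
       inverses (1 - (iota z * x) ^+ (2 ^ k)) (T z)) /\
    (forall z w, modulus z <= 1 -> modulus w <= 1 ->
      nrm (T z - T w) <= L * modulus (z - w)).
Proof.
move=> L0 HS SL; elim: k => [|k [T [HT TL]]].
  by exists S; split => // z z1; rewrite expn0 expr1; exact: HS.
have [e [e1 ek]] := unit_root_opp1 k.
have half2 : iota (1 / 2) * (1 + 1) = 1.
  by rewrite mulrDr mulr1 -iotaD -splitr.
exists (fun z => iota (1 / 2) * (T z + T (e * z))); split.
  (* With [y = (z x)^(2^k)], the elements [T z] and [T (e * z)] invert [1 - y] and [1 + y], and half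
     their sum inverts [1 - y^2]. *)
  move=> z z1; have ez1 : modulus (e * z) <= 1 by rewrite modulusM e1 mul1r.
  have := HT _ ez1; rewrite iotaM -mulrA iotaMX ek iotaN iota1 mulN1r opprK.
  have := HT _ z1; rewrite expnSr exprM; set y := (iota z * x) ^+ (2 ^ k).
  move: (T z) (T (e * z)) => a b [ya ay] [yb bx].
  have yl : (1 - y) * (1 + y) = 1 - y ^+ 2.
    by rewrite mulrDr mulr1 mulrBl mul1r addrA subrK expr2.
  have yr : (1 + y) * (1 - y) = 1 - y ^+ 2.
    by rewrite mulrBr mulr1 mulrDl mul1r opprD addrA addrK expr2.
  have s2 : (1 + y) + (1 - y) = 1 + 1 by rewrite addrACA subrr addr0.
  have Ea : (1 - y ^+ 2) * a = 1 + y by rewrite -yr -mulrA ya mulr1.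
  have Eb : (1 - y ^+ 2) * b = 1 - y by rewrite -yl -mulrA yb mulr1.
  have La : a * (1 - y ^+ 2) = 1 + y by rewrite -yl mulrA ay mul1r.
  have Lb : b * (1 - y ^+ 2) = 1 - y by rewrite -yr mulrA bx mul1r.
  split; last by rewrite -mulrA mulrDl La Lb s2.
  by rewrite mulrA -iotaC -mulrA mulrDr Ea Eb s2.
move=> z w z1 w1.
have -> : iota (1 / 2) * (T z + T (e * z)) - iota (1 / 2) * (T w + T (e * w)) =
    iota (1 / 2) * ((T z - T w) + (T (e * z) - T (e * w))).
  by rewrite -mulrBr; congr (_ * _); rewrite opprD addrACA.
apply: le_trans (nrmM _ _) _; rewrite nrm_iota.
have m2 : modulus (1 / 2 : R[i]) = 1 / 2.
  rewrite modulusM modulus1 modulusV !mul1r; congr (_^-1).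
  by rewrite (_ : 2 = (2 : R)%:C) ?modulus_real ?ger0_norm// rmorph_nat.
rewrite m2.
have h1 := TL _ _ z1 w1.
have h2 := TL (e * z) (e * w); rewrite !modulusM e1 !mul1r -mulrBr modulusM e1 mul1r in h2.
have := nrmD (T z - T w) (T (e * z) - T (e * w)).
have := h2 z1 w1.
lra.
Qed.

(* If [(t x)^(2^k)] has norm at most [1/2] for some [k], it is arbitrarily small
   for large [k]; as the averaged resolvents are [L]-Lipschitz uniformly in [k],
   the bound [1/2] persists at [t + d] for a step [d] independent of [t]. *)
Lemma gelfand_pow_le : exists k, nrm (x ^+ (2 ^ k)) <= 1 / 2.
Proof.
have [S [L [L0 HS SL]]] := resolvent_lipschitz.
pose y t k := (iota t%:C * x) ^+ (2 ^ k).
have small t (eps : R) : 0 < eps -> (exists k, nrm (y t k) <= 1 / 2) ->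
    exists k, nrm (y t k) <= eps.
  move=> eps0 [k yk].
  have h0 : 0 <= 1 / 2 :> R by lra.
  have h1 : 1 / 2 <= 1 :> R by lra.
  (* Repeated squaring gives the exponent [2^n]; the weaker [n + 1] is enough. *)
  have le n : nrm (y t (k + n)%N) <= (1 / 2) ^+ n.+1.
    elim: n => [|n ih]; first by rewrite addn0 expr1.
    rewrite addnS /y expnSr exprM -/(y t (k + n)%N).
    apply: le_trans (nrmX _ _) _.
    apply: le_trans (_ : ((1 / 2) ^+ n.+1) ^+ 2 <= _).
      by rewrite lerXn2r// nnegrE// exprn_ge0.
    rewrite -exprM; apply: ler_wiXn2l => //.
    by rewrite muln2 -addnn addSn ltnS addnS ltnS leq_addl.
  have [n] := ltr_add_invr eps0; rewrite add0r => /ltW ne.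
  exists (k + n)%N; apply: le_trans (le n) _; apply: le_trans ne.
  rewrite div1r exprVn lef_pV2 ?posrE ?exprn_gt0 ?ltr0n//.
  by rewrite -natrX ler_nat ltnW// ltn_expl.
(* The step will be [d = 1 / (m + 1)]: it divides [[0, 1]] evenly and moves an averaged resolvent by
   at most 1/8. *)
have [m Hm] : exists m : nat, L * m.+1%:R^-1 <= 1 / 8.
  have [m] := @ltr_add_invr R 0 (1 / 8 / (L + 1)) ltac:(by rewrite !divr_gt0 ?ltr_wpDl).
  rewrite add0r => /ltW mL; exists m.
  apply: le_trans (_ : (L + 1) * (1 / 8 / (L + 1)) <= _).
    by apply: ler_pM => //; rewrite lerDl.
  by rewrite mulrC divfK// gt_eqF// ltr_wpDl.
pose d : R := m.+1%:R^-1.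
have d0 : 0 < d by rewrite invr_gt0.
have step t : 0 <= t -> t + d <= 1 -> (exists k, nrm (y t k) <= 1 / 2) ->
    exists k, nrm (y (t + d) k) <= 1 / 2.
  move=> t0 td1 /(small t (1 / 16)) [|k yk]; first by rewrite divr_gt0.
  exists k.
  have [T [HT TL]] := averaged_resolvent k L0 HS SL.
  have mt : modulus t%:C <= 1 by rewrite modulus_real ger0_norm//; lra.
  have mtd : modulus (t + d)%:C <= 1 by rewrite modulus_real ger0_norm//; lra.
  have [T1 _] := HT _ mt; have [T2 _] := HT _ mtd.
  rewrite -/(y t k) in T1; rewrite -/(y (t + d) k) in T2.
  (* Write [y] and [y'] for the powers at [t] and [t + d], [T] and [T'] for the averaged resolvents.
     From [T - 1 = y T] and [|y| <= 1/16], [|T - 1| <= 1/15]; with the Lipschitz bound,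
     [|T' - 1| <= 1/15 + 1/8 <= 1/4]. Then [y' = (T' - 1) - y' (T' - 1)] gives [|y'| <= 1/3]. *)
  have t1 : T t%:C - 1 = y t k * T t%:C.
    by rewrite -[X in _ - X]T1 mulrBl mul1r subKr.
  have t2 : T (t + d)%:C - 1 = y (t + d) k * T (t + d)%:C.
    by rewrite -[X in _ - X]T2 mulrBl mul1r subKr.
  have e1 : T t%:C - 1 = y t k * (T t%:C - 1) + y t k.
    by rewrite mulrBr mulr1 subrK.
  have e2 : y (t + d) k = (T (t + d)%:C - 1) - y (t + d) k * (T (t + d)%:C - 1).
    by rewrite mulrBr mulr1 t2 subKr.
  have n1 : nrm (T t%:C - 1) <= 1 / 16 * nrm (T t%:C - 1) + 1 / 16.
    rewrite {1}e1; apply: le_trans (nrmD _ _) _; apply: lerD => //.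
    by apply: le_trans (nrmM _ _) _; rewrite ler_wpM2r.
  have n2 : nrm (T (t + d)%:C - T t%:C) <= 1 / 8.
    apply: le_trans (TL _ _ mtd mt) _; rewrite -rmorphB addrAC subrr add0r.
    by rewrite modulus_real ger0_norm// ltW.
  have n3 : nrm (T (t + d)%:C - 1) <= 1 / 4.
    rewrite (_ : _ - 1 = (T (t + d)%:C - T t%:C) + (T t%:C - 1)); last by rewrite addrA subrK.
    by apply: le_trans (nrmD _ _) _; lra.
  have n4 : nrm (y (t + d) k) <= 1 / 4 + nrm (y (t + d) k) * (1 / 4).
    rewrite {1}e2; apply: le_trans (nrmD _ _) _; rewrite nrmN; apply: lerD => //.
    by apply: le_trans (nrmM _ _) _; rewrite ler_wpM2l.
  lra.
have all j : (j <= m.+1)%N -> exists k, nrm (y (j%:R * d) k) <= 1 / 2.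
  elim: j => [_|j ih jm].
    exists 0%N; rewrite /y mul0r expn0 expr1; apply: le_trans (nrmM _ _) _.
    by rewrite nrm_iota modulus0 mul0r divr_ge0.
  rewrite -natr1 mulrDl mul1r; apply: step (ih (ltnW jm)).
    by rewrite mulr_ge0// ltW.
  rewrite -{2}[d]mul1r -mulrDl natr1 /d ler_pdivrMr// mul1r ler_nat//.
have [k] := all m.+1 (leqnn _).
rewrite /d mulfV ?pnatr_eq0// /y (_ : 1%:C = 1)// iota1 mul1r => yk.
by exists k.
Qed.

End gelfand.

(** * Unitization *)

Section unitization.
Context (R : realType) (G : topologicalGroupType).
Variable mu : {measure set (borel G) -> \bar R}.
Variables (A : set (G -> R[i])) (N : (G -> R[i]) -> \bar R).
Implicit Types (f g h : G -> R[i]) (c d e : R[i]).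

Lemma aeq_refl f : aeq mu f f.
Proof. exact: aeW. Qed.

Lemma aeq_sym f g : aeq mu f g -> aeq mu g f.
Proof. by apply: filterS => x ->. Qed.

Lemma aeq_trans g f h : aeq mu f g -> aeq mu g h -> aeq mu f h.
Proof. by apply: filterS2 => x -> ->. Qed.

Lemma aeqD f f' g g' : aeq mu f f' -> aeq mu g g' -> aeq mu (f \+ g) (f' \+ g').
Proof. by apply: filterS2 => x /= -> ->. Qed.

Lemma aeqZ c f f' : aeq mu f f' -> aeq mu (fun x => c * f x) (fun x => c * f' x).
Proof. by apply: filterS => x /= ->. Qed.

(** A representative in [A] of the class of [f]. The defining set depends on [f] only up to null
    sets, so equivalent functions receive the same representative; the default is [0] when the class
    misses [A]. *)
Definition canon f : G -> R[i] := xget (fun=> 0) [set g | A g /\ aeq mu f g].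

(* Keeping only canonical representatives turns equality almost everywhere into
   Leibniz equality, so that the unitization is a ring in the library's sense. *)
Record unitization (H : convolution_algebra mu A N) := Unitization {
  uscal : R[i] ;
  ufun : G -> R[i] ;
  ufun_mem : A ufun ;
  ufun_canon : canon ufun = ufun
}.

Variable H : convolution_algebra mu A N.

HB.instance Definition _ := gen_eqMixin (unitization H).
HB.instance Definition _ := gen_choiceMixin (unitization H).

Lemma canonP f : A f -> A (canon f) /\ aeq mu f (canon f).
Proof.
move=> Af; rewrite /canon; apply: (@xgetPex _ (fun=> 0) [set g | A g /\ aeq mu f g]).
by exists f; split => //; exact: aeq_refl.
Qed.

Lemma canon_eq f g : aeq mu f g -> canon f = canon g.
Proof.
move=> fg; rewrite /canon; congr xget; apply/seteqP; split => h [Ah].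
  by move=> fh; split => //; apply: aeq_trans fh; exact: aeq_sym.
by move=> fh; split => //; apply: aeq_trans fh.
Qed.

Lemma canon_id f : A f -> canon (canon f) = canon f.
Proof. by move=> /canonP[_ /aeq_sym]; exact: canon_eq. Qed.

(** Total in [f], with the scalar [c] as value when [f] is not in [A]; terms can thus be rewritten
    without carrying membership proofs. *)
Definition elt c f : unitization H :=
  match pselect (A f) with
  | left Af => Unitization H c (canonP Af).1 (canon_id Af)
  | right _ => Unitization H c (canonP (ca_zero H)).1 (canon_id (ca_zero H))
  end.

Lemma uscal_elt c f : uscal (elt c f) = c.
Proof. by rewrite /elt; case: pselect. Qed.

Lemma ufun_elt c f : A f -> aeq mu f (ufun (elt c f)).
Proof. by rewrite /elt; case: pselect => // Af _; exact: (canonP Af).2. Qed.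

Lemma unitization_inj (u v : unitization H) : uscal u = uscal v ->
  aeq mu (ufun u) (ufun v) -> u = v.
Proof.
case: u v => [c f Af fK] [d g Ag gK] /= cd /canon_eq; rewrite fK gK => fg.
move: Ag gK; rewrite -cd -fg => Ag gK.
by rewrite (Prop_irrelevance Af Ag) (Prop_irrelevance fK gK).
Qed.

Lemma elt_eq c d f g : A f -> A g -> elt c f = elt d g <-> c = d /\ aeq mu f g.
Proof.
move=> Af Ag; split => [E|[-> fg]].
  split; first by rewrite -(uscal_elt c f) E uscal_elt.
  apply: aeq_trans (ufun_elt c Af) _; rewrite E.
  by apply: aeq_sym; exact: ufun_elt.
apply: unitization_inj; first by rewrite !uscal_elt.
apply: aeq_trans (ufun_elt d Ag); apply: aeq_trans fg.
by apply: aeq_sym; exact: ufun_elt.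
Qed.

Lemma eltE (u : unitization H) : u = elt (uscal u) (ufun u).
Proof.
apply: unitization_inj; first by rewrite uscal_elt.
by apply: ufun_elt; exact: ufun_mem.
Qed.

Lemma eltP (u : unitization H) : exists c f, A f /\ u = elt c f.
Proof. by exists (uscal u), (ufun u); split; [exact: ufun_mem|exact: eltE]. Qed.

Let AD f g : A f -> A g -> A (f \+ g) := @ca_add _ _ _ _ _ H f g.
Let AZ c f : A f -> A (fun x => c * f x) := @ca_scale _ _ _ _ _ H c f.
Let AM f g : A f -> A g -> A (convolution mu f g) := @ca_conv _ _ _ _ _ H f g.
Let A0 : A (fun=> 0) := ca_zero H.

Lemma norm_fin f : A f -> N f \is a fin_num.
Proof. by move=> /(ca_norm_fin H)/andP[N0 Noo]; rewrite ge0_fin_numE. Qed.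

Lemma norm_ge0 f : A f -> (0 <= N f)%E.
Proof. by move=> /(ca_norm_fin H)/andP[]. Qed.

Lemma norm_le_aeq f g : A f -> A g -> aeq mu f g -> (N f <= N g)%E.
Proof.
move=> Af Ag fg; have Afg := AD Af (AZ (-1) Ag).
have -> : f = g \+ (f \+ (fun x => -1 * g x)).
  by apply/funext => x /=; rewrite mulN1r addrC subrK.
apply: le_trans (ca_norm_add H Ag Afg) _.
rewrite (ca_norm_eq0 H Afg).2 ?adde0//.
by apply: filterS fg => x /= ->; rewrite mulN1r subrr.
Qed.

Lemma norm_aeq f g : A f -> A g -> aeq mu f g -> N f = N g.
Proof.
move=> Af Ag fg; apply/eqP; rewrite eq_le !norm_le_aeq//.
exact: aeq_sym.
Qed.

(** In the abstract setting, that convolution respects classes follows from the norm inequality: a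
    null factor has norm 0, hence so has the product. *)
Lemma conv_null_l f g : A f -> A g -> aeq mu f (fun=> 0) ->
  aeq mu (convolution mu f g) (fun=> 0).
Proof.
move=> Af Ag /(ca_norm_eq0 H Af) f0; apply/(ca_norm_eq0 H (AM Af Ag)).
have [M M0 HM] := ca_norm_conv H.
apply/eqP; rewrite eq_le norm_ge0 ?andbT; last exact: AM.
by apply: le_trans (HM _ _ Af Ag) _; rewrite f0 mule0 mul0e.
Qed.

Lemma conv_null_r f g : A f -> A g -> aeq mu g (fun=> 0) ->
  aeq mu (convolution mu f g) (fun=> 0).
Proof.
move=> Af Ag /(ca_norm_eq0 H Ag) g0; apply/(ca_norm_eq0 H (AM Af Ag)).
have [M M0 HM] := ca_norm_conv H.
apply/eqP; rewrite eq_le norm_ge0 ?andbT; last exact: AM.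
by apply: le_trans (HM _ _ Af Ag) _; rewrite g0 mule0.
Qed.

Lemma conv_aeq f f' g g' : A f -> A f' -> A g -> A g' ->
  aeq mu f f' -> aeq mu g g' ->
  aeq mu (convolution mu f g) (convolution mu f' g').
Proof.
move=> Af Af' Ag Ag' ff' gg'.
have Bf := AZ (-1) Af'; have Bg := AZ (-1) Ag'.
have Cf := AD Af Bf; have Cg := AD Ag Bg.
have f0 : aeq mu (f \+ (fun x => -1 * f' x)) (fun=> 0).
  by apply: filterS ff' => x /= ->; rewrite mulN1r subrr.
have g0 : aeq mu (g \+ (fun x => -1 * g' x)) (fun=> 0).
  by apply: filterS gg' => x /= ->; rewrite mulN1r subrr.
apply: (@aeq_trans (convolution mu f' g)).
  have := conv_null_l Cf Ag f0.
  apply: filterS3 (ca_convDl H Af Bf Ag) (ca_convZl H (-1) Af' Ag) => x /= -> ->.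
  by move/eqP; rewrite mulN1r subr_eq0 => /eqP.
have := conv_null_r Af' Cg g0.
apply: filterS3 (ca_convDr H Af' Ag Bg) (ca_convZr H (-1) Af' Ag') => x /= -> ->.
by move/eqP; rewrite mulN1r subr_eq0 => /eqP.
Qed.

Definition umulf c f d g : G -> R[i] :=
  fun x => c * g x + d * f x + convolution mu f g x.

Lemma umulf_mem c f d g : A f -> A g -> A (umulf c f d g).
Proof.
by move=> Af Ag; exact: (AD (AD (AZ c Ag) (AZ d Af)) (AM Af Ag)).
Qed.

Lemma umulf_aeq c f f' d g g' : A f -> A f' -> A g -> A g' ->
  aeq mu f f' -> aeq mu g g' -> aeq mu (umulf c f d g) (umulf c f' d g').
Proof.
move=> Af Af' Ag Ag' ff' gg'.
by apply: filterS3 ff' gg' (conv_aeq Af Af' Ag Ag' ff' gg') => x;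
  rewrite /umulf => -> -> ->.
Qed.

Definition uadd (u v : unitization H) :=
  elt (uscal u + uscal v) (ufun u \+ ufun v).
Definition uopp (u : unitization H) := elt (- uscal u) (fun x => -1 * ufun u x).
Definition umul (u v : unitization H) :=
  elt (uscal u * uscal v) (umulf (uscal u) (ufun u) (uscal v) (ufun v)).

Let ufunA u := @ufun_mem H u.

Lemma uaddE c f d g : A f -> A g -> uadd (elt c f) (elt d g) = elt (c + d) (f \+ g).
Proof.
move=> Af Ag; rewrite /uadd !uscal_elt; apply/elt_eq; [exact: AD|exact: AD|].
by split => //; apply: aeqD; apply: aeq_sym; exact: ufun_elt.
Qed.

Lemma uoppE c f : A f -> uopp (elt c f) = elt (- c) (fun x => -1 * f x).
Proof.
move=> Af; rewrite /uopp !uscal_elt; apply/elt_eq; [exact: AZ|exact: AZ|].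
by split => //; apply: aeqZ; apply: aeq_sym; exact: ufun_elt.
Qed.

Lemma umulE c f d g : A f -> A g ->
  umul (elt c f) (elt d g) = elt (c * d) (umulf c f d g).
Proof.
move=> Af Ag; rewrite /umul !uscal_elt; apply/elt_eq; [exact: umulf_mem|exact: umulf_mem|].
by split => //; apply: umulf_aeq => //; apply: aeq_sym; exact: ufun_elt.
Qed.

Lemma uaddA : associative uadd.
Proof.
move=> u v w; have [c [f [Af ->]]] := eltP u; have [d [g [Ag ->]]] := eltP v.
have [e [h [Ah ->]]] := eltP w.
rewrite !uaddE//; [|exact: AD|exact: AD].
rewrite addrA; congr elt; apply/funext => x /=; exact: addrA.
Qed.

Lemma uaddC : commutative uadd.
Proof.
move=> u v; have [c [f [Af ->]]] := eltP u; have [d [g [Ag ->]]] := eltP v.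
rewrite !uaddE// addrC; congr elt; apply/funext => x /=; exact: addrC.
Qed.

Lemma uadd0 : left_id (elt 0 (fun=> 0)) uadd.
Proof.
move=> u; have [c [f [Af ->]]] := eltP u.
rewrite !uaddE// add0r; congr elt; apply/funext => x /=; exact: add0r.
Qed.

Lemma uaddN : left_inverse (elt 0 (fun=> 0)) uopp uadd.
Proof.
move=> u; have [c [f [Af ->]]] := eltP u.
rewrite uoppE// uaddE//; last exact: AZ.
by rewrite addNr; congr elt; apply/funext => x /=; rewrite mulN1r addNr.
Qed.

HB.instance Definition _ := GRing.isZmodule.Build (unitization H)
  uaddA uaddC uadd0 uaddN.

Lemma umulA : associative umul.
Proof.
move=> u v w; have [c [f [Af ->]]] := eltP u; have [d [g [Ag ->]]] := eltP v.
have [e [h [Ah ->]]] := eltP w.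
have Afg := AM Af Ag; have Agh := AM Ag Ah.
rewrite !umulE//; [|exact: umulf_mem|exact: umulf_mem].
apply/elt_eq; [exact: umulf_mem (umulf_mem _ _ _ _)|exact: umulf_mem (umulf_mem _ _ _ _) _|].
split; first by rewrite mulrA.
have e1 := ca_convDr H Af (AD (AZ d Ah) (AZ e Ag)) Agh.
have e2 := ca_convDr H Af (AZ d Ah) (AZ e Ag).
have e3 := ca_convZr H d Af Ah; have e4 := ca_convZr H e Af Ag.
have e5 := ca_convDl H (AD (AZ c Ag) (AZ d Af)) Afg Ah.
have e6 := ca_convDl H (AZ c Ag) (AZ d Af) Ah.
have e7 := ca_convZl H c Ag Ah; have e8 := ca_convZl H d Af Ah.
have e9 := ca_convA H Af Ag Ah.
apply: filterS3 (filterI (filterI e1 e2) (filterI e3 e4))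
  (filterI (filterI e5 e6) (filterI e7 e8)) e9 => x.
rewrite /umulf/= => -[[E1 E2] [E3 E4]] [[E5 E6] [E7 E8]] E9.
rewrite E1 E2 E3 E4 E5 E6 E7 E8 E9.
by ring.
Qed.

Lemma umul1 : left_id (elt 1 (fun=> 0)) umul.
Proof.
move=> u; have [c [f [Af ->]]] := eltP u.
rewrite umulE// mul1r; apply/elt_eq => //; first exact: umulf_mem.
split => //; apply: filterS (conv_null_l A0 Af (aeq_refl _)) => x.
by rewrite /umulf => ->; rewrite mul1r mulr0 !addr0.
Qed.

Lemma umul1r : right_id (elt 1 (fun=> 0)) umul.
Proof.
move=> u; have [c [f [Af ->]]] := eltP u.
rewrite umulE// mulr1; apply/elt_eq => //; first exact: umulf_mem.
split => //; apply: filterS (conv_null_r Af A0 (aeq_refl _)) => x.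
by rewrite /umulf => ->; rewrite mul1r mulr0 add0r addr0.
Qed.

Lemma umulDl : left_distributive umul uadd.
Proof.
move=> u v w; have [c [f [Af ->]]] := eltP u; have [d [g [Ag ->]]] := eltP v.
have [e [h [Ah ->]]] := eltP w.
rewrite !(uaddE, umulE)//; try exact: AD; try exact: umulf_mem.
apply/elt_eq; [exact: umulf_mem (AD _ _) _|exact: AD (umulf_mem _ _ _ _) (umulf_mem _ _ _ _)|].
split; first by rewrite mulrDl.
apply: filterS (ca_convDl H Af Ag Ah) => x; rewrite /umulf/= => ->.
by ring.
Qed.

Lemma umulDr : right_distributive umul uadd.
Proof.
move=> u v w; have [c [f [Af ->]]] := eltP u; have [d [g [Ag ->]]] := eltP v.
have [e [h [Ah ->]]] := eltP w.
rewrite !(uaddE, umulE)//; try exact: AD; try exact: umulf_mem.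
apply/elt_eq; [exact: umulf_mem _ (AD _ _)|exact: AD (umulf_mem _ _ _ _) (umulf_mem _ _ _ _)|].
split; first by rewrite mulrDr.
apply: filterS (ca_convDr H Af Ag Ah) => x; rewrite /umulf/= => ->.
by ring.
Qed.

HB.instance Definition _ := GRing.Zmodule_isPzRing.Build (unitization H)
  umulA umul1 umul1r umulDl umulDr.

End unitization.

(** * The norm of the unitization and the Neumann series *)

Section unitization_norm.
Context (R : realType) (G : topologicalGroupType).
Variable mu : {measure set (borel G) -> \bar R}.
Variables (A : set (G -> R[i])) (N : (G -> R[i]) -> \bar R).
Variable H : convolution_algebra mu A N.
Variables (M : R) (M0 : 0 < M).
Hypothesis NM : forall f g, A f -> A g ->
  (N (convolution mu f g) <= M%:E * N f * N g)%E.
Implicit Types (f g h : G -> R[i]) (c d e : R[i]) (u v : unitization H).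

Let A0 : A (fun=> 0) := ca_zero H.
Local Notation elt := (elt H).

(** The factor [M] turns [N] into a submultiplicative norm, which makes [unrm] submultiplicative
    with constant 1. *)
Definition unrm u : R := modulus (uscal u) + M * fine (N (ufun u)).

Definition uiota c : unitization H := elt c (fun=> 0).

Lemma eltD c d f g : A f -> A g -> elt c f + elt d g = elt (c + d) (f \+ g).
Proof. exact: uaddE. Qed.

Lemma eltM c d f g : A f -> A g -> elt c f * elt d g = elt (c * d) (umulf mu c f d g).
Proof. exact: umulE. Qed.

Lemma elt1E : elt 1 (fun=> 0) = 1. Proof. by []. Qed.

Lemma elt0E : elt 0 (fun=> 0) = 0. Proof. by []. Qed.

Lemma N_ufun c f : A f -> N (ufun (elt c f)) = N f.
Proof.
move=> Af; apply: (norm_aeq H) => //; first exact: ufun_mem.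
by apply: aeq_sym; exact: ufun_elt.
Qed.

Lemma unrmE c f : A f -> unrm (elt c f) = modulus c + M * fine (N f).
Proof. by move=> Af; rewrite /unrm uscal_elt N_ufun. Qed.

Lemma fineN_ge0 f : A f -> 0 <= fine (N f).
Proof. by move=> Af; rewrite fine_ge0// (norm_ge0 H). Qed.

Lemma unrm_ge0 u : 0 <= unrm u.
Proof.
rewrite /unrm addr_ge0 ?modulus_ge0// mulr_ge0 ?(ltW M0)//.
by apply: fineN_ge0; exact: ufun_mem.
Qed.

Lemma fineND f g : A f -> A g -> fine (N (f \+ g)) <= fine (N f) + fine (N g).
Proof.
move=> Af Ag; rewrite -lee_fin EFinD !fineK ?(norm_fin H)//; last exact: (ca_add H).
exact: (ca_norm_add H).
Qed.

Lemma fineNZ c f : A f -> fine (N (fun x => c * f x)) = modulus c * fine (N f).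
Proof. by move=> Af; rewrite (ca_norm_scale H)// fineM// (norm_fin H). Qed.

Lemma fineNM f g : A f -> A g ->
  fine (N (convolution mu f g)) <= M * fine (N f) * fine (N g).
Proof.
move=> Af Ag; rewrite -lee_fin !EFinM !fineK ?(norm_fin H)//; last exact: (ca_conv H).
exact: NM.
Qed.

Lemma fineN0 : fine (N (fun=> 0)) = 0.
Proof. by rewrite (ca_norm_eq0 H A0).2//; exact: aeq_refl. Qed.

Lemma unrmD u v : unrm (u + v) <= unrm u + unrm v.
Proof.
have [c [f [Af ->]]] := eltP u; have [d [g [Ag ->]]] := eltP v.
rewrite eltD// !unrmE//; last exact: (ca_add H).
rewrite addrACA lerD ?modulusD// -mulrDr ler_wpM2l ?(ltW M0)//.
exact: fineND.
Qed.

Lemma unrmM u v : unrm (u * v) <= unrm u * unrm v.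
Proof.
have [c [f [Af ->]]] := eltP u; have [d [g [Ag ->]]] := eltP v.
rewrite eltM// !unrmE//; last exact: (umulf_mem H).
rewrite modulusM mulrDl !mulrDr -addrA lerD//.
have Ac := ca_scale H c Ag; have Ad := ca_scale H d Af.
have Acd := ca_add H Ac Ad; have Afg := ca_conv H Af Ag.
have h1 := fineND Acd Afg; have h2 := fineND Ac Ad.
rewrite fineNZ// fineNZ// in h2; have h3 := fineNM Af Ag.
have h4 : fine (N (umulf mu c f d g)) <= modulus c * fine (N g) +
    modulus d * fine (N f) + M * fine (N f) * fine (N g).
  apply: le_trans h1 _; apply: lerD => //.
apply: le_trans (ler_wpM2l (ltW M0) h4) _.
by lra.
Qed.

Lemma uiota1 : uiota 1 = 1. Proof. by []. Qed.

Lemma uiotaD a b : uiota (a + b) = uiota a + uiota b.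
Proof. by rewrite eltD//; congr elt; apply/funext => x /=; rewrite addr0. Qed.

Lemma uiota_mull c d f : A f -> uiota c * elt d f = elt (c * d) (fun x => c * f x).
Proof.
move=> Af; rewrite eltM//; apply/elt_eq; [exact: (umulf_mem H)|exact: (ca_scale H)|].
split => //; apply: filterS (conv_null_l H A0 Af (aeq_refl mu _)) => x.
by rewrite /umulf => ->; rewrite mulr0 !addr0.
Qed.

Lemma uiota_mulr c d f : A f -> elt d f * uiota c = elt (c * d) (fun x => c * f x).
Proof.
move=> Af; rewrite eltM//; apply/elt_eq; [exact: (umulf_mem H)|exact: (ca_scale H)|].
split; first by rewrite mulrC.
apply: filterS (conv_null_r H Af A0 (aeq_refl mu _)) => x.
by rewrite /umulf => ->; rewrite mulr0 add0r addr0.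
Qed.

Lemma uiotaM a b : uiota (a * b) = uiota a * uiota b.
Proof. by rewrite uiota_mull//; congr elt; apply/funext => x; rewrite mulr0. Qed.

Lemma uiotaC a u : uiota a * u = u * uiota a.
Proof. by have [c [f [Af ->]]] := eltP u; rewrite uiota_mull// uiota_mulr. Qed.

Lemma unrm_iota a : unrm (uiota a) = modulus a.
Proof. by rewrite unrmE// fineN0 mulr0 addr0. Qed.

Lemma unrmN u : unrm (- u) = unrm u.
Proof.
have [c [f [Af ->]]] := eltP u.
rewrite [- _](uoppE H)// !unrmE//; last exact: (ca_scale H).
by rewrite modulusN fineNZ// modulusN modulus1 mul1r.
Qed.

Lemma unrm_eq0 u : unrm u = 0 -> u = 0.
Proof.
have [c [f [Af ->]]] := eltP u; rewrite unrmE//.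
have m0 := modulus_ge0 c.
have n0 : 0 <= M * fine (N f) by rewrite mulr_ge0 ?(ltW M0)// fineN_ge0.
move/eqP; rewrite paddr_eq0// => /andP[]; rewrite modulus_eq0 => /eqP ->.
rewrite mulf_eq0 gt_eqF//= => /eqP Nf.
apply/elt_eq => //; split => //; apply/(ca_norm_eq0 H Af).
by rewrite -(fineK (norm_fin H Af)) Nf.
Qed.

(** Sequences with zero scalar part live in [A], so completeness of [A] is all that enters; the
    partial sums in [neumann] are of this kind. *)
Lemma unitization_complete (t : nat -> unitization H) :
  (forall n, uscal (t n) = 0) ->
  (forall eps : R, 0 < eps -> exists n0, forall m n,
    (n0 <= m)%N -> (n0 <= n)%N -> unrm (t m - t n) < eps) ->
  exists l, forall eps : R, 0 < eps -> exists n0, forall n,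
    (n0 <= n)%N -> unrm (t n - l) <= eps.
Proof.
move=> t0 tC; pose f n := ufun (t n).
have Af n : A (f n) by exact: ufun_mem.
have tE n : t n = elt 0 (f n) by rewrite (eltE (t n)) t0.
have sub c d g h : A g -> A h -> elt c g - elt d h = elt (c - d) (g \- h).
  move=> Ag Ah; rewrite [- _](uoppE H)// eltD//; last exact: (ca_scale H).
  by congr elt; apply/funext => x /=; rewrite mulN1r.
have conv_algebra_sub g h : A g -> A h -> A (g \- h).
  move=> Ag Ah; have := ca_add H Ag (ca_scale H (-1) Ah).
  by congr A; apply/funext => x /=; rewrite mulN1r.
have nE g h : A g -> A h -> unrm (elt 0 g - elt 0 h) = M * fine (N (g \- h)).
  by move=> Ag Ah; rewrite sub// unrmE ?subrr ?modulus0 ?add0r//; exact: conv_algebra_sub.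
have [|l Al fl] := ca_complete H Af.
  move=> eps eps0; have [n0 Hn0] := tC (M * eps) (mulr_gt0 M0 eps0).
  exists n0 => m n nm nn; have := Hn0 m n nm nn.
  rewrite !tE nE// ltr_pM2l// -lte_fin fineK//.
  by apply: (norm_fin H); exact: conv_algebra_sub.
exists (elt 0 l) => eps eps0.
move/fine_cvgP : fl => [_ /cvgrPdist_le /(_ (eps / M) (divr_gt0 eps0 M0))[n0 _ Hn0]].
exists n0 => n nn; rewrite tE nE//.
have := Hn0 n nn; rewrite /= sub0r normrN ger0_norm; last by apply: fineN_ge0; exact: conv_algebra_sub.
by rewrite ler_pdivlMr// mulrC.
Qed.

Lemma uscalD u v : uscal (u + v) = uscal u + uscal v.
Proof. by rewrite uscal_elt. Qed.

Lemma uscalM u v : uscal (u * v) = uscal u * uscal v.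
Proof. by rewrite uscal_elt. Qed.

Lemma neumann (y : unitization H) : uscal y = 0 -> unrm y <= 1 / 2 ->
  exists v, inverses (1 - y) v.
Proof.
move=> y0 yn.
(* The sum starts at [y] rather than at 1, so its scalar part vanishes; with [l] its limit, the
   inverse is [1 + l]. *)
pose t n := \sum_(0 <= k < n) y ^+ k.+1.
have nX k : unrm (y ^+ k.+1) <= (1 / 2) ^+ k.+1.
  apply: le_trans (nrmX uiota1 unrm_ge0 unrmM unrm_iota _ _) _.
  by rewrite lerXn2r// ?nnegrE ?unrm_ge0// divr_ge0.
have tS n : t n.+1 = t n + y ^+ n.+1 by rewrite /t big_nat_recr.
have tl n : y * (1 + t n) = t n.+1.
  by rewrite /t big_nat_recl// expr1 mulrDr mulr1 mulr_sumr.
have tr n : (1 + t n) * y = t n.+1.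
  rewrite /t big_nat_recl// expr1 mulrDl mul1r mulr_suml; congr (_ + _).
  by apply: eq_bigr => i _; rewrite [in RHS]exprSr.
have ts n : uscal (t n) = 0.
  elim: n => [|n ih]; first by rewrite /t big_geq// uscal_elt.
  by rewrite tS uscalD ih exprS uscalM y0 mul0r addr0.
have dist n m : unrm (t (n + m)%N - t n) <= (1 / 2) ^+ n - (1 / 2) ^+ (n + m).
  elim: m => [|m ih]; first by rewrite addn0 !subrr -elt0E unrmE// modulus0 fineN0 mulr0 addr0.
  rewrite addnS tS addrAC; apply: le_trans (unrmD _ _) _.
  have := nX (n + m)%N.
  rewrite (_ : (1 / 2) ^+ (n + m).+1 = 1 / 2 * (1 / 2) ^+ (n + m)); last by rewrite exprS.
  move: ih; lra.
have h0 : 0 <= 1 / 2 :> R by lra.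
have [|l Hl] := unitization_complete ts.
  move=> eps eps0.
  have [n0] := ltr_add_invr eps0; rewrite add0r => ne.
  have half n : (n0 < n)%N -> (1 / 2) ^+ n < eps.
    move=> n0n; apply: le_lt_trans ne.
    rewrite div1r exprVn lef_pV2 ?posrE ?exprn_gt0 ?ltr0n//.
    by rewrite -natrX ler_nat (leq_trans n0n)// ltnW// ltn_expl.
  have ge n m : (n0 < n)%N -> unrm (t (n + m)%N - t n) < eps.
    move=> nn; apply: le_lt_trans (dist n m) _; apply: le_lt_trans (half n nn).
    by rewrite gerDl oppr_le0 exprn_ge0.
  exists n0.+1 => m n nm nn; case: (leqP n m) => [nm'|mn'].
    by rewrite -(subnKC nm'); exact: ge.
  rewrite -unrmN opprB -(subnKC (ltnW mn')); exact: ge.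
have lim0 v : (forall eps, 0 < eps -> unrm v <= eps) -> v = 0.
  move=> Hv; apply: unrm_eq0; apply/eqP; rewrite eq_le unrm_ge0 andbT.
  by apply/ler_addgt0Pr => eps eps0; rewrite add0r; exact: Hv.
have small eps : 0 < eps -> exists n, unrm (t n - l) <= eps /\ unrm (t n.+1 - l) <= eps.
  by move=> /Hl[n Hn]; exists n; split; apply: Hn.
(* The limit of [y * (1 + t n) = t n.+1]. *)
have ll : y * (1 + l) = l.
  apply/eqP; rewrite -subr_eq0; apply/eqP; apply: lim0 => eps eps0.
  have [n [n1 n2]] := small (eps / 2) ltac:(by rewrite divr_gt0).
  have -> : y * (1 + l) - l = - (y * (t n - l)) + (t n.+1 - l).
    rewrite -tl addrA; congr (_ - _); rewrite -mulrN -mulrDr; congr (_ * _).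
    by rewrite opprB (addrC 1 (t n)) subrKA addrC.
  apply: le_trans (unrmD _ _) _; rewrite unrmN.
  have := unrmM y (t n - l); have := ler_pM (unrm_ge0 _) (unrm_ge0 _) yn n1.
  have := unrm_ge0 (t n - l); lra.
have lr : (1 + l) * y = l.
  apply/eqP; rewrite -subr_eq0; apply/eqP; apply: lim0 => eps eps0.
  have [n [n1 n2]] := small (eps / 2) ltac:(by rewrite divr_gt0).
  have -> : (1 + l) * y - l = - ((t n - l) * y) + (t n.+1 - l).
    rewrite -tr addrA; congr (_ - _); rewrite -mulNr -mulrDl; congr (_ * _).
    by rewrite opprB (addrC 1 (t n)) subrKA addrC.
  apply: le_trans (unrmD _ _) _; rewrite unrmN.
  have := unrmM (t n - l) y; have := ler_pM (unrm_ge0 _) (unrm_ge0 _) n1 yn.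
  have := unrm_ge0 (t n - l); lra.
exists (1 + l); split.
  by rewrite mulrBl mul1r ll addrK.
by rewrite mulrBr mulr1 lr addrK.
Qed.

End unitization_norm.

(** * Spectra and iterated convolution squares *)

Definition conv_sq (R : realType) (G : topologicalGroupType)
    (mu : {measure set (borel G) -> \bar R}) (f : G -> R[i]) (k : nat) :=
  iter k (fun u => convolution mu u u) f.

(* An algebra with a unit [e] is the corner [e B e] of its unitization [B]; this
   matches the spectrum computed in the algebra with the one computed in [B],
   except possibly at [0]. *)
Section corner.
Variables (B : pzRingType) (e f l l' : B).
Hypotheses (ee : e * e = e) (ef : e * f = f) (fe : f * e = f).
Hypotheses (lC : forall x, l * x = x * l) (l'C : forall x, l' * x = x * l').
Hypotheses (ll' : l * l' = 1).

(** Relative to [1 = e + (1 - e)], the element [l - f] acts as [l * e - f] on the corner and as [l]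
    on the complement; the inverse is glued from [g] and [l']. *)
Lemma corner_inverse g : e * g = g -> g * e = g ->
  (l * e - f) * g = e -> g * (l * e - f) = e ->
  inverses (l - f) (l' * (1 - e) + g).
Proof.
move=> eg ge g1 g2.
have fe0 : f * (1 - e) = 0 by rewrite mulrBr mulr1 fe subrr.
have ef0 : (1 - e) * f = 0 by rewrite mulrBl mul1r ef subrr.
have h1 : (l - f) * g = e by rewrite -[RHS]g1 !mulrBl -mulrA eg.
have h2 : g * (l - f) = e by rewrite -[RHS]g2 !mulrBr (lC e) mulrA ge.
split.
  rewrite mulrDr h1 mulrA -l'C -mulrA mulrBl fe0 subr0 lC mulrA.
  by rewrite -lC mulrA ll' mul1r subrK.
rewrite mulrDl h2 -mulrA mulrBr ef0 subr0 -lC mulrA -lC ll' mul1r subrK//.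
Qed.

Lemma inverse_corner v : e * v = v * e -> inverses (l - f) v ->
  (l * e - f) * (v * e) = e /\ (v * e) * (l * e - f) = e.
Proof.
move=> ev [v1 v2].
have E1 : l * e - f = (l - f) * e by rewrite mulrBl fe.
have E2 : l * e - f = e * (l - f) by rewrite mulrBr ef lC.
split; first by rewrite E1 -ev -mulrA (mulrA e) ee ev mulrA v1 mul1r.
by rewrite E2 -mulrA (mulrA e) ee -E2 E1 mulrA v2 mul1r.
Qed.

End corner.

(** * The spectrum and the norms of iterated squares *)

Section spectrum_criterion.
Context (R : realType) (G : topologicalGroupType).
Variable mu : {measure set (borel G) -> \bar R}.
Variables (A : set (G -> R[i])) (N : (G -> R[i]) -> \bar R).
Variable H : convolution_algebra mu A N.
Variables (M : R) (M0 : 0 < M).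
Hypothesis NM : forall f g, A f -> A g ->
  (N (convolution mu f g) <= M%:E * N f * N g)%E.
Implicit Types (f g h : G -> R[i]) (c d : R[i]).

Let A0 : A (fun=> 0) := ca_zero H.
Let AZ c f : A f -> A (fun x => c * f x) := @ca_scale _ _ _ _ _ H c f.
Let AM f g : A f -> A g -> A (convolution mu f g) := @ca_conv _ _ _ _ _ H f g.
Local Notation elt := (elt H).
Local Notation iota := (uiota H).
Let emb f := elt 0 f.

Lemma conv_algebra_sub f g : A f -> A g -> A (f \- g).
Proof.
move=> Af Ag; have := ca_add H Af (AZ (-1) Ag).
by congr A; apply/funext => x /=; rewrite mulN1r.
Qed.

Let emb_eq f g : A f -> A g -> emb f = emb g <-> aeq mu f g.
Proof.
move=> Af Ag; split; first by move/(elt_eq H _ _ Af Ag) => [].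
by move=> fg; apply/(elt_eq H).
Qed.

Let embM f g : A f -> A g -> emb f * emb g = emb (convolution mu f g).
Proof.
move=> Af Ag; rewrite eltM// mul0r; apply/(elt_eq H); [exact: (umulf_mem H)|exact: AM|].
by split => //; apply: aeW => x; rewrite /umulf !mul0r !add0r.
Qed.

Let embZ c f : A f -> iota c * emb f = emb (fun x => c * f x).
Proof. by move=> Af; rewrite uiota_mull// mulr0. Qed.

Let embB f g : A f -> A g -> emb f - emb g = emb (f \- g).
Proof.
move=> Af Ag; rewrite [- _](uoppE H)// eltD//; last exact: AZ.
rewrite oppr0 addr0; congr elt.
by apply/funext => x /=; rewrite mulN1r.
Qed.

Let elt_split c f : A f -> elt c f = iota c + emb f.
Proof.
by move=> Af; rewrite eltD// addr0; congr elt; apply/funext => x /=; rewrite add0r.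
Qed.

Lemma is_unitP e : is_unit mu A e <->
  A e /\ forall f, A f -> emb e * emb f = emb f /\ emb f * emb e = emb f.
Proof.
split=> -[Ae eu]; split => // f Af; have [e1 e2] := eu f Af.
  by rewrite !embM//; split; apply/emb_eq => //; exact: AM.
by split; apply/emb_eq => //; try exact: AM; rewrite -embM.
Qed.

Lemma invertibleP e c f : A e -> A f ->
  invertible mu A e (fun x => c * e x - f x) <->
  exists2 g, A g & (iota c * emb e - emb f) * emb g = emb e /\
                   emb g * (iota c * emb e - emb f) = emb e.
Proof.
move=> Ae Af; have Ac := AZ c Ae; have Acf := conv_algebra_sub Ac Af.
rewrite embZ// embB//; split=> -[g Ag [g1 g2]]; exists g => //.
  by rewrite !embM//; split; apply/emb_eq => //; exact: AM.
by split; apply/emb_eq => //; try exact: AM; rewrite -embM.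
Qed.

Lemma unitization_invertibleP c f : A f ->
  unitization_invertible mu A (c, fun x => - f x) <->
  exists v, inverses (iota c - emb f) v.
Proof.
move=> Af.
have AN : A (fun x => - f x).
  by have := AZ (-1) Af; congr A; apply/funext => x; rewrite mulN1r.
have -> : iota c - emb f = elt c (fun x => - f x).
  rewrite [- _](uoppE H)// eltD//; last exact: AZ.
  rewrite oppr0 addr0; congr elt.
  by apply/funext => x /=; rewrite mulN1r add0r.
have mul1 d1 g1 d2 g2 : A g1 -> A g2 ->
    unitization_eq1 mu (unitization_mul mu (d1, g1) (d2, g2)) <->
    elt d1 g1 * elt d2 g2 = 1.
  move=> Ag1 Ag2; rewrite eltM// -(elt1E H).
  split; first by move=> e; apply/(elt_eq H) => //; exact: (umulf_mem H).
  by move/(elt_eq H _ _ (umulf_mem H _ _ Ag1 Ag2) A0).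
split.
  move=> [[d g] /= Ag [g1 g2]]; exists (elt d g).
  by split; apply/mul1.
move=> [v]; have [d [g [Ag ->]]] := eltP v => -[v1 v2].
by exists (d, g) => //=; split; apply/mul1.
Qed.

(** The value [c = 0] is excluded: an element with zero scalar part is never invertible in the
    unitization, whereas it may be invertible in a unital [A]. *)
Lemma spectrumP c f : A f -> c != 0 ->
  ~ spectrum mu A f c <-> exists v, inverses (iota c - emb f) v.
Proof.
move=> Af c0.
have cV : iota c * iota c^-1 = 1 by rewrite -uiotaM mulfV.
have Vc : iota c^-1 * iota c = 1 by rewrite -uiotaM mulVf.
split=> [nsp|[v [v1 v2]]].
  have [[e ue]|noe] := pselect (exists e, is_unit mu A e); last first.
    apply/unitization_invertibleP => //; apply: contrapT => ni.
    by apply: nsp; right.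
  have [Ae /(_ _ _)eu] := (is_unitP e).1 ue.
  have /invertibleP : invertible mu A e (fun x => c * e x - f x).
    by apply: contrapT => ni; apply: nsp; left; exists e.
  move=> /(_ Ae Af)[g Ag [g1 g2]].
  have [eg ge] := eu g Ag; have [ef fe] := eu f Af; have [ee _] := eu e Ae.
  exists (iota c^-1 * (1 - emb e) + emb g).
  by apply: corner_inverse => // x; exact: uiotaC.
move=> [[e ue ni]|[noe ni]]; last by apply: ni; apply/unitization_invertibleP => //; exists v.
apply: ni; have [Ae eu] := (is_unitP e).1 ue.
apply/invertibleP => //.
(* The inverse [v = d + g] need not lie in [A], but it commutes with [e], and its corner
   [v * e = d e + g] does lie in [A]. *)
have [d [g [Ag vE]]] := eltP v.
have [eg ge] := eu g Ag; have [ef fe] := eu f Af; have [ee _] := eu e Ae.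
have vE' : v = iota d + emb g by rewrite vE elt_split.
have ev : emb e * v = v * emb e by rewrite vE' mulrDr mulrDl eg ge uiotaC.
have vg : v * emb e = emb ((fun x => d * e x) \+ g).
  by rewrite vE' mulrDl ge embZ// /emb eltD ?addr0//; exact: AZ.
exists ((fun x => d * e x) \+ g); first by apply: (ca_add H) => //; exact: AZ.
rewrite -/(emb _) -vg; apply: inverse_corner => //.
by move=> x; exact: uiotaC.
Qed.

Lemma conv_sq_mem f k : A f -> A (conv_sq mu f k).
Proof. by move=> Af; elim: k => //= k ih; exact: AM. Qed.

Let embX f k : A f -> emb f ^+ (2 ^ k) = emb (conv_sq mu f k).
Proof.
move=> Af; elim: k => [|k ih]; first by rewrite expn0 expr1.
by rewrite expnSr exprM ih expr2 embM//; exact: conv_sq_mem.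
Qed.

Let powE c f k : A f -> unrm M ((iota c * emb f) ^+ (2 ^ k)) =
  modulus c ^+ (2 ^ k) * (M * fine (N (conv_sq mu f k))).
Proof.
move=> Af; have iX n : iota (c ^+ n) = iota c ^+ n.
  by elim: n => [|n ih]; rewrite ?expr0// !exprS uiotaM ih.
rewrite exprMn_comm; last exact: uiotaC.
rewrite -iX embX// embZ; last exact: conv_sq_mem.
rewrite unrmE; last by apply: AZ; exact: conv_sq_mem.
rewrite modulus0 add0r (fineNZ H); last exact: conv_sq_mem.
by rewrite modulusX mulrCA.
Qed.

(** This is [gelfand_pow_le] for [x = f / r]. For [0 < |z| <= 1] the scalar [r / z] has modulus at
    least [r], hence is outside the spectrum, and [1 - z x = (z / r) (r / z - f)] is invertible. *)
Lemma spectrum_lt_small f (r : R) : A f -> 0 < r ->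
  (forall c, spectrum mu A f c -> modulus c < r) ->
  exists k, M * fine (N (conv_sq mu f k)) <= 1 / 2 * r ^+ (2 ^ k).
Proof.
move=> Af r0 sr.
have rm : modulus (r%:C)^-1 = r^-1 by rewrite modulusV modulus_real gtr0_norm.
have rC0 : r%:C != 0 by rewrite -modulus_eq0 modulus_real normr_eq0 gt_eqF.
have [k|k Hk] := @gelfand_pow_le R (unitization H) iota (unrm M) (uiota1 H)
  (uiotaD H) (uiotaM H) (@uiotaC _ _ _ _ _ H) (unrm_ge0 M0) (unrmD M0) (unrmM M0 NM)
  (unrm_iota H M) (iota (r%:C)^-1 * emb f).
  move=> k1; have [->|k0] := eqVneq k 0.
    exists 1; rewrite (_ : iota 0 = 0) ?mul0r ?subr0//.
    by split; rewrite mulr1.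
  have rk0 : r%:C / k != 0 by rewrite mulf_neq0 ?invr_eq0.
  have [|v [v1 v2]] := (spectrumP Af rk0).1.
    move=> /sr; rewrite modulusM modulusV modulus_real gtr0_norm//.
    have k0' : 0 < modulus k by rewrite lt0r modulus_eq0 k0 modulus_ge0.
    by rewrite ltr_pdivrMr// ltNge ler_piMr// ltW.
  set a := r%:C / k in rk0 v1 v2.
  have ka : k * (r%:C)^-1 = a^-1 by rewrite /a invf_div.
  have aV : iota a^-1 * iota a = 1.
    by rewrite -[RHS](uiota1 H) -(mulVf rk0); exact: esym (uiotaM H _ _).
  have Va : iota a * iota a^-1 = 1 by rewrite (@uiotaC _ _ _ _ _ H).
  have E : 1 - iota k * (iota (r%:C)^-1 * emb f) = iota a^-1 * (iota a - emb f).
    rewrite (mulrA (iota k)) -(uiotaM H k) ka [RHS]mulrBr aV//.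
  exists (v * iota a); rewrite E; split.
    by rewrite -(mulrA (iota a^-1)) (mulrA _ v) v1 mul1r.
  rewrite -(mulrA v) (mulrA (iota a)) Va mul1r v2//.
exists k; move: Hk; rewrite powE// rm.
rewrite exprVn mulrC ler_pdivrMr//; exact: exprn_gt0.
Qed.

(** If [|c| >= r], a Neumann series inverts [1 - (f / c)^(2^k)], and [inverses_expn2] descends to
    [1 - f / c]. *)
Lemma small_spectrum_lt f (r : R) k : A f -> 0 < r ->
  M * fine (N (conv_sq mu f k)) <= 1 / 2 * r ^+ (2 ^ k) ->
  forall c, spectrum mu A f c -> modulus c < r.
Proof.
move=> Af r0 Hk c sc; rewrite ltNge; apply/negP => rc.
have c0 : c != 0 by rewrite -modulus_eq0 gt_eqF// (lt_le_trans r0).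
have mc0 : 0 < modulus c by exact: lt_le_trans rc.
suff : exists v, inverses (iota c - emb f) v by move/(spectrumP Af c0).2.
pose x := iota c^-1 * emb f.
have [||w xw] := neumann M0 NM (y := x ^+ (2 ^ k)).
- have xX n : uscal (x ^+ n) = uscal x ^+ n.
    elim: n => [|n ih]; first by rewrite !expr0; exact: (uscal_elt H).
    by rewrite !exprS uscalM ih.
  by rewrite xX /x uscalM !uscal_elt mulr0 expr0n expn_eq0.
- rewrite powE// modulusV exprVn mulrC ler_pdivrMr ?exprn_gt0//.
  apply: le_trans Hk _; rewrite ler_wpM2l//.
  by rewrite lerXn2r// nnegrE ltW.
have [v [v1 v2]] := inverses_expn2 xw.
have cV : iota c * iota c^-1 = 1.
  by rewrite -[RHS](uiota1 H) -(mulfV c0); exact: esym (uiotaM H _ _).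
have Vc : iota c^-1 * iota c = 1 by rewrite (@uiotaC _ _ _ _ _ H).
have E : iota c - emb f = iota c * (1 - x).
  by rewrite mulrBr mulr1 /x mulrA cV mul1r.
exists (v * iota c^-1); rewrite E; split.
  by rewrite -(mulrA (iota c)) (mulrA _ v) v1 mul1r.
by rewrite -(mulrA v) (mulrA (iota c^-1)) Vc mul1r v2.
Qed.

End spectrum_criterion.

(** * The weight [omega_sharp] *)

Section standard_decomposition.
Context (R : realType) (G : topologicalGroupType).
Variable mu : {measure set (borel G) -> \bar R}.
Variable K : nat -> set G.
Hypotheses (hG : locally_elliptic G) (hK : standard_decomposition K)
  (hmu : haar_measure mu) (muK1 : mu (K 1%N) = 1%E).

(** Shifts the index: the groups start at [K 1], the exhaustion at [Kexh 0]. *)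
Definition Kexh (n : nat) : set G := K n.+1.
Local Notation D := Kexh.

Lemma Kexh_sub n : is_subgroup (D n). Proof. by have [/(_ n.+1 isT)[]] := hK. Qed.
Lemma Kexh_compact n : compact (D n). Proof. by have [/(_ n.+1 isT)[]] := hK. Qed.
Lemma Kexh_open n : open (D n). Proof. by have [/(_ n.+1 isT)[]] := hK. Qed.
Lemma Kexh_borel n : measurable (D n : set (borel G)).
Proof. by apply: open_borel; exact: Kexh_open. Qed.

Lemma Kexh_nd : nondecreasing_seq D.
Proof.
apply/nondecreasing_seqP => n; apply/subsetPset.
by have [_ /(_ n.+1 isT)] := hK.
Qed.

Lemma Kexh_le m n : (m <= n)%N -> D m `<=` D n.
Proof. by move=> /Kexh_nd /subsetPset. Qed.

Lemma Kexh_cover : \bigcup_n D n = [set: G].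
Proof.
apply/seteqP; split=> // x _.
have [_ _ + _] := hK => /seteqP[_ /(_ x I)] [[//|n] _ Kx].
by exists n.
Qed.

Lemma mu_Kexh_ge1 n : (1 <= mu (D n))%E.
Proof.
rewrite -muK1; apply: measureS; [exact: (Kexh_borel 0)|exact: Kexh_borel|].
exact: (@Kexh_le 0 n).
Qed.

Lemma Kexh_haar : haar_exhaustion mu D.
Proof.
split.
- split.
  + by have [] := hG.
  + exact: (haar_inner_regular hmu).
  + exact: Kexh_open.
  + by move=> n; apply: (haar_compact hmu); exact: Kexh_compact.
  + exact: Kexh_nd.
  + exact: Kexh_cover.
- exact: Kexh_sub.
- by move=> n; apply: lt_le_trans (mu_Kexh_ge1 n); exact: lte01.
- exact: (haar_translate hmu).
Qed.

Lemma compact_Kexh (C : set G) : compact C -> exists n, C `<=` D n.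
Proof.
move=> cC.
have H x : C x -> \forall x' \near x & n \near \oo, D n x'.
  move=> _; have [n _ Dnx] : (\bigcup_n D n) x by rewrite Kexh_cover.
  exists (D n, [set m | (n <= m)%N]) => /=.
    split; last exact: nbhs_infty_ge.
    by apply: open_nbhs_nbhs; split => //; exact: Kexh_open.
  by move=> [x' m] /= [Dx' nm]; exact: Kexh_le nm _ Dx'.
have [n _ Hn] := (compact_near_coveringP C).1 cC nat \oo D _ H.
by exists n; exact: (Hn n (leqnn n)).
Qed.

Definition level (x : G) (l : nat) := D l x /\ forall m, (m < l)%N -> ~ D m x.

Lemma level_ex x : exists l, level x l.
Proof.
have [n _ Dnx] : (\bigcup_n D n) x by rewrite Kexh_cover.
have ex : exists n, `[< D n x >] by exists n; apply/asboolP.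
exists (ex_minn ex); case: ex_minnP => l /asboolP Dl lmin; split => // m ml /asboolP /lmin.
by rewrite leqNgt ml.
Qed.

Lemma level_le x l n : level x l -> D n x -> (l <= n)%N.
Proof. by move=> [_ lx] Dn; rewrite leqNgt; apply/negP => /lx. Qed.

Variable omega : G -> R.
Hypothesis homega : weight omega.

Let a i := sup [set omega x | x in K i].

(** The value of [omega_sharp] at points of level [l], that is on [K l.+1] minus [K l], or on [K 1]
    when [l = 0]. *)
Let b l : R := if l is l'.+1 then
  (a l.+1 + l.+1%:R ^+ 2) * fine (mu (D l `\` D l')) else a 1%N + 1.

Let w := omega_sharp mu K omega.

Let w_series x n := \sum_(2 <= i < n)
  (a i + i%:R ^+ 2) * fine (mu (K i `\` K i.-1)) * \1_(K i `\` K i.-1) x.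

(** The pieces [K 1] and [K i] minus [K i.-1] are disjoint, so at a point of level [l > 0] only the
    term of index [l.+1] survives and the partial sums are stationary. *)
Lemma omega_sharp_near x l : level x l ->
  \forall n \near \oo, (a 1%N + 1) * \1_(K 1%N) x + w_series x n = b l.
Proof.
case: l => [|l] [Dx lx]; near=> n.
  rewrite indicE mem_set//= mulr1 /w_series big_nat big1 ?addr0// => -[//|[//|i]] _.
  rewrite indicE memNset ?mulr0// => -[_] /=; apply.
  exact: (@Kexh_le 0 i).
have nl : (l.+3 <= n)%N by near: n; exact: nbhs_infty_ge.
rewrite indicE memNset ?mulr0 ?add0r; last by apply: (lx 0).
rewrite /w_series (big_cat_nat _ (n := l.+2)) ?(ltnW nl)//= big_nat big1 ?add0r; last first.
  move=> [//|[//|i]] /andP[_]; rewrite !ltnS => il.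
  rewrite indicE memNset ?mulr0// => -[Di] _.
  by apply: (lx i.+1) Di; rewrite ltnS.
rewrite big_ltn// big_nat big1 ?addr0; last first.
  move=> [//|[//|i]] /andP[+ _]; rewrite !ltnS => li.
  rewrite indicE memNset ?mulr0// => -[_] /=; apply.
  exact: (@Kexh_le l.+1 i).
rewrite indicE mem_set ?mulr1//; split => //=.
exact: (lx l).
Unshelve. all: by end_near. Qed.

Lemma omega_sharp_cvg x l : level x l ->
  (a 1%N + 1) * \1_(K 1%N) x + w_series x n @[n --> \oo] --> b l.
Proof. by move=> xl; apply: cvg_near_cst; exact: omega_sharp_near. Qed.

Lemma omega_sharpE x l : level x l -> w x = b l.
Proof.
move=> xl; rewrite /w /omega_sharp -/a.
have -> : limn (w_series x) = b l - (a 1%N + 1) * \1_(K 1%N) x.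
  apply/cvg_lim => //; apply: cvg_near_cst.
  by apply: filterS (omega_sharp_near xl) => n <-; rewrite addrC addKr.
by rewrite addrC subrK.
Qed.

Let omega_le_a n x : D n x -> omega x <= a n.+1.
Proof.
move=> Dx; have [_ _ + _ _] := homega => /(_ _ (@Kexh_compact n))[M HM].
apply: ub_le_sup; last by exists x.
by exists M => _ [y Ky <-]; exact: HM.
Qed.

Let a_ge1 n : 1 <= a n.+1.
Proof.
have [D1 _ _] := Kexh_sub n; have [_ om1 _ _ _] := homega.
exact: le_trans (om1 1%g) (omega_le_a D1).
Qed.

Let a_le m n : (m <= n)%N -> a m.+1 <= a n.+1.
Proof.
move=> mn; apply: ge_sup.
  by have [D1 _ _] := Kexh_sub m; exists (omega 1%g), 1%g.
by move=> _ [x Dx <-]; apply: omega_le_a; exact: Kexh_le mn _ Dx.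
Qed.

Let mu_diff_fin l : mu (D l.+1 `\` D l) \is a fin_num.
Proof.
rewrite ge0_fin_numE//; apply: le_lt_trans (haar_compact hmu (@Kexh_compact l.+1)).
apply: measureS; [|exact: Kexh_borel|by move=> x []].
by apply: measurableD; exact: Kexh_borel.
Qed.

(* [D l.+1 `\` D l] contains the coset [y * D l]. *)
Let mu_diff_ge l y : D l.+1 y -> ~ D l y -> (mu (D l) <= mu (D l.+1 `\` D l))%E.
Proof.
move=> Dy nDy; have := haar_translate hmu y (Kexh_borel l) => <-.
have mD : measurable ((fun x => y * x)%g @` D l : set (borel G)).
  rewrite (_ : _ @` _ = (fun x => y^-1 * x)%g @^-1` D l).
    have := continuous_borel (@mull_continuous G y^-1%g) measurableT (Kexh_borel l).
    by rewrite setTI.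
  apply/seteqP; split=> [_ [x Dx <-]|x /= Dx] /=; first by rewrite mulKg.
  by exists (y^-1 * x)%g; rewrite ?mulVKg.
apply: measureS => //; first by apply: measurableD; exact: Kexh_borel.
move=> _ [x Dx <-]; have [_ DM _] := Kexh_sub l.+1; have [_ DM' DV'] := Kexh_sub l.
split; first by apply: DM => //; exact: Kexh_le (leqnSn l) _ Dx.
move=> Dyx; apply: nDy; rewrite -(mulgK x y); apply: DM' => //; exact: DV'.
Qed.

(** The normalisation [mu (K 1) = 1] enters here: a nonempty difference contains a coset of [D l],
    which contains [K 1]. *)
Let mu_diff_ge1 l y : level y l.+1 -> 1 <= fine (mu (D l.+1 `\` D l)).
Proof.
move=> [Dy /(_ l (leqnn _)) nDy].
rewrite -lee_fin fineK//; exact: le_trans (mu_Kexh_ge1 l) (mu_diff_ge Dy nDy).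
Qed.

Let sq_ge0 n : 0 <= n%:R ^+ 2 :> R. Proof. exact: sqr_ge0. Qed.

Let a_le_b x l : level x l -> a l.+1 <= b l.
Proof.
case: l => [|l] xl; first by rewrite /b lerDl.
rewrite /b; apply: le_trans (_ : (a l.+2 + l.+2%:R ^+ 2) * 1 <= _).
  by rewrite mulr1 lerDl.
rewrite ler_wpM2l//; last exact: mu_diff_ge1 xl.
by rewrite addr_ge0// (le_trans _ (a_ge1 l.+1)).
Qed.

(** Monotonicity is claimed only along levels that are attained: if two consecutive groups coincide,
    the measure of their difference, hence the value of [b], is 0. At attained levels the difference
    for [l] lies in [D m'], [m'] the predecessor of [m], whose measure is at most that of the
    difference for [m]. *)
Let b_le x y l m : level x l -> level y m -> (l <= m)%N -> b l <= b m.
Proof.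
move=> xl ym; rewrite leq_eqVlt => /orP[/eqP->//|].
case: m ym => // m ym lm; rewrite ltnS in lm.
have ma := a_ge1 m.+1; have d1 := mu_diff_ge1 ym.
case: l xl lm => [|l] xl lm.
  rewrite /b; apply: le_trans (_ : (a m.+2 + m.+2%:R ^+ 2) * 1 <= _).
    rewrite mulr1 lerD//; first exact: (@a_le 0 m.+1).
    by rewrite expr2 -natrM (ler_nat _ 1).
  by rewrite ler_wpM2l// addr_ge0// (le_trans _ ma).
rewrite /b; apply: ler_pM.
- by rewrite addr_ge0// (le_trans _ (a_ge1 l.+1)).
- by rewrite fine_ge0.
- apply: lerD; first by apply: a_le; exact: leqW.
  by rewrite lerXn2r// ?nnegrE// ler_nat !ltnS ltnW.
rewrite -lee_fin !fineK//.
have [Dy nDy] := ym; apply: le_trans (mu_diff_ge Dy (nDy m (leqnn _))).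
apply: measureS; [|exact: Kexh_borel|].
  by apply: measurableD; exact: Kexh_borel.
by move=> z [Dz _]; exact: Kexh_le lm _ Dz.
Qed.

Lemma omega_le_sharp x : omega x <= w x.
Proof.
have [l xl] := level_ex x; rewrite (omega_sharpE xl).
exact: le_trans (omega_le_a xl.1) (a_le_b xl).
Qed.

Lemma omega_sharp_ge1 x : 1 <= w x.
Proof. by have [_ om1 _ _ _] := homega; exact: le_trans (om1 x) (omega_le_sharp x). Qed.

Lemma omega_sharp_max x y : w (x * y)%g <= Num.max (w x) (w y).
Proof.
have [l xl] := level_ex x; have [m ym] := level_ex y; have [k xyk] := level_ex (x * y)%g.
rewrite (omega_sharpE xl) (omega_sharpE ym) (omega_sharpE xyk) le_max.
have [lm|/ltnW ml] := leqP l m; apply/orP; [right|left].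
  apply: (b_le xyk ym); apply: (level_le xyk).
  have [_ DM _] := Kexh_sub m; apply: DM; last exact: ym.1.
  exact: Kexh_le lm _ xl.1.
apply: (b_le xyk xl); apply: (level_le xyk).
have [_ DM _] := Kexh_sub l; apply: DM; first exact: xl.1.
exact: Kexh_le ml _ ym.1.
Qed.

Lemma omega_sharp_meas : measurable_fun setT (w : borel G -> R).
Proof.
pose h n x := (a 1%N + 1) * \1_(K 1%N) x + w_series x n.
apply: (@measurable_fun_cvg _ (borel G) R setT h).
  move=> n; apply: measurable_funD.
    apply: measurable_funM; first exact: measurable_cst.
    by apply: measurable_indic; exact: (Kexh_borel 0).
  rewrite /w_series; elim: n => [|n ih].
    by under eq_fun do rewrite big_geq//; exact: measurable_cst.
  have [n2|n2] := leqP n.+1 2.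
    by under eq_fun do rewrite big_geq//; exact: measurable_cst.
  under eq_fun do rewrite big_nat_recr//=.
  apply: measurable_funD => //; apply: measurable_funM; first exact: measurable_cst.
  case: n n2 {ih} => [//|[//|n]] _.
  by apply: measurable_indic; apply: measurableD; exact: Kexh_borel.
move=> x _; have [l xl] := level_ex x; rewrite (omega_sharpE xl).
exact: omega_sharp_cvg.
Qed.

Lemma omega_sharp_weight : weight w.
Proof.
split.
- exact: omega_sharp_meas.
- exact: omega_sharp_ge1.
(* On [C] only the values [b 0], ..., [b n] occur; the sum of their absolute values bounds them
   all. *)
- move=> C /compact_Kexh[n Cn]; exists (\sum_(l < n.+1) `|b l|) => x Cx.
  have [l xl] := level_ex x; rewrite (omega_sharpE xl).
  have ln : (l < n.+1)%N by rewrite ltnS (level_le xl)//; exact: Cn.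
  rewrite (bigD1 (Ordinal ln))//=; apply: le_trans (ler_norm _) _.
  by rewrite lerDl sumr_ge0.
- move=> x y; apply: le_trans (omega_sharp_max x y) _.
  have x1 := omega_sharp_ge1 x; have y1 := omega_sharp_ge1 y.
  rewrite ge_max; apply/andP; split.
    by rewrite ler_peMr// (le_trans _ x1).
  by rewrite ler_peMl// (le_trans _ y1).
- move=> x; have [l xl] := level_ex x; rewrite (omega_sharpE xl).
  apply: omega_sharpE; have [_ _ DV] := Kexh_sub l; split; first exact: DV xl.1.
  move=> m /xl.2 nDx Dx; apply: nDx; have [_ _ DV'] := Kexh_sub m.
  by rewrite -(invgK x); exact: DV'.
Qed.

End standard_decomposition.

(** * Weighted Orlicz norms *)

Section complementary_function.
Context (R : realType) (Phi : R -> \bar R).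
Hypothesis Phi0 : forall x, (0 <= Phi x)%E.

(** A supremum of continuous functions of [y] is lower semicontinuous; an [x] with [Phi x = +oo]
    contributes [-oo] and can be ignored. *)
Lemma measurable_complementary : measurable_fun setT (complementary Phi).
Proof.
apply: lower_semicontinuous_measurable; apply/lower_semicontinuousP => a.
apply: nbhs_open => y /= /ereal_sup_gt[_ [x /= x0 <-] axy].
have [p E] : exists p, Phi x = p%:E.
  by move: axy (Phi0 x); case: (Phi x) => [p|//|//]; exists p.
move: axy; rewrite E -EFinB lte_fin => axy.
have c : (fun y : R => x * `|y| - p) @ y --> x * `|y| - p.
  apply: cvgB; last exact: cvg_cst.
  by apply: cvgMr; apply: norm_continuous.
have : \forall z \near y, a < x * `|z| - p.
  exact: (cvgr_gt _ c _ axy).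
apply: filterS => z az; apply: lt_le_trans (_ : ((x * `|z| - p)%:E <= _)%E).
  by rewrite lte_fin.
by apply: ereal_sup_ubound; exists x => //=; rewrite E EFinB.
Qed.

End complementary_function.

(** * Comparison of weighted Orlicz norms with the L1 norm *)

Section orlicz_norm.
Context (R : realType) (G : topologicalGroupType).
Variable mu : {measure set (borel G) -> \bar R}.
Variable Phi : R -> \bar R.
Implicit Types (f g h u : G -> R[i]) (om : G -> R).

Lemma orlicz_norm_ge g f : cmeasurable g ->
  (\int[mu]_x complementary Phi (modulus (g x)) <= 1)%E ->
  (\int[mu]_x (modulus (f x * g x))%:E <= orlicz_norm mu Phi f)%E.
Proof. by move=> mg g1; apply: ereal_sup_ubound; exists g. Qed.

Lemma cmeas_weighted f om : cmeasurable f ->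
  measurable_fun setT (om : borel G -> R) -> cmeasurable (fun x => f x * (om x)%:C).
Proof. by move=> mf mo; apply: (@cmeasM _ (borel G)) => //; exact: cmeas_real. Qed.

Lemma weighted_orlicz_norm_le f om om' : cmeasurable f ->
  measurable_fun setT (om : borel G -> R) -> measurable_fun setT (om' : borel G -> R) ->
  (forall x, 0 <= om x) -> (forall x, om x <= om' x) ->
  (weighted_orlicz_norm mu Phi om f <= weighted_orlicz_norm mu Phi om' f)%E.
Proof.
move=> mf mo mo' o0 oo'; apply: ge_ereal_sup => _ [h [mh h1] <-].
apply: le_trans (orlicz_norm_ge _ mh h1); apply: ge0_le_integral => //.
- by move=> x _; rewrite lee_fin modulus_ge0.
- by apply: cmeas_emodulus; apply: (@cmeasM _ (borel G)) => //; exact: cmeas_weighted.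
- by apply: cmeas_emodulus; apply: (@cmeasM _ (borel G)) => //; exact: cmeas_weighted.
- move=> x _; rewrite lee_fin !modulusM !modulus_real ler_wpM2r ?modulus_ge0//.
  by rewrite ler_wpM2l ?modulus_ge0// !ger0_norm// (le_trans (o0 x)).
Qed.

Variable Psi : R -> \bar R.
Hypothesis hPhi : complementary_pair Phi Psi.

Let Phi0 x : (0 <= Phi x)%E. Proof. by case: hPhi => /young_ge0. Qed.
Let PsiE : complementary Phi = Psi. Proof. by case: hPhi. Qed.
Let Psi0 x : (0 <= Psi x)%E. Proof. by case: hPhi => _ /young_ge0. Qed.

Lemma emeas_complementary h : cmeasurable h ->
  emeas (fun x => complementary Phi (modulus (h x))).
Proof.
move=> mh; exact: (measurableT_comp (measurable_complementary Phi0) (cmeas_modulus mh)).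
Qed.

(* By convexity [Psi (t * y) <= t * Psi y] for [0 <= t <= 1], so a small multiple
   of [1 / om] is a test function in the definition of the Orlicz norm. *)
Lemma L1_norm_le_weighted_orlicz om : measurable_fun setT (om : borel G -> R) ->
  (forall x, 1 <= om x) -> orlicz mu Psi (fun x => real_complex R (om x)^-1) ->
  exists2 C : R, 0 < C & forall f, cmeasurable f ->
    (L1_norm mu f <= C%:E * weighted_orlicz_norm mu Phi om f)%E.
Proof.
move=> mo o1 [mi [al al0]].
have o0 x : 0 < om x by exact: lt_le_trans (o1 x).
have mr x : modulus (om x)^-1%:C = (om x)^-1.
  by rewrite modulus_real ger0_norm// invr_ge0 ltW.
set I := (\int[mu]_x _)%E => Ioo.
have PI0 x : (0 <= Psi (al * modulus (om x)^-1%:C))%E by exact: Psi0.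
have I0 : (0 <= I)%E by apply: integral_ge0 => x _; exact: PI0.
have fI : I \is a fin_num by rewrite ge0_fin_numE.
(* Ensures both [t <= 1] and [t * I <= 1], also when [I = 0]. *)
pose t := (1 + fine I)^-1.
have p0 : 0 < 1 + fine I by rewrite ltr_pwDl// fine_ge0.
have t0 : 0 < t by rewrite invr_gt0.
have t1 : t <= 1 by rewrite invf_le1// lerDl fine_ge0.
have mP (c : R) : measurable_fun setT (fun x : borel G => Psi (c * modulus (om x)^-1%:C)).
  rewrite -PsiE; apply: (measurableT_comp (measurable_complementary Phi0)).
  apply: measurable_funM; first exact: measurable_cst.
  exact: (cmeas_modulus mi).
exists (t * al)^-1; first by rewrite invr_gt0 mulr_gt0.
move=> f mf; pose g (x : G) : R[i] := (t * al * (om x)^-1)%:C.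
have mg : cmeasurable g.
  have mr' : measurable_fun setT (fun x : borel G => (om x)^-1) := mi.1.
  by apply: (@cmeas_real _ (borel G)); apply: measurable_funM => //; exact: measurable_cst.
have mgE x : modulus (g x) = t * (al * modulus (om x)^-1%:C).
  by rewrite mr modulus_real ger0_norm ?mulrA// !mulr_ge0 ?invr_ge0 ?ltW.
have g1 : (\int[mu]_x complementary Phi (modulus (g x)) <= 1)%E.
  apply: (@le_trans _ _ (\int[mu]_x (t%:E * Psi (al * modulus (om x)^-1%:C)))%E).
    apply: ge0_le_integral => //.
    - by move=> x _; rewrite PsiE.
    - exact: emeas_complementary.
    - exact: measurable_funeM.
    - move=> x _; rewrite PsiE mgE; case: hPhi => _ yPsi _.
      have /(young_convex yPsi) : 0 <= t <= 1 by rewrite ltW.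
      move=> /(_ (al * modulus (om x)^-1%:C) 0).
      by rewrite mulr0 addr0 (young0 yPsi) mule0 adde0.
  rewrite (@ge0_integralZl _ _ _ mu setT measurableT)//; last by rewrite lee_fin ltW.
  rewrite -/I -(fineK fI) -EFinM lee_fin /t ler_pdivrMl// mulr1.
  by rewrite lerDr.
have := orlicz_norm_ge (fun x => f x * (om x)%:C) mg g1.
have -> : (\int[mu]_x (modulus (f x * (om x)%:C * g x))%:E = (t * al)%:E * L1_norm mu f)%E.
  rewrite /L1_norm -(@ge0_integralZl _ _ _ mu setT measurableT).
  - apply: eq_integral => x _; rewrite -EFinM; congr (_%:E).
    rewrite !modulusM mgE mr modulus_real gtr0_norm//.
    rewrite mulrC -!mulrA; congr (_ * (_ * _)).
    by rewrite mulrCA mulVf ?gt_eqF// mulr1.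
  - exact: cmeas_emodulus.
  - by move=> x _; rewrite lee_fin modulus_ge0.
  - by rewrite lee_fin mulr_ge0 ?ltW.
by rewrite lee_pdivlMl// mulr_gt0.
Qed.

(* [om x <= om y + om (y^-1 x)] moves the weight onto one of the two factors, and
   translates of a test function are test functions. The constant is not sharp:
   a factor 2 comes from [modulus_cintegral]. *)
Lemma weighted_orlicz_norm_sq om u : weight om ->
  (forall x y, om (x * y)%g <= Num.max (om x) (om y)) -> forall D : nat -> set G,
  haar_exhaustion mu D -> cmeasurable u ->
  (weighted_orlicz_norm mu Phi om (convolution mu u u) <=
   4%:E * L1_norm mu u * weighted_orlicz_norm mu Phi om u)%E.
Proof.
move=> [mo o1 _ _ _] omax D hD mu_.
have o0 x : 0 <= om x by exact: le_trans ler01 (o1 x).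
set S := weighted_orlicz_norm mu Phi om u.
apply: ge_ereal_sup => _ [h [mh h1] <-].
pose U := emod u; pose V : G -> \bar R := fun x => (modulus (u x) * om x)%:E.
pose E := emod h.
have mU : emeas U := emeas_emod mu_; have U0 := emod_ge0 u.
have mE : emeas E := emeas_emod mh; have E0 := emod_ge0 h.
have V0 x : (0 <= V x)%E by rewrite lee_fin mulr_ge0// modulus_ge0.
have mV : emeas V.
  apply/measurable_EFinP; apply: measurable_funM => //; exact: (cmeas_modulus mu_).
have S0 : (0 <= S)%E.
  apply: le_trans (orlicz_norm_ge _ mh h1).
  by apply: integral_ge0 => x _; rewrite lee_fin modulus_ge0.
have VE x : V x = (modulus (u x * (om x)%:C))%:E.
  by rewrite modulusM modulus_real ger0_norm.
(* If [phi] preserves integrals, [h \o phi] satisfies the same constraint as [h], so it is again a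
   test function for the norm [S]. *)
have transl (phi : G -> G) : continuous phi ->
    (forall F : G -> \bar R, emeas F -> (forall x, 0 <= F x)%E ->
      (\int[mu]_x F (phi x) = \int[mu]_x F x)%E) ->
    (\int[mu]_x (E (phi x) * V x) <= S)%E.
  move=> cphi iphi; pose h' x := h (phi x).
  have mh' : cmeasurable h' := cmeas_comp (continuous_borel cphi) mh.
  have h'1 : (\int[mu]_x complementary Phi (modulus (h' x)) <= 1)%E.
    rewrite (iphi (fun x => complementary Phi (modulus (h x))))//.
      exact: emeas_complementary.
    by move=> x; rewrite PsiE.
  apply: le_trans (orlicz_norm_ge _ mh' h'1).
  rewrite le_eqVlt; apply/orP; left; apply/eqP; apply: eq_integral => x _.
  by rewrite VE -EFinM -modulusM mulrC.
(* With the weight on the right factor, the test function is translated from the left; in [cv2],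
   with the weight on the left factor, it is translated from the right. *)
have cv1 : (\int[mu]_x (E x * ge0_convolution mu U V x) <= L1_norm mu u * S)%E.
  rewrite (ge0_convolution_pairl hD mU mV mE U0 V0 E0).
  rewrite -(@ge0_integralZr _ _ _ mu setT measurableT)//.
  apply: ge0_le_integral => //.
  - move=> y _; apply: mule_ge0 => //; apply: integral_ge0 => x _; exact: mule_ge0.
  - apply: emeasurable_funM => //.
    have mF : measurable_fun setT ((fun z => E z.2 * V (z.1^-1 * z.2)%g)%E :
        borel (G * G)%type -> \bar R).
      exact: (emeasurable_funM (measurable_snd mE) (measurable_ldiv mV)).
    have F0 (z : G * G) : (0 <= E z.2 * V (z.1^-1 * z.2)%g)%E by exact: mule_ge0.
    by have [] := haar_tonelli hD mF F0.
  - exact: emeasurable_funM.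
  - move=> y _; rewrite lee_wpmul2l//.
    rewrite -(ge0_integral_mull hD y).
    + under eq_integral do rewrite mulKg.
      apply: transl; first exact: mull_continuous.
      by move=> F mF F0; exact: (ge0_integral_mull hD).
    + exact: (emeasurable_funM mE (emeas_comp (@mull_continuous _ y^-1%g) mV)).
    + by move=> x; exact: mule_ge0.
  - by move=> x _; exact: U0.
have cv2 : (\int[mu]_x (E x * ge0_convolution mu V U x) <= L1_norm mu u * S)%E.
  rewrite (ge0_convolution_pairr hD mV mU mE V0 U0 E0).
  rewrite -(@ge0_integralZr _ _ _ mu setT measurableT)//.
  apply: ge0_le_integral => //.
  - move=> y _; apply: mule_ge0 => //; apply: integral_ge0 => x _; exact: mule_ge0.
  - apply: emeasurable_funM => //.
    have cm : continuous (fun z : G * G => z.2 * z.1)%g.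
      move=> z; apply: (@cvg_comp _ _ _ (fun z : G * G => (z.2, z.1))
        (fun z : G * G => z.1 * z.2)%g); last exact: (@mulg_continuous G (z.2, z.1)).
      by apply: cvg_pair => /=; [exact: cvg_snd|exact: cvg_fst].
    have mF : measurable_fun setT ((fun z => E (z.2 * z.1)%g * V z.2)%E :
        borel (G * G)%type -> \bar R).
      exact: (emeasurable_funM (measurableT_comp mE (continuous_borel cm)) (measurable_snd mV)).
    have F0 (z : G * G) : (0 <= E (z.2 * z.1)%g * V z.2)%E by exact: mule_ge0.
    by have [] := haar_tonelli hD mF F0.
  - exact: emeasurable_funM.
  - move=> z _; rewrite lee_wpmul2l//.
    apply: transl; first exact: mulr_continuous.
    by move=> F mF F0; exact: (ge0_integral_mulr hD).
  - by move=> x _; exact: U0.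
have mUV := emeas_ge0_convolution hD mU mV U0 V0.
have mVU := emeas_ge0_convolution hD mV mU V0 U0.
have UV0 := ge0_convolution_ge0 mu U0 V0.
have VU0 := ge0_convolution_ge0 mu V0 U0.
(* The factor 2 is that of [modulus_convolution]; each of the two convolutions contributes
   [|u|_1 * S], whence the constant 4. *)
have pt x : ((modulus (convolution mu u u x * (om x)%:C * h x))%:E <=
    2%:E * (E x * ge0_convolution mu U V x + E x * ge0_convolution mu V U x))%E.
  have := modulus_convolution mu x mu_ mu_; rewrite -/U => conv_le.
  have om_le : ((om x)%:E * ge0_convolution mu U U x <=
      ge0_convolution mu U V x + ge0_convolution mu V U x)%E.
    have mK (f : G -> \bar R) : emeas f -> emeas (fun y => f (y^-1 * x)%g).
      by move=> mf; exact: (emeas_comp (@invmul_continuous _ x) mf).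
    rewrite /ge0_convolution -(@ge0_integralZl _ _ _ mu setT measurableT); last 3 first.
    - exact: (emeasurable_funM mU (mK _ mU)).
    - by move=> y _; exact: mule_ge0.
    - by rewrite lee_fin.
    rewrite -(@ge0_integralD _ _ _ mu setT measurableT); last 4 first.
    - by move=> y _; exact: mule_ge0.
    - exact: (emeasurable_funM mU (mK _ mV)).
    - by move=> y _; exact: mule_ge0.
    - exact: (emeasurable_funM mV (mK _ mU)).
    apply: ge0_le_integral => //.
    - by move=> y _; apply: mule_ge0; [rewrite lee_fin|exact: mule_ge0].
    - by apply: measurable_funeM; exact: (emeasurable_funM mU (mK _ mU)).
    - apply: emeasurable_funD; first exact: (emeasurable_funM mU (mK _ mV)).
      exact: (emeasurable_funM mV (mK _ mU)).
    - move=> y _; rewrite -!EFinM -EFinD lee_fin.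
      set p := modulus (u y); set q := modulus (u (y^-1 * x)%g).
      have p0 : 0 <= p := modulus_ge0 _; have q0 : 0 <= q := modulus_ge0 _.
      have oxy : om x <= om y + om (y^-1 * x)%g.
        rewrite -{1}(mulVKg y x); apply: le_trans (omax _ _) _.
        by rewrite ge_max lerDl lerDr !o0.
      have := ler_wpM2r (mulr_ge0 p0 q0) oxy; lra.
  rewrite -(ge0_muleDr (E x) (UV0 x) (VU0 x)).
  apply: le_trans (_ : E x * (2%:E * ((om x)%:E * ge0_convolution mu U U x)) <= _)%E.
    rewrite modulusM modulusM modulus_real (ger0_norm (o0 x)) mulrC EFinM.
    rewrite lee_wpmul2l ?lee_fin ?modulus_ge0// mulrC EFinM muleCA.
    by rewrite lee_wpmul2l ?lee_fin.
  by rewrite muleCA lee_wpmul2l ?lee_fin// lee_wpmul2l.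
pose W x : \bar R := (E x * ge0_convolution mu U V x + E x * ge0_convolution mu V U x)%E.
have W0 x : (0 <= W x)%E by rewrite /W adde_ge0// mule_ge0.
have mW : emeas W.
  apply: emeasurable_funD; [exact: (emeasurable_funM mE mUV)|exact: (emeasurable_funM mE mVU)].
have : (\int[mu]_x (modulus (convolution mu u u x * (om x)%:C * h x))%:E <=
    \int[mu]_x (2%:E * W x))%E.
  apply: ge0_le_integral => //.
  - by move=> x _; rewrite lee_fin modulus_ge0.
  - apply: cmeas_emodulus; apply: (@cmeasM _ (borel G)) => //; apply: cmeas_weighted => //.
    exact: (cmeasurable_convolution hD).
  - exact: measurable_funeM.
  - by move=> x _; exact: pt.
move=> /le_trans; apply.
rewrite (@ge0_integralZl _ _ _ mu setT measurableT); last 3 first.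
- exact: mW.
- by move=> x _; exact: W0.
- by rewrite lee_fin.
rewrite (@ge0_integralD _ _ _ mu setT measurableT); last 4 first.
- by move=> x _; rewrite mule_ge0.
- exact: (emeasurable_funM mE mUV).
- by move=> x _; rewrite mule_ge0.
- exact: (emeasurable_funM mE mVU).
have L0 := L1_norm_ge0 mu u.
have : (2%:E * (\int[mu]_x (E x * ge0_convolution mu U V x) +
    \int[mu]_x (E x * ge0_convolution mu V U x)) <=
    2%:E * (L1_norm mu u * S + L1_norm mu u * S))%E.
  by rewrite lee_wpmul2l ?lee_fin// leeD.
move=> /le_trans; apply.
rewrite -mule2n -mule_natl muleA -EFinM.
by rewrite -natrM -muleA.
Qed.

End orlicz_norm.

(** * Comparison of spectral radii *)

(** Comparing strict bounds with a gap between [r] and [r'] leaves room for constants. Nonnegativity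
    of [X] gives [0 <= sup X], which settles an empty [Y], whose [sup] is 0, and makes [r]
    positive. *)
Lemma sup_le_sup_approx (R : realType) (X Y : set R) :
  (forall x, X x -> 0 <= x) -> has_ubound X ->
  (forall r r', 0 < r -> r < r' ->
    (forall x, X x -> x < r) -> forall y, Y y -> y < r') ->
  sup Y <= sup X.
Proof.
move=> X0 uX XY.
have s0 : 0 <= sup X.
  have [->|/set0P[x Xx]] := eqVneq X set0; first by rewrite sup0.
  by apply: le_trans (X0 x Xx) _; exact: ub_le_sup.
have [->|/set0P Y0] := eqVneq Y set0; first by rewrite sup0.
apply: ge_sup => // y Yy; rewrite leNgt; apply/negP => sy.
set s := sup X in s0 sy.
(* If [s < y], the points at one third and two thirds of the way from [s] to [y] serve as [r] and
   [r']. *)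
suff : y < (s + 2 * y) / 3 by lra.
apply: (XY ((2 * s + y) / 3) _ _ _ _ y Yy); [lra|lra|].
move=> x Xx; have : x <= s by exact: ub_le_sup.
lra.
Qed.

Lemma le_expn2_eventually (R : realType) (b r r' : R) : 0 < r -> r < r' ->
  exists j0, forall j, (j0 <= j)%N -> b * r ^+ (2 ^ j) <= r' ^+ (2 ^ j).
Proof.
move=> r0 rr'; have r'0 : 0 < r' := lt_trans r0 rr'.
have q1 : `|r / r'| < 1 by rewrite gtr0_norm ?divr_gt0// ltr_pdivrMr// mul1r.
have : b * (r / r') ^+ n @[n --> \oo] --> b * 0.
  by apply: cvgM; [exact: cvg_cst|exact: cvg_expr].
rewrite mulr0 => /cvgr_le /(_ 1 ltr01) [j0 _ Hj0]; exists j0 => j j0j.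
have /Hj0 : (j0 <= 2 ^ j)%N by rewrite (leq_trans j0j)// ltnW// ltn_expl.
by rewrite /= expr_div_n mulrA ler_pdivrMr ?exprn_gt0// mul1r.
Qed.

Section small.
Context (R : realType) (G : topologicalGroupType).
Variable mu : {measure set (borel G) -> \bar R}.
Variables (A : set (G -> R[i])) (N : (G -> R[i]) -> \bar R).
Variable H : convolution_algebra mu A N.
Variables (M : R) (M0 : 0 < M).
Hypothesis NM : forall f g, A f -> A g ->
  (N (convolution mu f g) <= M%:E * N f * N g)%E.
Variable f : G -> R[i].
Hypothesis Af : A f.
Implicit Types r : R.

Let u_fin k : N (conv_sq mu f k) \is a fin_num.
Proof. by have /andP[? ?] := ca_norm_fin H (conv_sq_mem H k Af); rewrite ge0_fin_numE. Qed.

Let u_ge0 k : 0 <= fine (N (conv_sq mu f k)).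
Proof. by have /andP[? ?] := ca_norm_fin H (conv_sq_mem H k Af); rewrite fine_ge0. Qed.

(** Since [M * N (u * u) <= (M * N u)^2], a bound [t / 2] becomes [t^2 / 4], which is below
    [t^2 / 2]. *)
Lemma conv_sq_small_ge r k j : (k <= j)%N ->
  M * fine (N (conv_sq mu f k)) <= 1 / 2 * r ^+ (2 ^ k) ->
  M * fine (N (conv_sq mu f j)) <= 1 / 2 * r ^+ (2 ^ j).
Proof.
move=> kj k_small; rewrite -(subnKC kj); elim: (j - k)%N => [|i ih].
  by rewrite addn0.
rewrite addnS expnSr exprM; move: (k + i)%N ih => l l_small.
have : fine (N (conv_sq mu f l.+1)) <= M * fine (N (conv_sq mu f l)) ^+ 2.
  rewrite -lee_fin EFinM fineK// expr2 EFinM fineK// muleA.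
  by apply: NM; exact: (conv_sq_mem H).
have := u_ge0 l; move: l_small; set n := fine _; set n' := fine _; set t := r ^+ _.
move=> h1 n0 h2.
have h3 : (M * n) ^+ 2 <= (1 / 2 * t) ^+ 2.
  by rewrite !expr2 ler_pM// mulr_ge0// ltW.
have h4 : M * n' <= (M * n) ^+ 2.
  by rewrite exprMn expr2 -mulrA ler_wpM2l// ltW.
have := sqr_ge0 t; nra.
Qed.

Lemma conv_sq_small_of_bound r r' b k : 0 < r -> r < r' ->
  (forall j, (k <= j)%N -> (N (conv_sq mu f j) <= (b * r ^+ (2 ^ j))%:E)%E) ->
  exists j, M * fine (N (conv_sq mu f j)) <= 1 / 2 * r' ^+ (2 ^ j).
Proof.
move=> r0 rr' Nb; have [j0 Hj0] := le_expn2_eventually (2 * M * b) r0 rr'.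
exists (maxn k j0).
have := Hj0 _ (leq_maxr k j0); have := Nb _ (leq_maxl k j0).
move: (maxn k j0) => j; rewrite -(fineK (u_fin j)) lee_fin => h1 h2.
have := ler_wpM2l (ltW M0) h1; lra.
Qed.

(** The criterion with [k = 0]. Boundedness matters because [sup] of an unbounded set is 0 by
    convention. *)
Lemma spectrum_bounded : exists r, forall c, spectrum mu A f c -> modulus c < r.
Proof.
pose r := 2 * (M * fine (N f)) + 1.
have n0 : 0 <= M * fine (N f) by rewrite mulr_ge0 ?(ltW M0)//; exact: (u_ge0 0).
exists r; apply: (small_spectrum_lt H M0 NM (k := 0)) => //.
  by rewrite /r; lra.
by rewrite expn0 expr1 /r /=; lra.
Qed.

End small.

(** Transfers growth of the iterated squares from one norm to another. The constant [b] may depend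
    on [r] and on the starting index [k], but not on [j]. *)
Lemma spectral_radius_le (R : realType) (G : topologicalGroupType)
    (mu : {measure set (borel G) -> \bar R}) (A A' : set (G -> R[i])) N N' M M' f :
  convolution_algebra mu A N -> 0 < M ->
  (forall g h, A g -> A h -> (N (convolution mu g h) <= M%:E * N g * N h)%E) ->
  convolution_algebra mu A' N' -> 0 < M' ->
  (forall g h, A' g -> A' h -> (N' (convolution mu g h) <= M'%:E * N' g * N' h)%E) ->
  A f -> A' f ->
  (forall (r : R) k, 0 < r ->
    (forall j, (k <= j)%N -> M * fine (N (conv_sq mu f j)) <= 1 / 2 * r ^+ (2 ^ j)) ->
    exists b, forall j, (k <= j)%N -> (N' (conv_sq mu f j) <= (b * r ^+ (2 ^ j))%:E)%E) ->
  spectral_radius mu A' f <= spectral_radius mu A f.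
Proof.
move=> H M0 NM H' M'0 NM' Af A'f cmp; apply: sup_le_sup_approx.
- by move=> _ [c _ <-]; exact: modulus_ge0.
- have [r Hr] := spectrum_bounded H M0 NM Af.
  by exists r => _ [c sc <-]; exact/ltW/Hr.
move=> r r' r0 rr' Ar _ [c sc <-].
have [k k_small] := spectrum_lt_small H M0 NM Af r0 (fun c sc => Ar _ (imageP _ sc)).
have [b Hb] := cmp r k r0 (fun j kj => conv_sq_small_ge H M0 NM Af kj k_small).
have [j j_small] := conv_sq_small_of_bound H' M'0 A'f r0 rr' Hb.
exact: (small_spectrum_lt H' M'0 NM' A'f (lt_trans r0 rr') j_small).
Qed.

(** * Equality of the two spectral radii *)

Theorem theorem1p1 (R : realType) (G : topologicalGroupType)
    (mu : {measure set (borel G) -> \bar R}) (K : nat -> set G)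
    (Phi Psi : R -> \bar R) (omega : G -> R)
    (hG : locally_elliptic G) (ncG : ~ compact [set: G])
    (hK : standard_decomposition K)
    (hmu : haar_measure mu) (muK1 : mu (K 1%N) = 1%E)
    (hPhi : complementary_pair Phi Psi)
    (homega : orlicz_weight mu Phi omega)
    (hinv : orlicz mu Psi (fun x => real_complex R (omega x)^-1)) :
  [/\ weight (omega_sharp mu K omega),
      weighted_orlicz mu Phi (omega_sharp mu K omega)
        `<=` weighted_orlicz mu Phi omega
    & forall f, weighted_orlicz mu Phi (omega_sharp mu K omega) f ->
        spectral_radius mu (weighted_orlicz mu Phi omega) f
        = spectral_radius mu (L1 mu) f].
Proof.
have [wo HA] := homega; have {}HA := banach_star_algebra_convolution HA.
have hD := Kexh_haar hG hK hmu muK1.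
have HL := L1_convolution_algebra hD.
have ws := omega_sharp_weight hK hmu muK1 wo.
have [mo o1 _ _ _] := wo; have [ms s1 _ _ _] := ws.
set N := weighted_orlicz_norm mu Phi omega in HA.
pose S := weighted_orlicz_norm mu Phi (omega_sharp mu K omega).
have NS u : cmeasurable u -> (N u <= S u)%E.
  move=> mu_; apply: weighted_orlicz_norm_le => // x.
    exact: le_trans ler01 (o1 x).
  exact: (omega_le_sharp hK hmu muK1 wo).
have AA f : weighted_orlicz mu Phi (omega_sharp mu K omega) f ->
    weighted_orlicz mu Phi omega f.
  move=> [[mf af] Sf]; split; [by []|exact: le_lt_trans (NS f mf) Sf].
split => // f Sf; have Af := AA f Sf; have [[mf _] Sfoo] := Sf.
have [M M0 NM] := ca_norm_conv HA.
have NL g h : L1 mu g -> L1 mu h ->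
    (L1_norm mu (convolution mu g h) <= 2%:E * L1_norm mu g * L1_norm mu h)%E.
  by move=> [mg _] [mh _]; exact: (L1_convolution_norm hD).
have [C C0 L1C] := L1_norm_le_weighted_orlicz hPhi mo o1 hinv.
have Afin g : weighted_orlicz mu Phi omega g -> N g \is a fin_num.
  by move=> Ag; have /andP[? ?] := ca_norm_fin HA Ag; rewrite ge0_fin_numE.
have AL g : weighted_orlicz mu Phi omega g -> L1 mu g.
  move=> Ag; have [[mg _] _] := Ag; split=> //; apply: le_lt_trans (L1C g mg) _.
  by rewrite -/N -(fineK (Afin g Ag)) -EFinM ltry.
have Au j := conv_sq_mem HA j Af; have Lu j := AL _ (Au j).
have Lfin j : L1_norm mu (conv_sq mu f j) \is a fin_num.
  by rewrite ge0_fin_numE ?L1_norm_ge0//; have [] := Lu j.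
apply/le_anti/andP; split; last first.
  apply: (spectral_radius_le HA M0 NM HL (ltr0n _ 2) NL) => //; first exact: AL.
  (* From [|u|_1 <= C * N u] and [M * N u <= r^(2^j) / 2]. *)
  move=> r k r0 Nk; exists (C / (2 * M)) => j /Nk.
  have [[mj _] _] := Au j; set P := r ^+ _ => MN.
  apply: le_trans (L1C _ mj) _; rewrite -/N -(fineK (Afin _ (Au j))) -EFinM lee_fin.
  rewrite -mulrA ler_wpM2l ?(ltW C0)// invfM mulrAC mulrC ler_pdivlMl//.
  by rewrite -[2^-1]mul1r.
apply: (spectral_radius_le HL (ltr0n _ 2) NL HA M0 NM) => //; first exact: AL.
have S0 j : (0 <= S (conv_sq mu f j))%E.
  have [[mj _] _] := Au j.
  by apply: le_trans (NS _ mj); have /andP[] := ca_norm_fin HA (Au j).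
have S_step j : (S (conv_sq mu f j.+1) <=
    4%:E * L1_norm mu (conv_sq mu f j) * S (conv_sq mu f j))%E.
  apply: (weighted_orlicz_norm_sq hPhi ws _ hD); last by have [[]] := Au j.
  exact: (omega_sharp_max hK hmu muK1 wo).
have Sfin j : S (conv_sq mu f j) \is a fin_num.
  rewrite ge0_fin_numE//; elim: j => [//|j ih].
  apply: le_lt_trans (S_step j) _.
  have fj : S (conv_sq mu f j) \is a fin_num by rewrite ge0_fin_numE.
  by rewrite -(fineK (Lfin j)) -(fineK fj) -!EFinM ltry.
move=> r k r0 Lk; pose s j := fine (S (conv_sq mu f j)).
(* Chosen so that equality holds at [j = k]. In the induction [Lk] gives [4 * |u_l|_1 <= r^(2^l)],
   hence [s l.+1 <= r^(2^l) * s l], which matches the squaring of [r^(2^l)]. *)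
exists (s k / r ^+ (2 ^ k)) => j kj.
have [[mj _] _] := Au j; apply: le_trans (NS _ mj) _.
rewrite -(fineK (Sfin j)) lee_fin -/(s j).
rewrite -(subnKC kj); elim: (j - k)%N => [|i ih].
  by rewrite addn0 divfK// gt_eqF// exprn_gt0.
rewrite addnS; move: (Lk _ (leq_addr i k)) (S_step (k + i)%N); move: (k + i)%N ih => l ih.
rewrite -(fineK (Lfin l)) -(fineK (Sfin l)) -(fineK (Sfin l.+1)) -!EFinM lee_fin -/(s l) -/(s l.+1).
set t := fine (L1_norm _ _) => h1 h2.
have sl0 : 0 <= s l by rewrite fine_ge0.
apply: le_trans h2 _; rewrite expnSr exprM expr2 mulrCA.
have t0 : 0 <= t by rewrite fine_ge0// L1_norm_ge0.
by rewrite ler_pM ?mulr_ge0//; move: h1; rewrite /=; lra.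
Qed.
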